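(* Consider the two-color randomly reinforced urn described in the context, and let $N_{n,1}=\sum_{j=1}^nX_{j,1}$ be the number of type $1$ balls drawn in the first $n$ samplings. Suppose $m_1=m_2>0$ and $\mathsf{E}[U_{1,k}^p]<\infty$, $k=1,2$, for some $p>2$. Then $$\sqrt{n}\left(\frac{N_{n,1}}{n}-Z_\infty\right)\overset{d}{\to}h(\omega)\cdot N(0,1)\quad\text{stably},$$ where $h(\omega)=\sqrt{Z_\infty(1-Z_\infty)}\sqrt{(1-Z_\infty)(2\sigma_1^2-1)+Z_\infty(2\sigma_2^2-1)}$ and $N(0,1)$ is a standard normal random variable independent of the original $\sigma$-field $\mathcal{A}$ (in particular of $\mathcal{F}_\infty$).
   Context: Two-color randomly reinforced urn, defined on a probability space with $\sigma$-field $\mathcal{A}$. The initial composition $(Y_{0,1},Y_{0,2})$ consists of fixed real numbers $Y_{0,1}>0$, $Y_{0,2}>0$. The reinforcement vectors $(U_{l,1},U_{l,2})$, $l=1,2,\ldots$, are independent identically distributed random vectors with nonnegative real coordinates (the two coordinates of one vector may be dependent); $m_k=\mathsf{E}[U_{1,k}]$. Let $X_{m,k}\in\{0,1\}$ indicate that the $m$-th drawn ball is of type $k$, so $X_{m,1}+X_{m,2}=1$. Let $\mathcal{F}_n=\sigma(U_{l,k},X_{l,k},Y_{l,k}: k=1,2;\ l=1,\ldots,n)$, $\mathcal{F}_0$ trivial, $\mathcal{F}_\infty=\bigvee_n\mathcal{F}_n$. At stage $m+1$ a ball of type $k$ is drawn with probability $\mathsf{P}(X_{m+1,k}=1\mid\mathcal{F}_m)=Y_{m,k}/(Y_{m,1}+Y_{m,2})$,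 the vector $(U_{m+1,1},U_{m+1,2})$ is independent of $\sigma(\mathcal{F}_m,X_{m+1,1},X_{m+1,2})$, and $Y_{m+1,k}=Y_{m,k}+X_{m+1,k}U_{m+1,k}$ for $k=1,2$. Notation: $Z_n=Y_{n,1}/(Y_{n,1}+Y_{n,2})$; $Z_\infty=\lim_n Z_n$, which exists a.s. with $0<Z_\infty<1$ a.s. when $m_1=m_2>0$ and $\mathsf{E}[U_{1,k}^q]<\infty$ for some $q>1$; $\sigma_k^2=\mathsf{E}[(U_{1,k}/m_k)^2]$. Stable convergence $\xi_n\overset{d}{\to}\xi$ stably: the limit $\xi$ is defined on an extension of the probability space and, for any bounded continuous $f:\mathbb{R}\to\mathbb{R}$ and any event $E\in\mathcal{A}$, $\mathsf{E}[f(\xi_n)I_E]\to\mathsf{E}[f(\xi)I_E]$. *)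

(* Defs.v *)
From HB Require Import structures.
From mathcomp Require Import all_boot all_order all_algebra.
From mathcomp Require Import all_classical all_reals all_analysis.
Set Implicit Arguments.
Unset Strict Implicit.
Unset Printing Implicit Defensive.
Import Order.TTheory GRing.Theory Num.Theory.
Import numFieldNormedType.Exports.
Local Open Scope classical_set_scope.
Local Open Scope ring_scope.

Section sigma_algebras.
Context {d} {T : measurableType d} {R : realType} (P : probability T R).
Local Open Scope ereal_scope.

Definition sigma_rv (I : Type) (V : I -> T -> R) : set (set T) :=
  <<s \bigcup_(i in [set: I]) g_sigma_algebra_preimage (V i) >>.

Definition indep_sets (F G : set (set T)) : Prop :=
  forall A B, F A -> G B -> P (A `&` B) = P A * P B.

Definition mutually_indep (I : choiceType) (F : I -> set (set T)) : Prop :=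
  forall (s : seq I) (A : I -> set T), uniq s ->
    (forall i, i \in s -> F i (A i)) ->
    P (\bigcap_(i in [set` s]) A i) = \big[*%E/1]_(i <- s) P (A i).

(* [Z] is a version of the conditional probability of the event [E] given the
   sigma-algebra [F]. *)
Definition is_cond_prob (F : set (set T)) (E : set T) (Z : T -> R) : Prop :=
  [/\ forall B, measurable B -> F (Z @^-1` B),
      P.-integrable setT (EFin \o Z) &
      forall A, F A -> \int[P]_(w in A) (Z w)%:E = P (E `&` A)].

End sigma_algebras.

Definition type1 : 'I_2 := ord0.
Definition type2 : 'I_2 := ord_max.

Section urn.
Context {d} {T : measurableType d} {R : realType} (P : probability T R).

(* Draws and reinforcements are numbered from 1: [U 0] and [X 0] are unused. *)
Variables (y0 : 'I_2 -> R) (U X : nat -> 'I_2 -> {RV P >-> R}).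

Fixpoint urn_Y (n : nat) (k : 'I_2) (w : T) : R :=
  if n is m.+1 then urn_Y m k w + X m.+1 k w * U m.+1 k w else y0 k.

Definition urn_frac (n : nat) (k : 'I_2) (w : T) : R :=
  urn_Y n k w / (urn_Y n type1 w + urn_Y n type2 w).

Definition urn_F (n : nat) : set (set T) :=
  <<s \bigcup_(l in [set l : nat | (1 <= l <= n)%N])
        (sigma_rv (U l) `|` sigma_rv (X l) `|` sigma_rv (urn_Y l)) >>.

Record reinforced_urn : Prop := {
  urn_y0_gt0 : forall k, 0 < y0 k ;
  urn_U_ge0 : forall l k w, 0 <= U l.+1 k w ;
  urn_U_indep : mutually_indep P (fun l => sigma_rv (U l.+1)) ;
  urn_U_ident : forall l (B : set (R * R)), measurable B ->
    pushforward P (fun w => (U l.+1 type1 w, U l.+1 type2 w)) B =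
    pushforward P (fun w => (U 1%N type1 w, U 1%N type2 w)) B ;
  urn_X_01 : forall m k w, X m.+1 k w = 0 \/ X m.+1 k w = 1 ;
  urn_X_sum : forall m w, X m.+1 type1 w + X m.+1 type2 w = 1 ;
  urn_draw : forall m k,
    is_cond_prob P (urn_F m) [set w | X m.+1 k w = 1] (urn_frac m k) ;
  urn_U_indep_past : forall m,
    indep_sets P (sigma_rv (U m.+1)) <<s urn_F m `|` sigma_rv (X m.+1) >> }.

Definition urn_Z (n : nat) (w : T) : R := urn_frac n type1 w.

(* [limn] is total; only its value on the almost sure event where the sequence
   converges matters. *)
Definition urn_Zinf (w : T) : R := limn (fun n => urn_Z n w).

Definition urn_N1 (n : nat) (w : T) : R := \sum_(1 <= j < n.+1) X j type1 w.

Definition urn_mean (k : 'I_2) : R := fine ('E_P[U 1%N k])%E.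

Definition urn_sigma2 (k : 'I_2) : R :=
  fine ('E_P[(fun w => (U 1%N k w / urn_mean k) ^+ 2)%R])%E.

Definition urn_h (w : T) : R :=
  Num.sqrt (urn_Zinf w * (1 - urn_Zinf w)) *
  Num.sqrt ((1 - urn_Zinf w) * (2 * urn_sigma2 type1 - 1) +
            urn_Zinf w * (2 * urn_sigma2 type2 - 1)).

End urn.

Section stable_convergence.
Context {d d'} {T : measurableType d} {T' : measurableType d'} {R : realType}.
Variables (P : probability T R) (Q : probability T' R) (pr : {mfun T' >-> T}).

(* [(T', Q)], with the projection [pr], extends [(T, P)]: an event [E] of the
   latter is identified with [pr @^-1` E], and a random variable [X] of the
   latter with [X \o pr]. *)
Definition prob_extension : Prop :=
  forall E : set T, measurable E -> pushforward Q pr E = P E.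

Definition standard_normal (N : {RV Q >-> R}) : Prop :=
  forall B : set R, measurable B -> distribution Q N B = normal_prob 0 1 B.

Definition indep_of_base (N : {RV Q >-> R}) : Prop :=
  indep_sets Q (g_sigma_algebra_preimage N) (g_sigma_algebra_preimage pr).

Definition stable_cvg (xi : nat -> T -> R) (zeta : T' -> R) : Prop :=
  forall f : R -> R, continuous f -> bounded_fun f ->
  forall E : set T, measurable E ->
    ('E_P[(fun w => f (xi n w) * \1_E w)%R])%E @[n --> \oo] -->
    ('E_Q[(fun w' => f (zeta w') * \1_(pr @^-1` E) w')%R])%E.

End stable_convergence.

(* Such extensions exist: take the product with the standard normal law. *)
Lemma standard_normal_extension_exists {d} {T : measurableType d}
    {R : realType} (P : probability T R) :
  exists d' (T' : measurableType d') (Q : probability T' R)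
    (pr : {mfun T' >-> T}) (N : {RV Q >-> R}),
  [/\ prob_extension P Q pr, standard_normal N & indep_of_base pr N].
Proof.
pose nu : probability (measurableTypeR R) R := normal_prob 0 1.
pose Q : probability (T * measurableTypeR R)%type R := (P \x nu)%E.
have mpr : measurable_fun setT (fst : T * measurableTypeR R -> T).
  exact: measurable_fst.
pose snd' (x : T * measurableTypeR R) : R := x.2.
have mN : measurable_fun setT snd'.
  by move=> _ B mB; exact: (measurable_snd measurableT B mB).
pose pr : {mfun _ >-> T} := mfun_Sub (mem_set mpr).
pose N : {RV Q >-> R} := mfun_Sub (mem_set mN).
have QE A B : measurable A -> measurable B -> Q (A `*` B) = (P A * nu B)%E.
  by move=> mA mB; exact: product_measure1E.
exists _, _, Q, pr, N; split.
- move=> E mE; rewrite /pushforward (_ : pr @^-1` E = E `*` setT); last first.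
    by apply/seteqP; split => x //= [].
  by rewrite QE// probability_setT mule1.
- move=> B mB; rewrite /distribution /pushforward.
  rewrite (_ : N @^-1` B = setT `*` B); last first.
    by apply/seteqP; split => x //= [].
  by rewrite QE// probability_setT mul1e.
- move=> _ _ [B mB <-] [A mA <-]; rewrite !setTI.
  rewrite (_ : N @^-1` B = setT `*` B); last first.
    by apply/seteqP; split => x //= [].
  rewrite (_ : pr @^-1` A = A `*` setT); last first.
    by apply/seteqP; split => x //= [].
  by rewrite -setXI setTI setIT !QE// !probability_setT mul1e mule1 muleC.
Qed.

(* Main.v *)
(* Write [S_n] for the total weight, [Z_n] for the proportion of type 1, and [m] for
   the common mean. The increment [Z_{n+1} - Z_n] is a martingale difference up to an
   error of second order in [U_{n+1} / S_n]; an exponential supermartingale for [S_n]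
   gives [E S_n^-2 = O(n^-2)], hence [E |Z_b - Z_a| = O(a^(-1/2))] and the almost sure
   convergence of [Z_n]. Summation by parts and [S_j ~ m j] turn
   [sqrt n (N_n / n - Z_oo)] into a sum over [j < n^2] of martingale differences
     [a_j (X_{j+1} - Z_j) - b_j xi_{j+1} / m]   (the array [arr_D] below),
   where [xi_{j+1}] is the numerator of [Z_{j+1} - Z_j], up to a term that tends to 0
   in mean. Given the past, the variance of the [j]-th difference is a polynomial in
   [Z_j], and with [Z_j] frozen at a fixed time [k] the variances sum to [h^2] at [Z_k].
   Lindeberg's replacement, carried out against bounded weights measurable at time
   [k], compares the law of the sum with a normal mixture of variance [h^2(Z_k)], with
   an error [O(k^(-1/2))] in the limit. Events are approximated by such weights, and
   bounded continuous test functions by iterated moving averages. *)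
Require Import Defs.
From HB Require Import structures.
From mathcomp Require Import all_boot all_order all_algebra.
From mathcomp Require Import all_classical all_reals all_analysis.
From mathcomp Require Import measurable_realfun ring lra.
Set Implicit Arguments.
Unset Strict Implicit.
Unset Printing Implicit Defensive.
Import Order.TTheory GRing.Theory Num.Theory.
Import numFieldNormedType.Exports.
Local Open Scope classical_set_scope.
Local Open Scope ring_scope.


(** * Integrability and expectation of real random variables *)

Section expectation_toolkit.
Context {d} {T : measurableType d} {R : realType} (P : probability T R).
Implicit Types f g : T -> R.

(** The limit variance [h^2(Z_oo)] is random and known only at infinity, whereas Lindeberg's
    replacement needs the remaining variance to be known when a difference is replaced. This is the
    reason for freezing [Z] at a time [k]: [n] tends to infinity first, and [k] only afterwards. The
    event in the definition of stable convergence need not belong to [F_oo]; it suffices that its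
    residual, after subtraction of a weight, is nearly orthogonal to everything observed at finite
    times. The factor [2 sigma^2 - 1] has two sources. For [j < n] both [a_j] and [b_j] are
    [n^(-1/2)], and up to the factor [z (1 - z)] and the mixing of the two types the conditional
    variances add up to [sigma^2 - 1], the variance of [U / m]. For [j >= n] one has [a_j = 0] and
    [b_j = sqrt n / (j + 1)], and these terms add up to nearly [sigma^2]: the further movement of
    [Z] towards its limit. Characteristic functions are avoided: the normal law enters through the
    heat semigroup [gsmooth], whose heat equation follows from Stein's identity. *)

Definition L1 f := P.-integrable setT (EFin \o f).

(** Expectations are real numbers, so that linear arithmetic applies to them; the value is
    meaningful only together with [L1], as an infinite integral would give 0. *)
Definition Ex f : R := \int[P]_w f w.

Lemma L1_meas f : L1 f -> measurable_fun setT f.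
Proof. by case/integrableP => /measurable_EFinP. Qed.

Lemma L1_bnd f (C : R) : measurable_fun setT f -> (forall w, `|f w| <= C) -> L1 f.
Proof.
move=> mf fC; apply: (@le_integrable _ _ _ P setT measurableT _ (fun=> C%:E)) => //.
- exact/measurable_EFinP.
- move=> w _ /=; rewrite lee_fin (le_trans (fC w))//; exact: ler_norm.
- exact: finite_measure_integrable_cst.
Qed.

Lemma L1_cst (c : R) : L1 (fun=> c).
Proof. exact: finite_measure_integrable_cst. Qed.

Lemma L1_dom f g : measurable_fun setT f -> L1 g ->
  (forall w, `|f w| <= g w) -> L1 f.
Proof.
move=> mf lg fg; apply: (@le_integrable _ _ _ P setT measurableT _ (EFin \o g)) => //.
- exact/measurable_EFinP.
- move=> w _ /=; rewrite lee_fin (le_trans (fg w))//; exact: ler_norm.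
Qed.

Lemma L1D f g : L1 f -> L1 g -> L1 (fun w => f w + g w).
Proof. by move=> lf lg; have := integrableD measurableT lf lg. Qed.

Lemma L1Z (c : R) f : L1 f -> L1 (fun w => c * f w).
Proof. by move=> lf; have := integrableZl measurableT c lf. Qed.

Lemma L1N f : L1 f -> L1 (fun w => - f w).
Proof. by move=> /(L1Z (-1)); congr L1; apply/funext => w; rewrite mulN1r. Qed.

Lemma L1B f g : L1 f -> L1 g -> L1 (fun w => f w - g w).
Proof. by move=> lf /L1N; exact: L1D. Qed.

Lemma L1_abs f : L1 f -> L1 (fun w => `|f w|).
Proof. by move=> lf; have := integrable_norm lf. Qed.

Lemma L1_sum (I : Type) (s : seq I) (Q : pred I) (F : I -> T -> R) :
  (forall i, Q i -> L1 (F i)) -> L1 (fun w => \sum_(i <- s | Q i) F i w).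
Proof.
move=> lF; elim: s => [|i s IH].
  rewrite (_ : (fun _ => _) = (fun=> 0)); first exact: L1_cst.
  by apply/funext => w; rewrite big_nil.
case: (boolP (Q i)) => Qi; last first.
  by rewrite (_ : (fun _ => _) = fun w => \sum_(i <- s | Q i) F i w)//;
    apply/funext => w; rewrite big_cons (negbTE Qi).
rewrite (_ : (fun _ => _) = fun w => F i w + \sum_(i <- s | Q i) F i w).
  by apply: L1D => //; exact: lF.
by apply/funext => w; rewrite big_cons Qi.
Qed.

Lemma L1M_bnd f g (C : R) : measurable_fun setT f -> (forall w, `|f w| <= C) ->
  L1 g -> L1 (fun w => f w * g w).
Proof.
move=> mf fC lg; apply: (@L1_dom _ (fun w => C * `|g w|)).
- by apply: measurable_funM => //; exact: L1_meas.
- exact/L1Z/L1_abs.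
- by move=> w; rewrite normrM ler_wpM2r.
Qed.

Lemma L1_sqr f : measurable_fun setT f -> L1 (fun w => f w ^+ 2) -> L1 f.
Proof.
move=> mf lf; apply: (@L1_dom _ (fun w => 1 + f w ^+ 2)) => //.
  by apply: L1D => //; exact: L1_cst.
by move=> w; rewrite ler_norml; apply/andP; split; nra.
Qed.

Lemma L1_mul f g : measurable_fun setT f -> measurable_fun setT g ->
  L1 (fun w => f w ^+ 2) -> L1 (fun w => g w ^+ 2) -> L1 (fun w => f w * g w).
Proof.
move=> mf mg lf lg; apply: (@L1_dom _ (fun w => f w ^+ 2 + g w ^+ 2)).
- exact: measurable_funM.
- exact: L1D.
- move=> w; have h1 := sqr_ge0 (f w + g w); have h2 := sqr_ge0 (f w - g w).
  have h3 := sqr_ge0 (f w); have h4 := sqr_ge0 (g w).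
  by rewrite ler_norml; apply/andP; split; nra.
Qed.

Lemma L1_sqrD f g : measurable_fun setT f -> measurable_fun setT g ->
  L1 (fun w => f w ^+ 2) -> L1 (fun w => g w ^+ 2) ->
  L1 (fun w => (f w + g w) ^+ 2).
Proof.
move=> mf mg lf lg; apply: (@L1_dom _ (fun w => 2 * (f w ^+ 2 + g w ^+ 2))).
- by apply: measurable_funX; exact: measurable_funD.
- by apply/L1Z/L1D.
- move=> w; have h1 := sqr_ge0 (f w - g w).
  by rewrite ger0_norm ?sqr_ge0//; nra.
Qed.

Lemma ExE f : L1 f -> (\int[P]_w (f w)%:E)%E = (Ex f)%:E.
Proof. by move=> lf; rewrite /Ex /Rintegral fineK// integrable_fin_num. Qed.

Lemma expectE f : L1 f -> 'E_P[f]%E = (Ex f)%:E.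
Proof. by move=> lf; rewrite unlock ExE. Qed.

Lemma Ex_cst (c : R) : Ex (fun=> c) = c.
Proof.
rewrite /Ex Rintegral_cst//.
have -> : fine (P setT) = 1 by rewrite probability_setT.
by rewrite mulr1.
Qed.

Lemma ExD f g : L1 f -> L1 g -> Ex (fun w => f w + g w) = Ex f + Ex g.
Proof. by move=> lf lg; rewrite /Ex RintegralD. Qed.

Lemma ExB f g : L1 f -> L1 g -> Ex (fun w => f w - g w) = Ex f - Ex g.
Proof. by move=> lf lg; rewrite /Ex RintegralB. Qed.

Lemma ExZ (c : R) f : L1 f -> Ex (fun w => c * f w) = c * Ex f.
Proof. by move=> lf; rewrite /Ex RintegralZl. Qed.

Lemma Ex_sum (I : Type) (s : seq I) (Q : pred I) (F : I -> T -> R) :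
  (forall i, Q i -> L1 (F i)) ->
  Ex (fun w => \sum_(i <- s | Q i) F i w) = \sum_(i <- s | Q i) Ex (F i).
Proof.
move=> lF; elim: s => [|i s IH].
  rewrite big_nil (_ : (fun _ => _) = (fun=> 0)) ?Ex_cst//.
  by apply/funext => w; rewrite big_nil.
rewrite big_cons; case: (boolP (Q i)) => Qi; last first.
  by rewrite (_ : (fun _ => _) = fun w => \sum_(i <- s | Q i) F i w)//;
    apply/funext => w; rewrite big_cons (negbTE Qi).
rewrite (_ : (fun _ => _) = fun w => F i w + \sum_(i <- s | Q i) F i w).
  by rewrite ExD ?IH//; [exact: lF|exact: L1_sum].
by apply/funext => w; rewrite big_cons Qi.
Qed.

Lemma Ex_ge0 f : (forall w, 0 <= f w) -> 0 <= Ex f.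
Proof. by move=> f0; apply: Rintegral_ge0. Qed.

Lemma Ex_le f g : L1 f -> L1 g -> (forall w, f w <= g w) -> Ex f <= Ex g.
Proof. by move=> lf lg fg; apply: le_Rintegral. Qed.

Lemma Ex_ge0_le f g : measurable_fun setT f -> L1 g ->
  (forall w, 0 <= f w <= g w) -> Ex f <= Ex g.
Proof.
move=> mf lg fg; apply: Ex_le => //; last by move=> w; case/andP: (fg w).
by apply: (L1_dom mf lg) => w; case/andP: (fg w) => *; rewrite ger0_norm.
Qed.

Lemma Ex_abs f : L1 f -> `|Ex f| <= Ex (fun w => `|f w|).
Proof. by move=> lf; apply: le_normr_Rintegral. Qed.

Lemma Ex_abs_le f g : measurable_fun setT f -> L1 g ->
  (forall w, `|f w| <= g w) -> `|Ex f| <= Ex g.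
Proof.
move=> mf lg fg; have lf := L1_dom mf lg fg.
by apply: (le_trans (Ex_abs lf)); apply: Ex_le => //; exact: L1_abs.
Qed.

Lemma Ex_abs_bnd f (C : R) : measurable_fun setT f -> (forall w, `|f w| <= C) ->
  `|Ex f| <= C.
Proof. by move=> mf fC; rewrite -(Ex_cst C); apply: Ex_abs_le => //; exact: L1_cst. Qed.

Lemma Ex_bnd f (C : R) : measurable_fun setT f -> (forall w, `|f w| <= C) ->
  Ex f <= C.
Proof. by move=> mf fC; apply: (le_trans (ler_norm _)); exact: Ex_abs_bnd. Qed.

(** The variance of [|f|] is nonnegative. This turns the second-moment bounds of martingale sums
    into first-moment bounds. *)
Lemma Ex_sqr_le f (C : R) : measurable_fun setT f -> L1 (fun w => f w ^+ 2) ->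
  0 <= C -> Ex (fun w => f w ^+ 2) <= C ^+ 2 -> Ex (fun w => `|f w|) <= C.
Proof.
move=> mf lf C0 fC; have lf1 := L1_abs (L1_sqr mf lf).
set a := Ex _.
have : 0 <= Ex (fun w => (`|f w| - a) ^+ 2) by apply: Ex_ge0 => w; exact: sqr_ge0.
have -> : (fun w => (`|f w| - a) ^+ 2) =
    (fun w => f w ^+ 2 + (- (2 * a) * `|f w| + a ^+ 2)).
  apply/funext => w; rewrite -(real_normK (num_real (f w))); ring.
have h1 : L1 (fun w => - (2 * a) * `|f w|) by exact: L1Z.
have h2 : L1 (fun=> a ^+ 2) by exact: L1_cst.
rewrite ExD//; last exact: L1D.
rewrite ExD// ExZ// Ex_cst -/a => ha.
have a0 : 0 <= a by apply: Ex_ge0.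
rewrite -(@ler_pXn2r _ 2)// ?nnegrE//; nra.
Qed.

Lemma Ex_cvg (f_ : nat -> T -> R) f g : (forall n, measurable_fun setT (f_ n)) ->
  measurable_fun setT f -> L1 g -> (forall n w, `|f_ n w| <= g w) ->
  {ae P, forall w, f_ n w @[n --> \oo] --> f w} ->
  Ex (f_ n) @[n --> \oo] --> Ex f.
Proof.
move=> mf_ mf lg fg cv.
have H1 n : measurable_fun setT (EFin \o f_ n) by exact/measurable_EFinP.
have H2 : measurable_fun setT (EFin \o f) by exact/measurable_EFinP.
have H3 : {ae P, forall w, setT w -> EFin \o f_ ^~ w @ \oo --> (EFin \o f) w}.
  by apply: filterS cv => w h _; apply/fine_cvgP; split => //; exact: nearW.
have H4 : {ae P, forall w n, setT w -> (`|(EFin \o f_ n) w| <= (EFin \o g) w)%E}.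
  by apply: aeW => w n _ /=; rewrite lee_fin.
have [lf _ H] := @dominated_convergence _ _ _ P setT measurableT
  (fun n => EFin \o f_ n) _ _ H1 H2 H3 lg H4.
rewrite (ExE lf) in H.
by move/fine_cvgP : H => [_].
Qed.

End expectation_toolkit.

(** * Integrals against weights that agree on a sigma-algebra *)

Section weighted_integrals.
Import HBNNSimple.
Local Open Scope ereal_scope.

(** The case of a simple [g]: the integral depends on the weight only through its integrals over
    preimages. *)
Let integral_weighted_nnsfun d d1 (T : measurableType d) (T1 : measurableType d1)
    (R : realType) (mu : {measure set T -> \bar R}) (phi : T -> T1)
    (p : T -> R) (g : {nnsfun T1 >-> R}) :
  measurable_fun setT phi -> measurable_fun setT p -> (forall x, (0 <= p x)%R) ->
  \int[mu]_x (g (phi x) * p x)%:E =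
  \sum_(r \in range g) r%:E * \int[mu]_(x in phi @^-1` (g @^-1` [set r])) (p x)%:E.
Proof.
move=> mphi mp p0.
have mI r : measurable_fun setT (fun x => (\1_(g @^-1` [set r]) (phi x) * p x)%R).
  apply: measurable_funM => //.
  exact: (measurableT_comp (measurable_indic (measurable_sfunP g _)) mphi).
have mA r : measurable (phi @^-1` (g @^-1` [set r])).
  by rewrite -[_ @^-1` _]setTI; exact: mphi.
transitivity (\int[mu]_x \sum_(r \in range g)
    (r * (\1_(g @^-1` [set r]) (phi x) * p x))%:E).
  apply: eq_integral => x _; rewrite fsumEFin//; congr EFin.
  rewrite [in LHS]fimfunE mulrC mulr_fsumr; apply: eq_fsbigr => r _.
  by rewrite mulrCA (mulrC (p x)).
have r0 x r : (0 <= r * (\1_(g @^-1` [set r]) (phi x) * p x))%R.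
  rewrite indicE; case: (boolP (_ \in _)) => [|_]; last by rewrite mul0r mulr0.
  rewrite inE /= => <-; rewrite mul1r mulr_ge0//.
rewrite ge0_integral_fsum//.
- apply: eq_fsbigr => r _.
  under eq_integral do rewrite EFinM.
  (* A negative scalar cannot be moved out of a nonnegative integral, but its level set is empty. *)
  have [r1|r1] := ltP r 0%R.
    have E0 : g @^-1` [set r] = set0.
      rewrite predeqE => y; split=> //= gy.
      by move: r1; rewrite -gy ltNge; have := @fun_ge0 _ _ g y => ->.
    rewrite E0 preimage_set0 integral_set0 mule0; apply: integral0_eq => x _.
    by rewrite indic0 mul0r mule0.
  rewrite ge0_integralZl//.
  - congr (_ * _); rewrite [RHS]integral_mkcond; apply: eq_integral => x _.
    rewrite patchE indicE.
    case: (boolP (x \in _)) => [|/negP].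
      by rewrite inE /= => gx; rewrite mem_set// mul1r.
    by rewrite inE /= => gx; rewrite memNset// mul0r.
  - exact/measurable_EFinP.
  - by move=> x _; rewrite lee_fin mulr_ge0.
- by move=> r; apply/measurable_EFinP; exact: measurable_funM.
- by move=> r x _; rewrite lee_fin.
Qed.

(* If two weights have the same integrals over the sigma-algebra of the sets
   [phi @^-1` A], then they are interchangeable under the integral against any
   function that is measurable with respect to it. *)
Lemma ge0_integral_weighted d d' d1 (T : measurableType d)
    (T' : measurableType d') (T1 : measurableType d1)
    (R : realType) (mu : {measure set T -> \bar R})
    (mu' : {measure set T' -> \bar R}) (phi : T -> T1) (phi' : T' -> T1)
    (p : T -> R) (q : T' -> R) (G : T1 -> R) :
  measurable_fun setT phi -> measurable_fun setT phi' ->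
  measurable_fun setT p -> measurable_fun setT q ->
  (forall x, (0 <= p x)%R) -> (forall x, (0 <= q x)%R) ->
  (forall A, measurable A -> \int[mu]_(x in phi @^-1` A) (p x)%:E =
                             \int[mu']_(x in phi' @^-1` A) (q x)%:E) ->
  measurable_fun setT G -> (forall y, (0 <= G y)%R) ->
  \int[mu]_x (G (phi x) * p x)%:E = \int[mu']_x (G (phi' x) * q x)%:E.
Proof.
move=> mphi mphi' mp mq p0 q0 pq mG G0.
have mEG : measurable_fun setT (EFin \o G) by exact/measurable_EFinP.
pose f_ := nnsfun_approx measurableT mEG.
have cvf y : (f_ n y)%:E @[n --> \oo] --> (G y)%:E.
  by apply: (@cvg_nnsfun_approx _ _ _ _ measurableT _ mEG) => // z _ /=; rewrite lee_fin.
(* Monotone convergence along simple approximations of [G], for an arbitrary space so that it serves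
   both sides. *)
have key dd (TT : measurableType dd) (m : {measure set TT -> \bar R})
    (ph : TT -> T1) (w : TT -> R) : measurable_fun setT ph ->
    measurable_fun setT w -> (forall x, (0 <= w x)%R) ->
    \int[m]_x (G (ph x) * w x)%:E = lim (\int[m]_x (f_ n (ph x) * w x)%:E @[n --> \oo]).
  move=> mph mw w0; rewrite -monotone_convergence//=.
  - apply: eq_integral => x _; apply/esym/cvg_lim => //.
    rewrite EFinM; under eq_fun do rewrite EFinM.
    by apply: cvgeZr => //; exact: cvf.
  - move=> n; apply/measurable_EFinP/measurable_funM => //.
    exact: (measurableT_comp _ mph).
  - by move=> n x _; rewrite lee_fin mulr_ge0.
  - move=> x _ m1 n1 mn; rewrite lee_fin ler_wpM2r//.
    exact/lefP/nd_nnsfun_approx.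
rewrite !key//; apply: congr_lim; apply/funext => n.
rewrite !integral_weighted_nnsfun//; apply: eq_fsbigr => r _; rewrite pq//.
Qed.

End weighted_integrals.

(** * The standard normal law and its density *)

Section gaussian_density.
Context {R : realType}.
Notation mu := (@lebesgue_measure R).
Notation gam := (normal_prob 0 1 : probability (measurableTypeR R) R).

(** The weight 1 under the normal law and the density under Lebesgue measure have the same integral
    over every measurable set, so [ge0_integral_weighted] applies with the identity map. *)
Lemma ge0_integral_normal_prob (G : R -> R) : measurable_fun setT G ->
  (forall y, 0 <= G y) ->
  (\int[gam]_y (G y)%:E = \int[mu]_y (G y * normal_pdf 0 1 y)%:E)%E.
Proof.
move=> mG G0.
transitivity (\int[gam]_y (G (idfun y) * 1)%:E)%E.
  by apply: eq_integral => y _; rewrite mulr1.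
apply: (@ge0_integral_weighted _ _ _ _ _ _ R gam mu idfun idfun (fun=> 1)
  (normal_pdf 0 1) G) => //.
- exact: measurable_id.
- exact: measurable_id.
- exact: measurable_normal_pdf.
- exact: normal_pdf_ge0.
- by move=> A mA; rewrite integral_cst//= mul1e.
Qed.

End gaussian_density.

(** * Elementary facts on real sequences and derivatives *)

Section real_sequences.
Context {R : realType}.

Lemma cvg0_le (u v : nat -> R) (N : nat) :
  (forall n, (N <= n)%N -> `|u n| <= v n) -> v n @[n --> \oo] --> 0 ->
  u n @[n --> \oo] --> 0.
Proof.
move=> uv v0; apply/norm_cvg0P.
apply: (@squeeze_cvgr _ _ _ _ (fun=> 0) v) => //; last exact: cvg_cst.
by exists N => // n /= Nn; rewrite normr_ge0 uv.
Qed.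

Lemma cvg_invS0 (c : R) : c / n.+1%:R @[n --> \oo] --> 0.
Proof.
rewrite -[X in _ --> X](mulr0 c); apply: cvgMr; exact: cvg_harmonic.
Qed.

End real_sequences.

Section real_derivatives.
Context {R : realType}.
Implicit Types f g : R -> R.

Lemma is_derive1D f g (x a b : R) : is_derive x 1 f a -> is_derive x 1 g b ->
  is_derive x 1 (fun t => f t + g t) (a + b).
Proof. exact: is_deriveD. Qed.

Lemma is_derive1M f g (x a b : R) : is_derive x 1 f a -> is_derive x 1 g b ->
  is_derive x 1 (fun t => f t * g t) (a * g x + f x * b).
Proof.
by move=> ha hb; apply: is_derive_eq (is_deriveM ha hb) _;
  rewrite /GRing.scale /=; ring.
Qed.

Lemma is_derive1Z f (c x a : R) : is_derive x 1 f a ->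
  is_derive x 1 (fun t => c * f t) (c * a).
Proof. exact: is_deriveZ. Qed.

Lemma is_derive1_affine (a b x : R) : is_derive x 1 (fun t => a + b * t) b.
Proof.
have := is_derive1D (is_derive_cst a x 1) (is_derive1Z b (is_derive_id x 1)).
by move/is_derive_eq; apply; rewrite add0r mulr1.
Qed.

Lemma derive_continuous g (g1 : R -> R) :
  (forall y : R, is_derive y 1 g (g1 y)) -> continuous g.
Proof.
move=> dg y; apply: differentiable_continuous; apply/derivable1_diffP.
exact: (@ex_derive _ _ _ _ _ _ _ (dg y)).
Qed.

End real_derivatives.

(** * Stein's identity for the standard normal law *)

Section gaussian_stein.
Context {R : realType}.
Notation mu := (@lebesgue_measure R).
Notation gam := (normal_prob 0 1 : probability (measurableTypeR R) R).
Implicit Types f g : R -> R.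

Let phi : R -> R := normal_pdf 0 1.

Let phi_ge0 y : 0 <= phi y. Proof. exact: normal_pdf_ge0. Qed.

Let measurable_phi : measurable_fun setT phi.
Proof. exact: measurable_normal_pdf. Qed.

Let phiE y : phi y = normal_peak 1 * expR (- y ^+ 2 / 2).
Proof.
by rewrite /phi normal_pdfE ?oner_eq0// /normal_fun subr0 expr1n.
Qed.

(** With [e = expR (y^2 / 8)] the density is a multiple of [e^-4] and that of variance 2 a multiple
    of [e^-2]. The spare factor [e^-2] absorbs the cube, since
    [|y|^3 <= 64 (1 + y^2 / 8)^2 <= 64 e^2]. *)
Let cube_phi_le : exists2 K : R, 0 <= K &
  forall y, `|y| ^+ 3 * phi y <= K * normal_pdf 0 (Num.sqrt 2) y.
Proof.
have s2 : Num.sqrt 2 != 0 :> R by rewrite gt_eqF// sqrtr_gt0.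
have p1 : 0 < normal_peak (1 : R) by apply: normal_peak_gt0; rewrite oner_eq0.
have p2 : 0 < normal_peak (Num.sqrt 2 : R) by exact: normal_peak_gt0.
exists (64 * normal_peak 1 / normal_peak (Num.sqrt 2)).
  by rewrite divr_ge0 ?mulr_ge0// ltW.
move=> y; rewrite phiE normal_pdfE// /normal_fun subr0 sqr_sqrtr//.
rewrite [leRHS](_ : _ = 64 * normal_peak 1 * expR (- y ^+ 2 / (2 *+ 2)))//; last first.
  by field; rewrite gt_eqF.
set e := expR (y ^+ 2 / 8).
have e0 : 0 < e by exact: expR_gt0.
have e1 : 1 + y ^+ 2 / 8 <= e by exact: expR_ge1Dx.
have -> : expR (- y ^+ 2 / 2) = e^-1 ^+ 4.
  by rewrite -expRN -expRM_natl; congr expR; field.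
have -> : expR (- y ^+ 2 / (2 *+ 2)) = e^-1 ^+ 2.
  by rewrite -expRN -expRM_natl; congr expR; field.
set np := normal_peak 1.
have -> : `|y| ^+ 3 * (np * e^-1 ^+ 4) = np * (`|y| ^+ 3 / e ^+ 2) / e ^+ 2.
  by field; rewrite gt_eqF.
have -> : 64 * np * e^-1 ^+ 2 = np * 64 / e ^+ 2 by field; rewrite gt_eqF.
rewrite ler_wpM2r ?invr_ge0 ?exprn_ge0 ?(ltW e0)// ler_wpM2l ?(ltW p1)//.
rewrite ler_pdivrMr ?exprn_gt0//.
have e2 : (1 + y ^+ 2 / 8) ^+ 2 <= e ^+ 2.
  by rewrite ler_sqr ?nnegrE// ?(ltW e0)// addr_ge0// divr_ge0// sqr_ge0.
apply: le_trans (ler_wpM2l _ e2) => //.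
rewrite -(real_normK (num_real y)); set t := `|y|.
have t0 : 0 <= t by exact: normr_ge0.
have := exprn_ge0 3 t0; have := sqr_ge0 t; have := sqr_ge0 (t ^+ 2 - t).
have -> : 64 * (1 + t ^+ 2 / 8) ^+ 2 = 64 + 16 * t ^+ 2 + t ^+ 4 by field.
have -> : (t ^+ 2 - t) ^+ 2 = t ^+ 4 - 2 * t ^+ 3 + t ^+ 2 by ring.
lra.
Qed.

(** Reduced to nonnegative functions by [f = (f + |f|) - |f|]; the same splitting recurs below. *)
Lemma normal_prob_integrable f : L1 gam f ->
  mu.-integrable setT (EFin \o (fun y => f y * phi y)) /\
  Ex gam f = \int[mu]_y (f y * phi y).
Proof.
move=> lf; have mf := L1_meas lf.
have ge0P g : L1 gam g -> (forall y, 0 <= g y) ->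
    mu.-integrable setT (EFin \o (fun y => g y * phi y)) /\
    Ex gam g = \int[mu]_y (g y * phi y).
  move=> lg g0; have E := ge0_integral_normal_prob (L1_meas lg) g0.
  split; last by rewrite /Ex /Rintegral E.
  apply/integrableP; split.
    by apply/measurable_EFinP/measurable_funM => //; exact: L1_meas lg.
  under eq_integral do rewrite /= ger0_norm ?mulr_ge0//.
  by rewrite -E (ExE lg) ltry.
have la := L1_abs lf.
have [i1 E1] := ge0P _ la (fun y => normr_ge0 _).
have fp y : 0 <= f y + `|f y| by have := ler_norm (- f y); rewrite normrN; lra.
have [i2 E2] := ge0P _ (L1D lf la) fp.
have E : (fun y => f y * phi y) =
    (fun y => (f y + `|f y|) * phi y - `|f y| * phi y).
  by apply/funext => y; ring.
split.
  by have := integrableB measurableT i2 i1; rewrite E.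
rewrite E RintegralB// -E1 -E2 ExD//; ring.
Qed.

Let Rintegral_cvg_itv h : mu.-integrable setT (EFin \o h) ->
  \int[mu]_(x in `[- n%:R, n%:R]) h x @[n --> \oo] --> \int[mu]_x h x.
Proof.
move=> ih; have mh : measurable_fun setT h.
  by case/integrableP : ih => /measurable_EFinP.
pose I (n : nat) : set R := `[- n%:R, n%:R]%classic.
have mI n : measurable (I n) by exact: measurable_itv.
have m1 n : measurable_fun setT ((EFin \o h) \_ (I n)).
  apply/(measurable_restrictT _ _).1 => //.
  by apply: measurable_funTS; exact/measurable_EFinP.
have c1 : {ae mu, forall x, setT x -> ((EFin \o h) \_ (I n)) x @[n --> \oo] --> (EFin \o h) x}.
  apply: aeW => x _; apply: cvg_near_cst.
  have [N hN] : exists N : nat, `|x| <= N%:R.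
    by exists (Num.truncn `|x|).+1; apply/ltW/truncnS_gt.
  exists N => // n /= Nn; rewrite patchE mem_set//.
  by rewrite /I /= in_itv/= -ler_norml (le_trans hN)// ler_nat.
have c2 : {ae mu, forall x n, setT x -> (`|((EFin \o h) \_ (I n)) x| <= (abse \o (EFin \o h)) x)%E}.
  apply: aeW => x n _; rewrite patchE; case: ifPn => //= _.
  by rewrite normr0 lee_fin.
have m2 : measurable_fun setT (EFin \o h) by exact/measurable_EFinP.
have [_ _ H] := @dominated_convergence _ _ _ mu setT measurableT _ _ _ m1
  m2 c1 (integrable_abse ih) c2.
have fin : (\int[mu]_x (EFin \o h) x)%E \is a fin_num.
  exact: integrable_fin_num.
rewrite -(fineK fin) in H.
move/fine_cvgP : H => [_]; rewrite /Rintegral; apply: cvg_trans.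
by apply: near_eq_cvg; apply: nearW => n /=; rewrite /Rintegral [in RHS]integral_mkcond.
Qed.

Lemma normal_prob_cube_integrable : L1 gam (fun y => `|y| ^+ 3).
Proof.
have mc : measurable_fun setT (fun y : R => `|y| ^+ 3).
  by apply: measurable_funX; exact: normr_measurable.
apply/integrableP; split; first exact/measurable_EFinP.
under eq_integral do rewrite /= ger0_norm ?exprn_ge0//.
rewrite ge0_integral_normal_prob//; have [K K0 hK] := cube_phi_le.
have iK := integrableZl measurableT K (integrable_normal_pdf (0:R) (Num.sqrt 2)).
apply: le_lt_trans (integrable_lty measurableT iK) => //.
apply: ge0_le_integral => //.
- by move=> y _; rewrite lee_fin mulr_ge0.
- by apply/measurable_EFinP/measurable_funM.
- by case/integrableP : iK.
- by move=> y _; rewrite -EFinM lee_fin.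
Qed.

Let is_derive_phi (y : R) : is_derive y 1 phi (- (y * phi y)).
Proof.
have -> : phi = (fun x => normal_peak 1 * expR (- x ^+ 2 / 2)).
  by apply/funext => x; exact: phiE.
have h1 : is_derive y 1 (fun x : R => - x ^+ 2 / 2) (- y).
  have -> : (fun x : R => - x ^+ 2 / 2) = (fun x => x * (0 + (- 2^-1) * x)).
    by apply/funext => x; field.
  have := is_derive1M (is_derive_id y 1) (is_derive1_affine 0 (- 2^-1) y).
  by move/is_derive_eq; apply; field.
have h2 := is_derive1_comp (is_derive_expR _) h1.
have := is_derive1Z (normal_peak 1) h2.
by move/is_derive_eq; apply; rewrite /=; ring.
Qed.

(** Controls the boundary terms of the integration by parts in [stein]. *)
Let phi_tail : exists2 K : R, 0 <= K &
  forall y, 1 <= `|y| -> (1 + `|y|) * phi y <= K / `|y|.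
Proof.
have [K K0 hK] := cube_phi_le.
have s2 : Num.sqrt 2 != 0 :> R by rewrite gt_eqF// sqrtr_gt0.
pose K1 := K * normal_peak (Num.sqrt 2).
have hK1 y : `|y| ^+ 3 * phi y <= K1.
  by rewrite (le_trans (hK y))// ler_wpM2l// normal_pdf_ub.
have K10 : 0 <= K1 by rewrite mulr_ge0// normal_peak_ge0.
exists (2 * K1) => [|y y1]; first by rewrite mulr_ge0.
have y0 : 0 < `|y| by rewrite (lt_le_trans _ y1).
rewrite ler_pdivlMr//; have := hK1 y; set t := `|y| in y1 y0 *.
have p0 := phi_ge0 y => h.
apply: (@le_trans _ _ (2 * (t ^+ 3 * phi y))); last by lra.
rewrite mulrA mulrAC ler_wpM2r//.
have : t ^+ 2 <= t ^+ 3 by rewrite ler_weXn2l.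
have : t <= t ^+ 3 by rewrite -[leLHS]expr1 ler_weXn2l.
lra.
Qed.

(** Integration by parts on [[-n, n]] with [phi' = - y phi]. As [g] grows at most linearly, the
    boundary terms are [O(1/n)]. *)
Lemma stein (g g1 : R -> R) (C : R) : (forall y : R, is_derive y 1 g (g1 y)) ->
  continuous g1 -> (forall y, `|g y| <= C * (1 + `|y|)) ->
  (forall y, `|g1 y| <= C) -> Ex gam (fun y => y * g y) = Ex gam g1.
Proof.
move=> dg cg1 gC g1C.
have C0 : 0 <= C by apply: le_trans (g1C 0).
have cg := derive_continuous dg.
have mg := continuous_measurable_fun cg.
have mg1 := continuous_measurable_fun cg1.
have lg1 : L1 gam g1 by exact: (@L1_bnd _ (measurableTypeR R) R gam g1 C mg1 g1C).
have lyg : L1 gam (fun y => y * g y).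
  apply: (@L1_dom _ (measurableTypeR R) R gam _ (fun y => (C * 2) * (1 + `|y| ^+ 3))).
  - by apply: measurable_funM.
  - by apply/L1Z/L1D; [exact: L1_cst|exact: normal_prob_cube_integrable].
  - move=> y; rewrite normrM; have := gC y; set t := `|y|.
    have t0 : 0 <= t by exact: normr_ge0.
    move=> h; apply: (@le_trans _ _ (t * (C * (1 + t)))); first by rewrite ler_wpM2l.
    rewrite mulrCA -mulrA ler_wpM2l//.
    have t3 : 0 <= t ^+ 3 by exact: exprn_ge0.
    have [t1|t1] := lerP 1 t.
      have : t ^+ 2 <= t ^+ 3 by rewrite ler_weXn2l.
      have : t <= t ^+ 3 by rewrite -[leLHS]expr1 ler_weXn2l.
      lra.
    nra.
have [i1 E1] := normal_prob_integrable lg1.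
have [i2 E2] := normal_prob_integrable lyg.
rewrite E1 E2.
have c1 := Rintegral_cvg_itv i1.
have c2 := Rintegral_cvg_itv i2.
pose bd (n : nat) := phi n%:R * g n%:R - phi (- n%:R) * g (- n%:R).
have cphi := derive_continuous is_derive_phi.
have ibp n : (0 < n)%N -> \int[mu]_(x in `[- n%:R, n%:R]) (g1 x * phi x) =
    bd n + \int[mu]_(x in `[- n%:R, n%:R]) (x * g x * phi x).
  move=> n0; have nn : - n%:R < n%:R :> R by rewrite gt0_cp// ltr0n.
  have dLR (F F1 : R -> R) : (forall y : R, is_derive y 1 F (F1 y)) ->
      derivable_oo_LRcontinuous F (- n%:R) n%:R.
    move=> dF; have cF := derive_continuous dF; split.
    - by move=> x _; exact: (@ex_derive _ _ _ _ _ _ _ (dF x)).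
    - by apply: cvg_at_right_filter; exact: cF.
    - by apply: cvg_at_left_filter; exact: cF.
  have d1 (F F1 : R -> R) : (forall y : R, is_derive y 1 F (F1 y)) -> F^`()%classic =1 F1.
    by move=> dF x; have dFx := dF x; rewrite derive1E derive_val.
  have cw (F : R -> R) : continuous F -> {within `[- n%:R, n%:R], continuous F}.
    by move=> cF; exact: continuous_subspaceT.
  have cxphi : continuous (fun x : R => - (x * phi x)).
    by move=> x; apply: cvgN; apply: cvgM; [exact: cvg_id|exact: cphi].
  have H := @Rintegration_by_parts R phi g (fun x : R => - (x * phi x)) g1 _ _ nn
    (cw _ cxphi) (dLR _ _ is_derive_phi)
    (fun x _ => d1 _ _ is_derive_phi x) (cw _ cg1) (dLR _ _ dg)
    (fun x _ => d1 _ _ dg x).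
  transitivity (\int[mu]_(x in `[- n%:R, n%:R]) (phi x * g1 x)).
    by apply: eq_Rintegral => x _; rewrite mulrC.
  rewrite H /bd; congr (_ + _).
  have i3 : mu.-integrable `[- n%:R, n%:R] (EFin \o (fun y => y * g y * phi y)).
    exact: integrableS i2.
  transitivity (- \int[mu]_(x in `[- n%:R, n%:R]) (-1 * (x * g x * phi x))).
    by congr (- _); apply: eq_Rintegral => x _; ring.
  by rewrite RintegralZl// mulN1r opprK.
have bd0 : bd n @[n --> \oo] --> 0.
  have [K K0 hK] := phi_tail.
  apply: (@cvg0_le _ _ (fun n => (4 * C * K) / n.+1%:R) 1%N); last exact: cvg_invS0.
  move=> n n1; have n1R : 1 <= n%:R :> R by rewrite ler1n.
  have b (y : R) : `|y| = n%:R -> `|phi y * g y| <= C * K / n%:R.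
    move=> yn; rewrite normrM (ger0_norm (phi_ge0 y)).
    have := hK y; rewrite yn => /(_ n1R) h.
    have p0 := phi_ge0 y.
    apply: le_trans (ler_wpM2l p0 (gC y)) _; rewrite yn.
    by rewrite mulrCA -mulrA ler_wpM2l// mulrC.
  rewrite /bd; apply: le_trans (ler_normB _ _) _.
  apply: le_trans (lerD (b _ _) (b _ _)) _; rewrite ?normrN ?ger0_norm//.
  have n0 : 0 < n%:R :> R by rewrite (lt_le_trans _ n1R).
  have h1 : (n%:R : R)^-1 <= 2 / n.+1%:R.
    by rewrite ler_pdivlMr// ler_pdivrMl// -natr1; lra.
  have CK : 0 <= C * K by exact: mulr_ge0.
  have -> : C * K / n%:R + C * K / n%:R = C * K * (n%:R^-1 + n%:R^-1) by ring.
  have -> : 4 * C * K / n.+1%:R = C * K * (2 / n.+1%:R + 2 / n.+1%:R) by ring.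
  by rewrite ler_wpM2l// lerD.
have c3 : bd n + \int[mu]_(x in `[- n%:R, n%:R]) (x * g x * phi x) @[n --> \oo] -->
    0 + \int[mu]_x (x * g x * phi x) by exact: cvgD.
rewrite add0r in c3.
have c4 : \int[mu]_(x in `[- n%:R, n%:R]) (g1 x * phi x) @[n --> \oo] -->
    \int[mu]_x (x * g x * phi x).
  apply: cvg_trans c3; apply: near_eq_cvg.
  by exists 1%N => // n /= n1; rewrite ibp.
by rewrite -(cvg_lim (@Rhausdorff R) c1) -(cvg_lim (@Rhausdorff R) c4).
Qed.

End gaussian_stein.

(** * Smooth test functions and Taylor bounds *)

Section smooth_functions.
Context {R : realType}.
Implicit Types f : R -> R.

(** The Lipschitz bound on [f2] stands in for a third derivative: the cubic Taylor bound uses no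
    more, and three moving averages of a bounded continuous function attain it. *)
Record smooth3 (f f1 f2 : R -> R) (C : R) : Prop := {
  smooth3_d1 : forall x : R, is_derive x 1 f (f1 x) ;
  smooth3_d2 : forall x : R, is_derive x 1 f1 (f2 x) ;
  smooth3_b0 : forall x, `|f x| <= C ;
  smooth3_b1 : forall x, `|f1 x| <= C ;
  smooth3_b2 : forall x, `|f2 x| <= C ;
  smooth3_lip : forall x y, `|f2 x - f2 y| <= C * `|x - y| }.

Lemma MVT_real f df (a b : R) : (forall x : R, is_derive x 1 f (df x)) ->
  exists2 c, `|c - a| <= `|b - a| & f b - f a = df c * (b - a).
Proof.
move=> dfx; have cf := derive_continuous dfx.
have [ab|ba] := leP a b.
  have [c cab E] := MVT_segment ab (fun x _ => dfx x) (continuous_subspaceT cf).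
  exists c => //; move: cab; rewrite in_itv/= => /andP[ac cb].
  by rewrite !ger0_norm ?subr_ge0// lerD2r.
have [c cab E] := MVT_segment (ltW ba) (fun x _ => dfx x) (continuous_subspaceT cf).
exists c; last by rewrite -[LHS]opprB E; ring.
move: cab; rewrite in_itv/= => /andP[bc ca].
by rewrite !ler0_norm ?subr_le0// ?(ltW ba)// lerN2 lerD2r.
Qed.

Lemma lip_continuous f (C : R) : (forall x y, `|f x - f y| <= C * `|x - y|) ->
  continuous f.
Proof.
move=> fC x; apply/cvgrPdist_lt => e e0.
have C0 : 0 <= C.
  by have := fC 1 0; rewrite subr0 normr1 mulr1; apply: le_trans.
have d0 : 0 < e / (C + 1) by rewrite divr_gt0// ltr_wpDl.
exists (e / (C + 1)) => //= t; rewrite /ball_ /= => xt.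
apply: le_lt_trans (fC _ _) _.
apply: (@le_lt_trans _ _ ((C + 1) * `|x - t|)); first by rewrite ler_wpM2r// lerDl.
by rewrite mulrC -ltr_pdivlMr// ltr_wpDl.
Qed.

Section smooth3_theory.
Variables (f f1 f2 : R -> R) (C : R).
Hypothesis sm : smooth3 f f1 f2 C.

Lemma smooth3_C0 : 0 <= C.
Proof. exact: le_trans (smooth3_b0 sm 0). Qed.

Lemma smooth3_cont : [/\ continuous f, continuous f1 & continuous f2].
Proof.
split; [exact: derive_continuous (smooth3_d1 sm)|
  exact: derive_continuous (smooth3_d2 sm)|exact: lip_continuous (smooth3_lip sm)].
Qed.

Lemma smooth3_lip0 x y : `|f x - f y| <= C * `|x - y|.
Proof.
have [c _ ->] := MVT_real y x (smooth3_d1 sm).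
by rewrite normrM ler_wpM2r//; exact: (smooth3_b1 sm).
Qed.

Lemma taylor_sqr x a :
  `|f (x + a) - f x - a * f1 x - a ^+ 2 / 2 * f2 x| <= 2 * C * a ^+ 2.
Proof.
have [c] := MVT_real x (x + a) (smooth3_d1 sm).
rewrite addrAC subrr add0r => cx ->.
have [c' _] := MVT_real x c (smooth3_d2 sm) => E.
have -> : f1 c * a - a * f1 x - a ^+ 2 / 2 * f2 x =
  a * (f2 c' * (c - x) - a * (f2 x / 2)) by rewrite mulrBr -E; field.
have b1 := smooth3_b2 sm c'; have b2 := smooth3_b2 sm x; have C0 := smooth3_C0.
have a0 : 0 <= `|a| by exact: normr_ge0.
rewrite -(real_normK (num_real a)) normrM.
rewrite (_ : 2 * C * `|a| ^+ 2 = `|a| * (2 * C * `|a|)); last by ring.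
rewrite ler_wpM2l//.
apply: le_trans (ler_normB _ _) _; rewrite !normrM.
have h1 : `|f2 c'| * `|c - x| <= C * `|a| by rewrite ler_pM.
have h2 : `|a| * (`|f2 x| * `|2^-1 : R|) <= `|a| * C.
  rewrite ler_wpM2l// (_ : `|2^-1 : R| = 2^-1); last by rewrite gtr0_norm.
  have := normr_ge0 (f2 x); lra.
lra.
Qed.

Lemma taylor_cube x a :
  `|f (x + a) - f x - a * f1 x - a ^+ 2 / 2 * f2 x| <= 2 * C * `|a| ^+ 3.
Proof.
(* The Taylor remainder vanishes at [t = 0], and its derivative is the first-order remainder of
   [f1]; the mean value theorem is applied to each. *)
pose g t := f (x + t) - f x - t * f1 x - t ^+ 2 / 2 * f2 x.
pose g1 t := f1 (x + t) - f1 x - t * f2 x.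
have dg (t : R) : is_derive t 1 g (g1 t).
  have -> : g = (fun t => f (x + 1 * t) +
      (- f x + (- f1 x) * t) + t * (0 + (- (f2 x / 2)) * t)).
    by apply/funext => u; rewrite /g mul1r; field.
  have h1 := @is_derive1_comp R f (fun u => x + 1 * u) t _ _
    (smooth3_d1 sm (x + 1 * t)) (is_derive1_affine x 1 t).
  have h2 := is_derive1M (is_derive_id t 1) (is_derive1_affine 0 (- (f2 x / 2)) t).
  have := is_derive1D (is_derive1D h1 (is_derive1_affine (- f x) (- f1 x) t)) h2.
  by move/is_derive_eq; apply; rewrite /g1 /= mul1r; field.
have [c] := MVT_real 0 a dg; rewrite !subr0 => ca.
rewrite {2}/g addr0 subrr expr0n/= !mul0r !subr0 /g => ->.
rewrite normrM /g1.
have [c' c'x] := MVT_real x (x + c) (smooth3_d2 sm).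
rewrite addrAC subrr add0r in c'x * => ->.
have -> : f2 c' * c - c * f2 x = (f2 c' - f2 x) * c by ring.
have C0 := smooth3_C0.
have a0 : 0 <= `|a| by exact: normr_ge0.
have a3 : 0 <= C * `|a| ^+ 3 by rewrite mulr_ge0// exprn_ge0.
apply: (@le_trans _ _ (C * `|a| ^+ 3)); last by lra.
rewrite exprSr mulrA ler_wpM2r// normrM expr2 mulrA ler_pM//.
apply: le_trans (smooth3_lip sm _ _) _; rewrite ler_wpM2l//.
exact: le_trans c'x ca.
Qed.

(** Lindeberg's condition needs both bounds: the quadratic one alone does not become small in the
    sum, and the cube of a difference may fail to be integrable. *)
Lemma taylor_min x a :
  `|f (x + a) - f x - a * f1 x - a ^+ 2 / 2 * f2 x| <=
  2 * C * Num.min (a ^+ 2) (`|a| ^+ 3).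
Proof. by rewrite /Num.min; case: ifP => _; [exact: taylor_sqr|exact: taylor_cube]. Qed.

End smooth3_theory.
End smooth_functions.

(** * The heat semigroup *)

Section gaussian_smoothing.
Context {R : realType}.
Notation gam := (normal_prob 0 1 : probability (measurableTypeR R) R).
Implicit Types f : R -> R.

(** For [s >= 0] this is the heat semigroup: the mean of [f] under the normal law of mean [x] and
    variance [s]. *)
Definition gsmooth f (s x : R) : R := Ex gam (fun y => f (x + Num.sqrt s * y)).

Let cont_affine f (x s : R) : continuous f -> continuous (fun y => f (x + s * y)).
Proof.
move=> cf y; apply: (@continuous_comp _ _ _ (fun y => x + s * y) f); last exact: cf.
by apply: cvgD; [exact: cvg_cst|apply: cvgMr; exact: cvg_id].
Qed.

Let meas_affine f (x s : R) : continuous f ->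
  measurable_fun setT (fun y => f (x + s * y)).
Proof. by move=> cf; exact: continuous_measurable_fun (cont_affine cf). Qed.

Let gL1_bnd f (C : R) := @L1_bnd _ (measurableTypeR R) R gam f C.
Arguments gL1_bnd {f C}.
Let gL1_dom f g := @L1_dom _ (measurableTypeR R) R gam f g.
Arguments gL1_dom {f g}.
Let gL1M f g C := @L1M_bnd _ (measurableTypeR R) R gam f g C.
Arguments gL1M {f g C}.

Let L1_affine f (x s C : R) : continuous f -> (forall y, `|f y| <= C) ->
  L1 gam (fun y => f (x + s * y)).
Proof. by move=> cf fC; exact: (gL1_bnd (meas_affine x s cf) (fun y => fC _)). Qed.

Lemma gsmooth_bnd f (C s x : R) : continuous f -> (forall y, `|f y| <= C) ->
  `|gsmooth f s x| <= C.
Proof.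
move=> cf fC.
by apply: (@Ex_abs_bnd _ (measurableTypeR R) R gam) => //; exact: meas_affine.
Qed.

Lemma gsmooth0 f x : gsmooth f 0 x = f x.
Proof.
rewrite /gsmooth sqrtr0 -[RHS](Ex_cst gam); congr Ex.
by apply/funext => y; rewrite mul0r addr0.
Qed.

Lemma gsmooth_taylor (f f1 f2 : R -> R) (C s x a : R) : smooth3 f f1 f2 C ->
  `|gsmooth f s (x + a) - gsmooth f s x - a * gsmooth f1 s x -
    a ^+ 2 / 2 * gsmooth f2 s x| <= 2 * C * Num.min (a ^+ 2) (`|a| ^+ 3).
Proof.
move=> sm; have [cf cf1 cf2] := smooth3_cont sm.
set t := Num.sqrt s.
have l0 z := L1_affine z t cf (smooth3_b0 sm).
have l1 z := L1_affine z t cf1 (smooth3_b1 sm).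
have l2 z := L1_affine z t cf2 (smooth3_b2 sm).
have i1 := L1B (l0 (x + a)) (l0 x).
have i2 := L1Z a (l1 x).
have i3 := L1B i1 i2.
have i4 := L1Z (a ^+ 2 / 2) (l2 x).
rewrite /gsmooth -/t -(ExZ a (l1 x)) -(ExZ (a ^+ 2 / 2) (l2 x)).
rewrite -(ExB (l0 (x + a)) (l0 x)) -(ExB i1 i2) -(ExB i3 i4).
apply: (@Ex_abs_bnd _ (measurableTypeR R) R gam).
  by do ?[apply: measurable_funB|apply: measurable_funM] => //; exact: meas_affine.
by move=> y; rewrite (addrAC x a); exact: taylor_min sm _ _.
Qed.

(** The second and the first moment come from [stein] with [g y = y] and [g y = 1]. *)
Lemma normal_moments : [/\ L1 gam (fun y => `|y|), L1 gam (fun y => y ^+ 2),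
  Ex gam (fun y => y ^+ 2) = 1 & Ex gam (fun y => y) = 0].
Proof.
have l3 := @normal_prob_cube_integrable R.
have lg : L1 gam (fun y => 1 + `|y| ^+ 3) by apply: L1D => //; exact: L1_cst.
have t3 (t : R) : 0 <= t -> t <= 1 + t ^+ 3 /\ t ^+ 2 <= 1 + t ^+ 3.
  move=> t0; have [t1|t1] := lerP 1 t.
    have h1 : t ^+ 2 <= t ^+ 3 by rewrite ler_weXn2l.
    have h2 : t <= t ^+ 3 by rewrite -[leLHS]expr1 ler_weXn2l.
    by split; lra.
  by have := exprn_ge0 3 t0; split; nra.
split.
- apply: (gL1_dom _ lg); first exact: normr_measurable.
  by move=> y; rewrite normr_id; case: (t3 _ (normr_ge0 y)).
- apply: (gL1_dom _ lg); first exact: exprn_measurable.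
  by move=> y; rewrite normrX; case: (t3 _ (normr_ge0 y)).
- have h : Ex gam (fun y => y * y) = Ex gam (fun=> 1).
    apply: (@stein R (fun y => y) (fun=> 1) 1).
    + by move=> x; exact: cvg_cst.
    + by move=> y; rewrite mul1r lerDr.
    + by move=> y; rewrite normr1.
  exact: (etrans h (Ex_cst gam 1)).
- have h : Ex gam (fun y => y * 1) = Ex gam (fun=> 0).
    apply: (@stein R (fun y => 1) (fun=> 0) 1).
    + by move=> x; exact: cvg_cst.
    + by move=> y; rewrite normr1 mul1r lerDl.
    + by move=> y; rewrite normr0.
  rewrite (_ : (fun y => y) = (fun y => y * 1)); last first.
    by apply/funext => y; rewrite mulr1.
  exact: (etrans h (Ex_cst gam 0)).
Qed.

Let K1 := Ex gam (fun y => `|y|).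
Let K3 := Ex gam (fun y => `|y| ^+ 3).

Let K1_ge0 : 0 <= K1. Proof. exact: Ex_ge0. Qed.
Let K3_ge0 : 0 <= K3. Proof. by apply: Ex_ge0 => y; exact: exprn_ge0. Qed.

(* The heat equation for [gsmooth f], in integrated form: the second order
   Taylor expansion in the standard deviation, where Stein's identity turns the
   first order term into one with [f2]. *)
Lemma gsmooth_heat : exists2 K : R, 0 <= K &
  forall (f f1 f2 : R -> R) (C : R), smooth3 f f1 f2 C ->
  forall s c x : R, 0 <= s -> 0 <= c ->
  `|gsmooth f (s + c) x - gsmooth f s x - c / 2 * gsmooth f2 s x| <=
    K * C * (c * Num.sqrt c).
Proof.
have [l1 l2 m2 m1] := normal_moments.
have l3 := @normal_prob_cube_integrable R.
exists (2 * K3 + (K1 + K3)); first by rewrite !addr_ge0// mulr_ge0.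
move=> f f1 f2 C sm s c x s0 c0; have [cf cf1 cf2] := smooth3_cont sm.
have C0 := smooth3_C0 sm.
set t := Num.sqrt s; set t' := Num.sqrt (s + c); set D := t' - t.
have t0 : 0 <= t by exact: sqrtr_ge0.
have D0 : 0 <= D by rewrite subr_ge0 ler_sqrt ?addr_ge0// lerDl.
have tt : t ^+ 2 = s by rewrite sqr_sqrtr.
have tt' : t' ^+ 2 = s + c by rewrite sqr_sqrtr ?addr_ge0.
(* [D] is the increment of the standard deviation. The first-order term will carry [t D] and the
   second-order one [D^2 / 2]; together they make [c / 2]. *)
have cE : c = D ^+ 2 + 2 * t * D.
  by rewrite -[LHS](addKr s) -tt' -tt /D; ring.
have tD0 : 0 <= t * D by exact: mulr_ge0.
set q := Num.sqrt c; have q0 : 0 <= q by exact: sqrtr_ge0.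
have qq : q ^+ 2 = c by rewrite sqr_sqrtr.
have Dq : D <= q by rewrite -(@ler_pXn2r _ 2)// ?nnegrE// qq cE; lra.
have g0 := L1_affine x t cf (smooth3_b0 sm).
have g0' := L1_affine x t' cf (smooth3_b0 sm).
have g1 := L1_affine x t cf1 (smooth3_b1 sm).
have g2 := L1_affine x t cf2 (smooth3_b2 sm).
have my : measurable_fun setT (fun y : R => y) by exact: measurable_id.
have m1f := meas_affine x t cf1; have m2f := meas_affine x t cf2.
have lid : L1 gam (fun y => y) by exact: (gL1_dom my l1).
have yg1 : L1 gam (fun y => y * f1 (x + t * y)).
  have := gL1M m1f (fun y => smooth3_b1 sm (x + t * y)) lid.
  by congr L1; apply/funext => y; rewrite mulrC.
have yg2 : L1 gam (fun y => y ^+ 2 * f2 (x + t * y)).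
  have := gL1M m2f (fun y => smooth3_b2 sm (x + t * y)) l2.
  by congr L1; apply/funext => y; rewrite mulrC.
pose M := Ex gam (fun y => y ^+ 2 * f2 (x + t * y)).
have st : Ex gam (fun y => y * f1 (x + t * y)) = t * gsmooth f2 s x.
  rewrite -(ExZ t g2).
  have Ct : C <= C * (1 + t) by rewrite ler_peMr// lerDl.
  apply: (@stein R (fun y => f1 (x + t * y)) (fun y => t * f2 (x + t * y)) (C * (1 + t))).
  - move=> y.
    have := @is_derive1_comp R f1 (fun u => x + t * u) y _ _
      (smooth3_d2 sm (x + t * y)) (is_derive1_affine x t y).
    by move/is_derive_eq; apply; rewrite mulrC.
  - by move=> y; apply: cvgMr; exact: cont_affine.
  - move=> y; apply: le_trans (smooth3_b1 sm _) _; apply: le_trans Ct _.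
    by rewrite ler_peMr ?lerDl// mulr_ge0// addr_ge0.
  - move=> y; rewrite normrM (ger0_norm t0) mulrDr mulr1 mulrC.
    by apply: ler_wpDl => //; rewrite ler_wpM2r//; exact: smooth3_b2 sm _.
have A : `|gsmooth f (s + c) x - gsmooth f s x - D * (t * gsmooth f2 s x) -
    D ^+ 2 / 2 * M| <= 2 * C * D ^+ 3 * K3.
  rewrite -st /M /gsmooth -/t -/t' -(ExZ D yg1) -(ExZ (D ^+ 2 / 2) yg2).
  have i1 := L1B g0' g0; have i2 := L1Z D yg1; have i4 := L1Z (D ^+ 2 / 2) yg2.
  have i3 := L1B i1 i2.
  rewrite -(ExB g0' g0) -(ExB i1 i2) -(ExB i3 i4) -(ExZ (2 * C * D ^+ 3) l3).
  apply: (@Ex_abs_le _ (measurableTypeR R) R gam).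
  - exact: (L1_meas (L1B i3 i4)).
  - exact: L1Z.
  - move=> y; have := taylor_cube sm (x + t * y) (D * y).
    have -> : x + t * y + D * y = x + t' * y by rewrite /D; ring.
    rewrite normrM (ger0_norm D0) exprMn mulrA.
    by congr (`|_| <= _); ring.
(* In the second-order term [y^2] is replaced by its mean 1: subtracting [(y^2 - 1) f2 x], of mean
   zero, leaves a difference of values of [f2] at distance [t |y|]. *)
have B : `|M - gsmooth f2 s x| <= C * t * (K1 + K3).
  have j1 : L1 gam (fun y => (y ^+ 2 - 1) * f2 x).
    have := L1Z (f2 x) (L1B l2 (L1_cst gam 1)).
    by congr L1; apply/funext => y; rewrite mulrC.
  have j2 := L1B yg2 g2.
  have e1 : Ex gam (fun y => (y ^+ 2 - 1) * f2 x) = 0.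
    transitivity (Ex gam (fun y => f2 x * (y ^+ 2 - 1))).
      by congr Ex; apply/funext => y; rewrite mulrC.
    have l21 := L1B l2 (L1_cst gam 1).
    by rewrite (ExZ (f2 x) l21) (ExB l2 (L1_cst gam 1)) m2 Ex_cst subrr mulr0.
  rewrite -[M - _]subr0 -e1 /M /gsmooth -/t -(ExB yg2 g2) -(ExB j2 j1).
  have l13 := L1D l1 l3.
  rewrite -(ExD l1 l3) -(ExZ (C * t) l13).
  apply: (@Ex_abs_le _ (measurableTypeR R) R gam).
  - exact: (L1_meas (L1B j2 j1)).
  - exact: L1Z.
  - move=> y.
    rewrite (_ : _ - _ = (y ^+ 2 - 1) * (f2 (x + t * y) - f2 x)); last by ring.
    rewrite normrM; have := smooth3_lip sm (x + t * y) x.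
    rewrite addrAC subrr add0r normrM (ger0_norm t0) => h.
    have h2 : `|y ^+ 2 - 1| <= `|y| ^+ 2 + 1.
      by apply: le_trans (ler_normB _ _) _; rewrite normr1 normrX.
    apply: le_trans (ler_pM _ _ h2 h) _ => //.
    by rewrite le_eqVlt; apply/orP; left; apply/eqP; ring.
have -> : gsmooth f (s + c) x - gsmooth f s x - c / 2 * gsmooth f2 s x =
   (gsmooth f (s + c) x - gsmooth f s x - D * (t * gsmooth f2 s x) -
    D ^+ 2 / 2 * M) + D ^+ 2 / 2 * (M - gsmooth f2 s x).
  by rewrite [in c / 2]cE; field.
apply: le_trans (ler_normD _ _) _; rewrite normrM.
rewrite (ger0_norm (_ : 0 <= D ^+ 2 / 2)); last by rewrite divr_ge0// sqr_ge0.
have d2 : 0 <= D ^+ 2 / 2 by rewrite divr_ge0// sqr_ge0.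
apply: le_trans (lerD A (ler_wpM2l d2 B)) _.
have u1 : D ^+ 3 <= c * q.
  by rewrite -qq -exprSr; apply: lerXn2r => //; rewrite nnegrE.
have u2 : D ^+ 2 * t <= c * q.
  have -> : D ^+ 2 * t = (t * D) * D by ring.
  by apply: ler_pM => //; rewrite cE; have := sqr_ge0 D; lra.
have cq0 : 0 <= c * q by exact: mulr_ge0.
have v1 : 2 * C * D ^+ 3 * K3 <= 2 * C * (c * q) * K3.
  by rewrite ler_wpM2r// ler_wpM2l// mulr_ge0.
have v2 : D ^+ 2 / 2 * (C * t * (K1 + K3)) <= c * q * (C * (K1 + K3)).
  have -> : D ^+ 2 / 2 * (C * t * (K1 + K3)) = (D ^+ 2 * t / 2) * (C * (K1 + K3)).
    by ring.
  rewrite ler_wpM2r ?mulr_ge0 ?addr_ge0//.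
  have : 0 <= D ^+ 2 * t by rewrite mulr_ge0// sqr_ge0.
  lra.
apply: le_trans (lerD v1 v2) _.
by rewrite le_eqVlt; apply/orP; left; apply/eqP; ring.
Qed.

(** By [gsmooth_heat] a change [c] of the variance costs [c / 2] times a bounded term plus
    [O(c sqrt c)], which is linear in [c] while variances stay below [B]. *)
Lemma gsmooth_var_lip : exists2 K : R, 0 <= K &
  forall (f f1 f2 : R -> R) (C B : R), smooth3 f f1 f2 C ->
  forall s s' x : R, 0 <= s <= B -> 0 <= s' <= B ->
  `|gsmooth f s x - gsmooth f s' x| <= K * C * (1 + B) * `|s - s'|.
Proof.
have [K K0 hK] := gsmooth_heat.
exists (K + 1) => [|f f1 f2 C B sm]; first by rewrite addr_ge0.
suff H s s' x : 0 <= s <= s' -> s' <= B ->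
    `|gsmooth f s x - gsmooth f s' x| <= (K + 1) * C * (1 + B) * `|s - s'|.
  move=> s s' x /andP[s0 sB] /andP[s'0 s'B]; have [ss'|s's] := leP s s'.
    by apply: H => //; rewrite s0.
  by rewrite distrC (distrC s); apply: H => //; rewrite s'0 ltW.
move=> /andP[s0 ss'] s'B.
have C0 := smooth3_C0 sm; have [cf cf1 cf2] := smooth3_cont sm.
set c := s' - s; have c0 : 0 <= c by rewrite subr_ge0.
have := hK _ _ _ _ sm s c x s0 c0.
rewrite (_ : s + c = s'); last by rewrite /c addrC subrK.
move=> h.
have b2 := gsmooth_bnd s x cf2 (smooth3_b2 sm).
rewrite distrC (distrC s) -/c (ger0_norm c0).
have q0 := sqrtr_ge0 c.
have B0 : 0 <= B by lra.
have qB : Num.sqrt c <= 1 + B.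
  apply: (@le_trans _ _ (Num.sqrt ((1 + B) ^+ 2))); last first.
    by rewrite sqrtr_sqr ger0_norm// addr_ge0.
  rewrite ler_sqrt ?sqr_ge0//; have := sqr_ge0 B; rewrite /c; nra.
have -> : gsmooth f s' x - gsmooth f s x =
  (gsmooth f s' x - gsmooth f s x - c / 2 * gsmooth f2 s x) + c / 2 * gsmooth f2 s x by ring.
apply: le_trans (ler_normD _ _) _.
have h1 : K * C * (c * Num.sqrt c) <= K * C * (c * (1 + B)).
  by rewrite ler_wpM2l ?mulr_ge0// ler_wpM2l.
have h2 : `|c / 2 * gsmooth f2 s x| <= C * (1 + B) * c.
  rewrite normrM (ger0_norm (_ : 0 <= c / 2)) ?divr_ge0//.
  apply: (@le_trans _ _ (C * c)).
    by have := normr_ge0 (gsmooth f2 s x); nra.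
  by rewrite ler_wpM2r// ler_peMr// lerDl.
apply: le_trans (lerD (le_trans h h1) h2) _.
by rewrite le_eqVlt; apply/orP; left; apply/eqP; ring.
Qed.

End gaussian_smoothing.

(** * Integrating out an independent variable *)

Section product_law.
Local Open Scope ereal_scope.

(** Independence on rectangles makes the joint law a product measure, and Tonelli's theorem applies.
    This serves both for the reinforcements and for the normal variable on the extension. *)
Lemma ge0_integral_indep d d1 d2 (T : measurableType d) (T1 : measurableType d1)
    (T2 : measurableType d2) (R : realType) (P : probability T R)
    (mu2 : probability T2 R) (X1 : {mfun T >-> T1}) (X2 : {mfun T >-> T2})
    (f : T1 * T2 -> \bar R) :
  (forall B, measurable B -> P (X2 @^-1` B) = mu2 B) ->
  (forall A B, measurable A -> measurable B ->
    P (X1 @^-1` A `&` X2 @^-1` B) = P (X1 @^-1` A) * P (X2 @^-1` B)) ->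
  measurable_fun setT f -> (forall z, 0 <= f z) ->
  \int[P]_w f (X1 w, X2 w) = \int[P]_w \int[mu2]_y f (X1 w, y).
Proof.
move=> law2 ind mf f0.
have mX : measurable_fun setT (fun w => (X1 w, X2 w)).
  by apply: measurable_fun_pair; exact: measurable_funPT.
pose X : {mfun T >-> (T1 * T2)%type} := mfun_Sub (mem_set mX).
pose mu1 := distribution P X1.
have E : forall B, measurable B -> (mu1 \x mu2) B = distribution P X B.
  apply: product_measure_unique => A B mA mB.
  transitivity (P (X1 @^-1` A `&` X2 @^-1` B)) => //.
  by rewrite ind// law2.
transitivity (\int[distribution P X]_z f z).
  by rewrite /distribution ge0_integral_pushforward//= preimage_setT.
rewrite (eq_measure_integral (mu1 \x mu2)); last first.
  by move=> B mB _; apply/esym; exact: E.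
rewrite fubini_tonelli1// /mu1 /distribution ge0_integral_pushforward//.
- exact: measurable_fun_fubini_tonelli_F.
- by move=> x _; apply: integral_ge0.
Qed.

End product_law.

Section normal_kernel.
Context d {T : measurableType d} {R : realType}.
Notation gam := (normal_prob 0 1 : probability (measurableTypeR R) R).

(** Adding the bound [C] makes the integrand nonnegative, as required by Tonelli's theorem. *)
Lemma integral_normal_shift (f : T * measurableTypeR R -> R) (C : R) :
  measurable_fun setT f -> (forall z, `|f z| <= C) -> forall w,
  (\int[gam]_y (f (w, y) + C)%:E = (Ex gam (fun y => f (w, y)) + C)%:E)%E.
Proof.
move=> mf fC w.
have lf : L1 gam (fun y => f (w, y)).
  by apply: (@L1_bnd _ (measurableTypeR R) R gam _ C) => //; exact: measurable_fun_pair2.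
have lg := L1D lf (L1_cst gam C).
transitivity (Ex gam (fun y => f (w, y) + C))%:E; first exact: (ExE lg).
by rewrite (ExD lf (L1_cst gam C)) (Ex_cst gam C).
Qed.

Lemma measurable_Ex_normal (f : T * measurableTypeR R -> R) (C : R) :
  measurable_fun setT f -> (forall z, `|f z| <= C) ->
  measurable_fun setT (fun w => Ex gam (fun y => f (w, y))).
Proof.
move=> mf fC.
have g0 z : (0 <= (f z + C)%:E)%E.
  by rewrite lee_fin -lerBlDr sub0r; have := fC z; rewrite ler_norml => /andP[].
have mg : measurable_fun setT (EFin \o (fun z => f z + C)).
  by apply/measurable_EFinP/measurable_funD.
have := @measurable_fun_fubini_tonelli_F _ _ T (measurableTypeR R) R gam
  (EFin \o (fun z => f z + C)) mg g0.
rewrite /fubini_F (_ : (fun x => _) =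
  (EFin \o (fun w => Ex gam (fun y => f (w, y)) + C))); last first.
  by apply/funext => w; rewrite (integral_normal_shift mf fC).
move/measurable_EFinP => h.
rewrite (_ : (fun w => _) = (fun w => (Ex gam (fun y => f (w, y)) + C) - C)).
  exact: measurable_funB.
by apply/funext => w; rewrite addrK.
Qed.

End normal_kernel.

(** * Expectations on the extended probability space *)

Section product_law_extension.
Context d d' {T : measurableType d} {T' : measurableType d'} {R : realType}.
Variables (P : probability T R) (Q : probability T' R) (pr : {mfun T' >-> T}).
Variable (N : {RV Q >-> R}).
Hypotheses (Qext : prob_extension P Q pr) (Nn : standard_normal N)
  (Nind : indep_of_base pr N).
Notation gam := (normal_prob 0 1 : probability (measurableTypeR R) R).

Lemma Ex_extension (F : T -> R) : L1 P F -> Ex Q (fun w => F (pr w)) = Ex P F.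
Proof.
move=> lF; have ge0E (G : T -> R) : L1 P G -> (forall w, 0 <= G w) ->
    L1 Q (fun w => G (pr w)) /\ Ex Q (fun w => G (pr w)) = Ex P G.
  move=> lG G0; have mG := L1_meas lG.
  have E : (\int[Q]_w (G (pr w))%:E = \int[P]_w (G w)%:E)%E.
    have := @ge0_integral_pushforward _ _ _ _ R pr (measurable_funPT pr) Q setT
      (EFin \o G) measurableT.
    rewrite preimage_setT => <-//.
    - by apply: eq_measure_integral => A mA _; exact: Qext.
    - exact/measurable_EFinP.
    - by move=> w _ /=; rewrite lee_fin.
  split; last by rewrite /Ex /Rintegral E.
  apply/integrableP; split.
    by apply/measurable_EFinP; exact: (measurableT_comp mG (measurable_funPT pr)).
  under eq_integral do rewrite /= ger0_norm//.
  by rewrite E (ExE lG) ltry.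
have la := L1_abs lF.
have [i1 E1] := ge0E _ la (fun w => normr_ge0 _).
have fp w : 0 <= F w + `|F w| by have := ler_norm (- F w); rewrite normrN; lra.
have [i2 E2] := ge0E _ (L1D lF la) fp.
rewrite (_ : (fun w => F (pr w)) =
  (fun w => (F (pr w) + `|F (pr w)|) - `|F (pr w)|)); last first.
  by apply/funext => w; rewrite addrK.
by rewrite (ExB i2 i1) E1 E2 (ExD lF la) addrK.
Qed.

(** Brings the limit, which lives on the extension, back to an expectation over the original
    space. *)
Lemma Ex_extension_normal (f : T * measurableTypeR R -> R) (C : R) :
  measurable_fun setT f -> (forall z, `|f z| <= C) ->
  measurable_fun setT (fun w => Ex gam (fun y => f (w, y))) /\
  Ex Q (fun w => f (pr w, N w)) = Ex P (fun w => Ex gam (fun y => f (w, y))).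
Proof.
move=> mf fC.
have lf w : L1 gam (fun y => f (w, y)).
  by apply: (@L1_bnd _ (measurableTypeR R) R gam _ C) => //; exact: measurable_fun_pair2.
pose g z := f z + C.
have g0 z : 0 <= g z by rewrite /g -lerBlDr sub0r; have := fC z; rewrite ler_norml => /andP[].
have mg : measurable_fun setT (EFin \o g).
  by apply/measurable_EFinP/measurable_funD.
have gE w : (\int[gam]_y (EFin \o g) (w, y) = (Ex gam (fun y => f (w, y)) + C)%:E)%E.
  exact: integral_normal_shift mf fC w.
have mE := measurable_Ex_normal mf fC.
split => //.
pose Nf : T' -> measurableTypeR R := N.
have mN : measurable_fun setT Nf.
  by move=> _ B mB; exact: (measurable_funPT N measurableT).
pose N' : {mfun T' >-> measurableTypeR R} := mfun_Sub (mem_set mN).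
have lE : L1 P (fun w => Ex gam (fun y => f (w, y))).
  apply: (@L1_bnd _ _ _ P _ C) => // w.
  by apply: (@Ex_abs_bnd _ (measurableTypeR R) R gam) => //; exact: measurable_fun_pair2.
have mpN : measurable_fun setT (fun w => (pr w, N' w)).
  by apply: measurable_fun_pair; exact: measurable_funPT.
have lQ : L1 Q (fun w => f (pr w, N' w)).
  by apply: (@L1_bnd _ _ _ Q _ C) => //; exact: (measurableT_comp mf mpN).
have H := @ge0_integral_indep _ _ _ T' T (measurableTypeR R) R Q gam pr N' (EFin \o g).
have {}H := H (fun B mB => Nn mB) (fun A B mA mB => ltac:(
   by rewrite setIC muleC; apply: Nind; [exists B => //; rewrite setTI|exists A => //; rewrite setTI])) mg
   (fun z => ltac:(by rewrite /= lee_fin)).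
have lEC := L1D lE (L1_cst P C).
have E1 : Ex Q (fun w => f (pr w, N' w) + C) =
          Ex Q (fun w => Ex gam (fun y => f (pr w, y)) + C).
  rewrite /Ex /Rintegral; congr fine; rewrite [LHS]H.
  by apply: eq_integral => w _; rewrite gE.
have := E1; rewrite (Ex_extension lEC) (ExD lQ (L1_cst Q C)) (ExD lE (L1_cst P C)).
by rewrite !Ex_cst => /addIr.
Qed.

End product_law_extension.

(** * Measurability with respect to a sub-sigma-algebra *)

Section sub_sigma_algebra_measurability.
Context {d} {T : measurableType d} {R : realType}.
Implicit Types (gens : set (set T)) (G : T -> R).

(** The domain is retyped with the generated sigma-algebra, so that the usual closure properties of
    measurable functions apply as they are. *)
Definition meas_wrt gens G :=
  measurable_fun (setT : set (g_sigma_algebraType gens)) (G : g_sigma_algebraType gens -> R).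

Lemma meas_wrt_sub gens gens' G : <<s gens >> `<=` <<s gens' >> ->
  meas_wrt gens G -> meas_wrt gens' G.
Proof. by move=> sub mG _ B mB; apply: sub; exact: mG. Qed.

Lemma meas_wrt_measurable gens G : gens `<=` measurable ->
  meas_wrt gens G -> measurable_fun setT G.
Proof.
move=> sub mG _ B mB; have := mG measurableT B mB.
by apply: smallest_sub => //; exact: sigma_algebra_measurable.
Qed.

Lemma meas_wrt_preimage gens G : g_sigma_algebra_preimage G `<=` <<s gens >> ->
  meas_wrt gens G.
Proof. by move=> sub _ B mB; apply: sub; exists B. Qed.

Lemma meas_wrt_comp gens (f : R -> R) G : measurable_fun setT f ->
  meas_wrt gens G -> meas_wrt gens (fun w => f (G w)).
Proof. by move=> mf mG; exact: (measurableT_comp mf mG). Qed.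

(** The identity into the coarser space is the random element that represents the past in
    [ge0_integral_weighted] and [ge0_integral_indep]. *)
Lemma measurable_id_sub gens : gens `<=` measurable ->
  measurable_fun setT (idfun : T -> g_sigma_algebraType gens).
Proof.
move=> sub _ B; rewrite setTI => mB.
move: mB; apply: smallest_sub => //; exact: sigma_algebra_measurable.
Qed.

End sub_sigma_algebra_measurability.

Lemma ord2_cases (k : 'I_2) : k = type1 \/ k = type2.
Proof. by case: k => [[|[|//]] ?]; [left|right]; exact/val_inj. Qed.

(** * Measurability and positivity for the urn *)

Section urn_basics.
Context {R : realType} {d : measure_display} {T : measurableType d}.
Variables (P : probability T R) (y0 : 'I_2 -> R) (U X : nat -> 'I_2 -> {RV P >-> R}).
Hypothesis urn : reinforced_urn y0 U X.

Local Notation Y := (urn_Y y0 U X).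
Local Notation frac := (urn_frac y0 U X).
Local Notation Z := (urn_Z y0 U X).

(** The generators of [urn_F m], kept apart because [meas_wrt] takes generators. *)
Definition urn_gens (m : nat) : set (set T) :=
  \bigcup_(l in [set l : nat | (1 <= l <= m)%N])
    (sigma_rv (U l) `|` sigma_rv (X l) `|` sigma_rv (Y l)).

(** The past together with the next draw: the next reinforcement is independent of all this. *)
Definition urn_past (m : nat) : set (set T) := urn_F y0 U X m `|` sigma_rv (X m.+1).

Local Notation measF m := (meas_wrt (urn_gens m)).

Definition urn_S (n : nat) (w : T) : R := Y n type1 w + Y n type2 w.

Definition urn_s0 : R := y0 type1 + y0 type2.

Lemma measurable_Y n k : measurable_fun setT (Y n k).
Proof.
elim: n => [|n IH] /=; first exact: measurable_cst.
by apply: measurable_funD => //; apply: measurable_funM; exact: measurable_funPT.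
Qed.

Lemma sigma_rv_sub (I : Type) (V : I -> T -> R) :
  (forall i, measurable_fun setT (V i)) -> sigma_rv V `<=` measurable.
Proof.
move=> mV; apply: smallest_sub; first exact: sigma_algebra_measurable.
by move=> A [i _] [B mB <-]; exact: mV.
Qed.

Lemma urn_gens_sub m : urn_gens m `<=` measurable.
Proof.
move=> A [l _] [[|]|]; apply: sigma_rv_sub => k; try exact: measurable_funPT.
exact: measurable_Y.
Qed.

Lemma urn_past_sub m : urn_past m `<=` measurable.
Proof.
move=> A [|]; last by apply: sigma_rv_sub => k; exact: measurable_funPT.
move: A; apply: smallest_sub; [exact: sigma_algebra_measurable|exact: urn_gens_sub].
Qed.

Lemma urn_gens_mono m n : (m <= n)%N -> <<s urn_gens m >> `<=` <<s urn_gens n >>.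
Proof.
move=> mn; apply: sub_sigma_algebra2 => A [l /andP[l1 lm] Al].
by exists l => //=; rewrite l1 (leq_trans lm).
Qed.

Lemma measF_mono m n (G : T -> R) : (m <= n)%N -> measF m G -> measF n G.
Proof. by move=> mn mG; apply: (meas_wrt_sub _ mG); exact: urn_gens_mono. Qed.

Lemma measF_meas m (G : T -> R) : measF m G -> measurable_fun setT G.
Proof. by move=> mG; exact: (meas_wrt_measurable (@urn_gens_sub m) mG). Qed.

Lemma measF_past m (G : T -> R) : measF m G -> meas_wrt (urn_past m) G.
Proof.
move=> mG; apply: (meas_wrt_sub _ mG) => A FA. apply: sub_sigma_algebra.
by left.
Qed.

Let sigma_rv_preimage (I : Type) (V : I -> T -> R) i :
  g_sigma_algebra_preimage (V i) `<=` sigma_rv V.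
Proof. by move=> A VA; apply: sub_sigma_algebra; exists i. Qed.

Lemma past_X m k : meas_wrt (urn_past m) (X m.+1 k).
Proof.
apply: meas_wrt_preimage => A VA; apply: sub_sigma_algebra; right.
exact: (@sigma_rv_preimage _ (fun i => X m.+1 i : T -> R) k A VA).
Qed.

Lemma measF_X m k : measF m.+1 (X m.+1 k).
Proof.
apply: meas_wrt_preimage => A VA; apply: sub_sigma_algebra.
exists m.+1 => //=; left; right.
exact: (@sigma_rv_preimage _ (fun i => X m.+1 i : T -> R) k A VA).
Qed.

Lemma measF_U m k : measF m.+1 (U m.+1 k).
Proof.
apply: meas_wrt_preimage => A VA; apply: sub_sigma_algebra.
exists m.+1 => //=; left; left.
exact: (@sigma_rv_preimage _ (fun i => U m.+1 i : T -> R) k A VA).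
Qed.

Lemma measF_Y m k : measF m (Y m k).
Proof.
case: m => [|m]; first exact: measurable_cst.
apply: meas_wrt_preimage => A VA; apply: sub_sigma_algebra.
exists m.+1 => //=; right.
exact: (@sigma_rv_preimage _ (fun i => Y m.+1 i : T -> R) k A VA).
Qed.

Lemma measF_S m : measF m (urn_S m).
Proof. by apply: measurable_funD; exact: measF_Y. Qed.

Lemma X_ge0 m k w : 0 <= X m.+1 k w.
Proof. by case: (urn_X_01 urn m k w) => ->. Qed.

Lemma X2E m w : X m.+1 type2 w = 1 - X m.+1 type1 w.
Proof. by rewrite -(urn_X_sum urn m w) addrAC subrr add0r. Qed.

Lemma Y_ge m k w : y0 k <= Y m k w.
Proof.
elim: m => [//|m IH] /=; apply: (le_trans IH).
by rewrite lerDl mulr_ge0 ?X_ge0// (urn_U_ge0 urn).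
Qed.

Lemma Y_gt0 m k w : 0 < Y m k w.
Proof. by apply: lt_le_trans (Y_ge m k w); exact: (urn_y0_gt0 urn). Qed.

Lemma s0_gt0 : 0 < urn_s0.
Proof. by rewrite addr_gt0// (urn_y0_gt0 urn). Qed.

Lemma S_ge m w : urn_s0 <= urn_S m w.
Proof. by rewrite lerD// Y_ge. Qed.

Lemma S_gt0 m w : 0 < urn_S m w.
Proof. by rewrite addr_gt0// Y_gt0. Qed.

Lemma S_neq0 m w : urn_S m w != 0.
Proof. by rewrite gt_eqF// S_gt0. Qed.

Lemma Z_gt0 m w : 0 < Z m w.
Proof. by rewrite divr_gt0 ?Y_gt0// S_gt0. Qed.

Lemma frac2E m w : frac m type2 w = 1 - Z m w.
Proof.
rewrite /urn_Z /urn_frac -/(urn_S m w) -[X in X - _](divff (S_neq0 m w)) -mulrBl.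
by rewrite /urn_S addrAC subrr add0r.
Qed.

Lemma Z_lt1 m w : Z m w < 1.
Proof. by rewrite -subr_gt0 -frac2E divr_gt0 ?Y_gt0// S_gt0. Qed.

Lemma Z_itv m w : 0 <= Z m w <= 1.
Proof. by rewrite (ltW (Z_gt0 m w)) (ltW (Z_lt1 m w)). Qed.

Lemma frac_itv m k w : 0 <= frac m k w <= 1.
Proof.
have := Z_itv m w; have := frac2E m w.
have [->|->] := ord2_cases k.
  by [].
by move=> -> /andP[? ?]; rewrite subr_ge0 gerBl; apply/andP.
Qed.

Lemma measF_invS m : measF m (fun w => (urn_S m w)^-1).
Proof.
have h := @measF_S m.
(* Inversion is continuous only away from 0; the truncation at [urn_s0] changes nothing by
   [S_ge]. *)
rewrite (_ : (fun w => _) = (fun w => (Num.max (urn_S m w) urn_s0)^-1)); last first.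
  by apply/funext => w; congr (_^-1); apply/esym/max_idPl; exact: S_ge.
apply: (@measurableT_comp _ _ _ _ _ _ (fun x : R => (Num.max x urn_s0)^-1)) => //.
apply: continuous_measurable_fun => x; apply: cvgV.
  by rewrite gt_eqF// lt_max s0_gt0 orbT.
exact: (@continuous_max R R (fun x => x) (fun=> urn_s0) x (@cvg_id _ _) (@cvg_cst _ _ _ _ _)).
Qed.

Lemma measF_frac m k : measF m (frac m k).
Proof. by apply: measurable_funM; [exact: measF_Y|exact: measF_invS]. Qed.

Lemma measF_Z m : measF m (Z m).
Proof. exact: measF_frac. Qed.

End urn_basics.

(** * One step of the urn, conditionally on the past *)

Section urn_conditioning.
Context {R : realType} {d : measure_display} {T : measurableType d}.
Variables (P : probability T R) (y0 : 'I_2 -> R) (U X : nat -> 'I_2 -> {RV P >-> R}).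
Hypothesis urn : reinforced_urn y0 U X.

Local Notation frac := (urn_frac y0 U X).
Local Notation measF m := (meas_wrt (urn_gens y0 U X m)).

Let U_law m k (B : set R) : measurable B ->
  P (U m.+1 k @^-1` B) = P (U 1%N k @^-1` B).
Proof.
move=> mB; pose pk (z : R * R) : R := if k == type1 then z.1 else z.2.
have mpk : measurable_fun setT pk.
  by rewrite /pk; case: (k == type1); [exact: measurable_fst|exact: measurable_snd].
have E l : U l.+1 k @^-1` B =
    (fun w => (U l.+1 type1 w, U l.+1 type2 w)) @^-1` (pk @^-1` B).
  by rewrite /pk; have [->|->] := ord2_cases k.
rewrite !E; apply: (urn_U_ident urn).
by rewrite -[_ @^-1` _]setTI; exact: mpk.
Qed.

Lemma U_ident m k (phi : R -> R) : measurable_fun setT phi -> (forall u, 0 <= phi u) ->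
  (\int[P]_w (phi (U m.+1 k w))%:E = \int[P]_w (phi (U 1%N k w))%:E)%E.
Proof.
move=> mphi phi0.
have E l : (\int[P]_w (phi (U l k w))%:E =
    \int[distribution P (U l k)]_u (phi u)%:E)%E.
  rewrite /distribution ge0_integral_pushforward ?preimage_setT//.
    exact/measurable_EFinP.
  by move=> u _; rewrite lee_fin.
rewrite !E; apply: eq_measure_integral => B mB _; exact: U_law.
Qed.

Let past_indep m k (H : T -> R) (phi : R -> R) :
  meas_wrt (urn_past y0 U X m) H -> (forall w, 0 <= H w) ->
  measurable_fun setT phi -> (forall u, 0 <= phi u) ->
  (\int[P]_w (H w * phi (U m.+1 k w))%:E =
   (\int[P]_w (H w)%:E) * (\int[P]_w (phi (U 1%N k w))%:E))%E.
Proof.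
move=> mH H0 mphi phi0.
pose T1 := g_sigma_algebraType (urn_past y0 U X m).
pose id1 : T -> T1 := idfun.
have mid : measurable_fun setT id1.
  by apply: measurable_id_sub; exact: urn_past_sub.
pose X1 : {mfun T >-> T1} := mfun_Sub (mem_set mid).
pose X2 : {mfun T >-> R} := U m.+1 k.
pose f (z : T1 * R) : \bar R := ((H : T1 -> R) z.1 * phi z.2)%:E.
have mf : measurable_fun setT f.
  apply/measurable_EFinP; apply: measurable_funM.
    exact: (measurableT_comp (mH : measurable_fun setT (H : T1 -> R)) measurable_fst).
  exact: (measurableT_comp mphi measurable_snd).
have f0 z : (0 <= f z)%E by rewrite lee_fin mulr_ge0.
have law2 (B : set R) : measurable B -> P (X2 @^-1` B) = distribution P (U 1%N k) B.
  exact: U_law.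
have ind (A : set T1) (B : set R) : measurable A -> measurable B ->
    P (X1 @^-1` A `&` X2 @^-1` B) = (P (X1 @^-1` A) * P (X2 @^-1` B))%E.
  move=> mA mB; rewrite setIC muleC; apply: (urn_U_indep_past urn (m := m)); last exact: mA.
  by apply: sub_sigma_algebra; exists k => //; exists B => //; rewrite setTI.
have := ge0_integral_indep law2 ind mf f0.
rewrite /f /= => ->.
have mE : measurable_fun setT (EFin \o phi) by exact/measurable_EFinP.
have cE : (\int[distribution P (U 1%N k)]_u (phi u)%:E =
    \int[P]_w (phi (U 1%N k w))%:E)%E.
  by rewrite /distribution ge0_integral_pushforward ?preimage_setT// => u _; rewrite lee_fin.
transitivity (\int[P]_w ((H w)%:E * \int[P]_w (phi (U 1%N k w))%:E))%E.
  apply: eq_integral => w _; rewrite -cE.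
  under eq_integral do rewrite EFinM.
  rewrite ge0_integralZl//; last by rewrite lee_fin; exact: H0.
  by move=> u _; rewrite lee_fin.
rewrite ge0_integralZr//.
- apply/measurable_EFinP; exact: (meas_wrt_measurable (@urn_past_sub _ _ _ _ _ _ _ _) mH).
- by move=> w _; rewrite lee_fin.
- by apply: integral_ge0 => w _; rewrite lee_fin.
Qed.

(** By the drawing rule [X m.+1 k] and [frac m k] have the same integral over every event of the
    first [m] stages, which makes them interchangeable weights. *)
Let draw_cond m k (G : T -> R) : measF m G -> (forall w, 0 <= G w) ->
  (\int[P]_w (G w * X m.+1 k w)%:E = \int[P]_w (G w * frac m k w)%:E)%E.
Proof.
move=> mG G0.
pose T1 := g_sigma_algebraType (urn_gens y0 U X m).
pose id1 : T -> T1 := idfun.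
have mid : measurable_fun setT id1.
  by apply: measurable_id_sub; exact: urn_gens_sub.
have [_ _ cp] := urn_draw urn m k.
have mX : measurable_fun setT (X m.+1 k) by exact: measurable_funPT.
have mfr : measurable_fun setT (frac m k).
  exact: (meas_wrt_measurable (@urn_gens_sub _ _ _ _ _ _ _ _) (measF_frac urn k)).
apply: (@ge0_integral_weighted _ _ _ T T T1 R P P id1 id1 _ _ G) => //.
- by move=> w; exact: (X_ge0 urn).
- by move=> w; case/andP: (frac_itv urn m k w).
move=> A mA.
have mA' : d.-measurable (A : set T) by have := mid measurableT A mA; rewrite setTI.
rewrite [RHS](cp _ mA) [LHS]integral_mkcond.
have mE : measurable [set w | X m.+1 k w = 1].
  by rewrite (_ : [set w | _] = X m.+1 k @^-1` [set 1]).
have mXA : d.-measurable ([set w | X m.+1 k w = 1] `&` (A : set T)).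
  exact: measurableI.
rewrite -(setIT (_ `&` A)) -integral_indic//.
apply: eq_integral => w _; rewrite patchE indicE.
case: (boolP (w \in _)) => wA.
  move: wA; rewrite inE => wA.
  case: (urn_X_01 urn m k w) => Xw; rewrite Xw.
    by rewrite memNset//= => -[]; rewrite Xw => /eqP; rewrite eq_sym oner_eq0.
  by rewrite mem_set.
by rewrite memNset// => -[_ wA']; move/negP: wA; apply; rewrite inE.
Qed.

Let ge0_step m k (G : T -> R) (phi : R -> R) : measF m G -> (forall w, 0 <= G w) ->
  measurable_fun setT phi -> (forall u, 0 <= phi u) ->
  (\int[P]_w (G w * X m.+1 k w * phi (U m.+1 k w))%:E =
   (\int[P]_w (G w * frac m k w)%:E) * (\int[P]_w (phi (U 1%N k w))%:E))%E.
Proof.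
move=> mG G0 mphi phi0; rewrite -draw_cond//.
apply: (@past_indep m k (fun w => G w * X m.+1 k w)) => //.
- by apply: measurable_funM; [exact: measF_past|exact: past_X].
- by move=> w; rewrite mulr_ge0// (X_ge0 urn).
Qed.

Lemma L1_U_ident m k (phi : R -> R) : measurable_fun setT phi ->
  L1 P (fun w => phi (U 1%N k w)) ->
  L1 P (fun w => phi (U m.+1 k w)).
Proof.
move=> mphi lphi; apply/integrableP; split.
  apply/measurable_EFinP; exact: (measurableT_comp mphi (measurable_funPT _)).
rewrite (eq_integral (fun w => (`|phi (U m.+1 k w)|)%:E))//.
rewrite (@U_ident m k (fun u => `|phi u|))//.
  by rewrite (ExE (L1_abs lphi)) ltry.
exact: measurableT_comp.
Qed.

Lemma Ex_U_ident m k (phi : R -> R) : measurable_fun setT phi -> (forall u, 0 <= phi u) ->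
  Ex P (fun w => phi (U m.+1 k w)) = Ex P (fun w => phi (U 1%N k w)).
Proof. by move=> mphi phi0; rewrite /Ex /Rintegral U_ident. Qed.

(* Conditionally on the first [m] stages, the draw has law [frac m] and the
   reinforcement is independent of it. *)
Lemma Ex_step m k (G : T -> R) (phi : R -> R) : measF m G -> L1 P G ->
  measurable_fun setT phi -> L1 P (fun w => phi (U 1%N k w)) ->
  L1 P (fun w => G w * X m.+1 k w * phi (U m.+1 k w)) /\
  Ex P (fun w => G w * X m.+1 k w * phi (U m.+1 k w)) =
  Ex P (fun w => G w * frac m k w) * Ex P (fun w => phi (U 1%N k w)).
Proof.
have ge0P (G' : T -> R) (phi' : R -> R) : measF m G' -> (forall w, 0 <= G' w) ->
    L1 P G' -> measurable_fun setT phi' -> (forall u, 0 <= phi' u) ->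
    L1 P (fun w => phi' (U 1%N k w)) ->
    L1 P (fun w => G' w * X m.+1 k w * phi' (U m.+1 k w)) /\
    Ex P (fun w => G' w * X m.+1 k w * phi' (U m.+1 k w)) =
    Ex P (fun w => G' w * frac m k w) * Ex P (fun w => phi' (U 1%N k w)).
  move=> mG G0 lG mphi phi0 lphi.
  have mGT := meas_wrt_measurable (@urn_gens_sub _ _ _ _ _ _ _ _) mG.
  have mfr := meas_wrt_measurable (@urn_gens_sub _ _ _ _ _ _ _ _) (@measF_frac _ _ _ _ _ _ _ urn m k).
  have lGf : L1 P (fun w => G' w * frac m k w).
    apply: (L1_dom _ lG); first exact: measurable_funM.
    move=> w; have /andP[f0 f1] := frac_itv urn m k w.
    by rewrite normrM !ger0_norm// ler_piMr.
  have E := ge0_step k mG G0 mphi phi0.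
  rewrite (ExE lGf) (ExE lphi) -EFinM in E.
  split; last by rewrite /Ex /Rintegral in E *; rewrite E.
  apply/integrableP; split.
    apply/measurable_EFinP/measurable_funM.
      by apply: measurable_funM => //; exact: measurable_funPT.
    exact: (measurableT_comp mphi (measurable_funPT _)).
  rewrite (eq_integral (fun w => (G' w * X m.+1 k w * phi' (U m.+1 k w))%:E)).
    by rewrite E ltry.
  by move=> w _ /=; rewrite ger0_norm// !mulr_ge0// (X_ge0 urn).
move=> mG lG mphi lphi.
have mfr := meas_wrt_measurable (@urn_gens_sub _ _ _ _ _ _ _ _) (@measF_frac _ _ _ _ _ _ _ urn m k).
(* Both [G] and [phi] are split as [(x + |x|) - |x|], which yields four nonnegative cases. *)
have fp (x : R) : 0 <= x + `|x| by have := ler_norm (- x); rewrite normrN; lra.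
have maG : measF m (fun w => `|G w|) by exact: measurableT_comp.
have mpG : measF m (fun w => G w + `|G w|) by exact: measurable_funD.
have maphi : measurable_fun setT (fun u => `|phi u|) by exact: measurableT_comp.
have mpphi : measurable_fun setT (fun u => phi u + `|phi u|) by exact: measurable_funD.
have laG := L1_abs lG; have lpG := L1D lG laG.
have laphi := L1_abs lphi; have lpphi := L1D lphi laphi.
have [i1 E1] := ge0P _ _ mpG (fun w => fp _) lpG mpphi (fun w => fp _) lpphi.
have [i2 E2] := ge0P _ _ mpG (fun w => fp _) lpG maphi (fun w => normr_ge0 _) laphi.
have [i3 E3] := ge0P _ _ maG (fun w => normr_ge0 _) laG mpphi (fun w => fp _) lpphi.
have [i4 E4] := ge0P _ _ maG (fun w => normr_ge0 _) laG maphi (fun w => normr_ge0 _) laphi.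
have lGf (G' : T -> R) : L1 P G' -> L1 P (fun w => G' w * frac m k w).
  move=> lG'; apply: (L1_dom _ (L1_abs lG')).
    by apply: measurable_funM => //; exact: L1_meas lG'.
  move=> w; have /andP[f0 f1] := frac_itv urn m k w.
  by rewrite normrM (ger0_norm f0) ler_piMr.
have j12 := L1B i1 i2; have j123 := L1B j12 i3.
rewrite (_ : (fun w => G w * X m.+1 k w * phi (U m.+1 k w)) = (fun w =>
  (G w + `|G w|) * X m.+1 k w * (phi (U m.+1 k w) + `|phi (U m.+1 k w)|) -
  (G w + `|G w|) * X m.+1 k w * `|phi (U m.+1 k w)| -
  `|G w| * X m.+1 k w * (phi (U m.+1 k w) + `|phi (U m.+1 k w)|) +
  `|G w| * X m.+1 k w * `|phi (U m.+1 k w)|)); last by apply/funext => w; ring.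
split; first exact: L1D.
rewrite (ExD j123 i4) (ExB j12 i3) (ExB i1 i2) E1 E2 E3 E4.
have -> : Ex P (fun w => (G w + `|G w|) * frac m k w) =
    Ex P (fun w => G w * frac m k w) + Ex P (fun w => `|G w| * frac m k w).
  rewrite -(ExD (lGf _ lG) (lGf _ laG)); congr Ex.
  by apply/funext => w; rewrite mulrDl.
rewrite (ExD lphi laphi); ring.
Qed.

End urn_conditioning.

(** * Martingale differences of the urn *)

Section urn_martingales.
Context {R : realType} {d : measure_display} {T : measurableType d}.
Variables (P : probability T R) (y0 : 'I_2 -> R) (U X : nat -> 'I_2 -> {RV P >-> R}).
Hypothesis urn : reinforced_urn y0 U X.

Local Notation frac := (urn_frac y0 U X).
Local Notation measF m := (meas_wrt (urn_gens y0 U X m)).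

(** Square-integrable martingale differences, [D j] being observed at time [j + 1]; orthogonality to
    the past replaces conditional expectations. *)
Definition mdiff (D : nat -> T -> R) := forall j,
  [/\ measF j.+1 (D j), L1 P (fun w => D j w ^+ 2) &
      forall G, measF j G -> L1 P (fun w => G w ^+ 2) ->
        Ex P (fun w => G w * D j w) = 0].

Lemma measF_sum (D : nat -> T -> R) a b : (forall j, measF j.+1 (D j)) ->
  measF b (fun w => \sum_(a <= j < b) D j w).
Proof.
move=> mD; have [ab|ba] := leqP a b; last first.
  rewrite (_ : (fun w => _) = (fun=> 0)); first exact: measurable_cst.
  by apply/funext => w; rewrite big_geq// ltnW.
elim: b ab => [|b IH].
  rewrite leqn0 => /eqP ->; rewrite (_ : (fun w => _) = (fun=> 0)).
    exact: measurable_cst.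
  by apply/funext => w; rewrite big_geq.
rewrite leq_eqVlt => /predU1P[->|ab].
  rewrite (_ : (fun w => _) = (fun=> 0)); first exact: measurable_cst.
  by apply/funext => w; rewrite big_geq.
rewrite (_ : (fun w => _) = (fun w => \sum_(a <= j < b) D j w + D b w)); last first.
  by apply/funext => w; rewrite big_nat_recr.
apply: measurable_funD; last exact: mD.
by apply: (measF_mono (leqnSn b)); exact: IH.
Qed.

(** Pythagoras: each new difference is orthogonal to the sum of the previous ones. *)
Lemma mdiff_sum (D : nat -> T -> R) a b : mdiff D ->
  L1 P (fun w => (\sum_(a <= j < b) D j w) ^+ 2) /\
  Ex P (fun w => (\sum_(a <= j < b) D j w) ^+ 2) =
    \sum_(a <= j < b) Ex P (fun w => D j w ^+ 2).
Proof.
move=> mD.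
have triv c : (c <= a)%N -> L1 P (fun w => (\sum_(a <= j < c) D j w) ^+ 2) /\
    Ex P (fun w => (\sum_(a <= j < c) D j w) ^+ 2) =
    \sum_(a <= j < c) Ex P (fun w => D j w ^+ 2).
  move=> ca; rewrite (_ : (fun w => _) = (fun=> 0)).
    by rewrite Ex_cst big_geq//; split=> //; exact: L1_cst.
  by apply/funext => w; rewrite big_geq// expr0n.
elim: b => [|b [lb IH]]; first exact: triv.
have [ab|ba] := leqP a b; last exact: triv.
pose M w := \sum_(a <= j < b) D j w.
have mM : measF b M by apply: measF_sum => j; case: (mD j).
have [mDb lDb oDb] := mD b.
have mMT := measF_meas mM; have mDT := measF_meas mDb.
have lMD := L1_mul mMT mDT lb lDb.
rewrite (_ : (fun w => _) = (fun w => M w ^+ 2 + (2 * (M w * D b w) + D b w ^+ 2))).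
  have i1 := L1Z 2 lMD; have i2 := L1D i1 lDb.
  split; first exact: L1D.
  by rewrite (ExD lb i2) (ExD i1 lDb) (ExZ 2 lMD) oDb// mulr0 add0r IH big_nat_recr.
by apply/funext => w; rewrite big_nat_recr//= -/(M w); ring.
Qed.

Section one_step.
Variables (j : nat) (p q : T -> R) (phi psi : R -> R) (B : R).
Hypotheses (mp : measF j p) (mq : measF j q)
  (mphi : measurable_fun setT phi) (mpsi : measurable_fun setT psi)
  (lphi : L1 P (fun w => phi (U 1%N type1 w) ^+ 2))
  (lpsi : L1 P (fun w => psi (U 1%N type2 w) ^+ 2)).

(** The common form of the increments below: a factor [p] or [q] known at time [j], according to the
    type drawn, times a function of the new reinforcement of that type. *)
Definition urn_step w := p w * X j.+1 type1 w * phi (U j.+1 type1 w) +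
  q w * X j.+1 type2 w * psi (U j.+1 type2 w).

Lemma measF_step : measF j.+1 urn_step.
Proof.
have mU k (f : R -> R) : measurable_fun setT f -> measF j.+1 (fun w => f (U j.+1 k w)).
  by move=> mf; exact: (measurableT_comp mf (@measF_U _ _ _ _ y0 U X j k)).
apply: measurable_funD; apply: measurable_funM; try exact: mU;
  by apply: measurable_funM; [exact: (measF_mono (leqnSn j))|exact: measF_X].
Qed.

Let comp_phi : measurable_fun setT (fun w => phi (U 1%N type1 w)).
Proof. exact: (measurableT_comp mphi (measurable_funPT _)). Qed.
Let comp_psi : measurable_fun setT (fun w => psi (U 1%N type2 w)).
Proof. exact: (measurableT_comp mpsi (measurable_funPT _)). Qed.

Lemma Ex_urn_step (G : T -> R) : measF j G ->
  L1 P (fun w => G w * p w) -> L1 P (fun w => G w * q w) ->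
  L1 P (fun w => G w * urn_step w) /\
  Ex P (fun w => G w * urn_step w) =
    Ex P (fun w => G w * p w * frac j type1 w) * Ex P (fun w => phi (U 1%N type1 w)) +
    Ex P (fun w => G w * q w * frac j type2 w) * Ex P (fun w => psi (U 1%N type2 w)).
Proof.
move=> mG lGp lGq.
have [i1 E1] := Ex_step urn (measurable_funM mG mp) lGp mphi (L1_sqr comp_phi lphi).
have [i2 E2] := Ex_step urn (measurable_funM mG mq) lGq mpsi (L1_sqr comp_psi lpsi).
rewrite (_ : (fun w => G w * urn_step w) = (fun w =>
   G w * p w * X j.+1 type1 w * phi (U j.+1 type1 w) +
   G w * q w * X j.+1 type2 w * psi (U j.+1 type2 w))); last first.
  by apply/funext => w; rewrite /urn_step; ring.
by split; [exact: L1D|rewrite (ExD i1 i2) E1 E2].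
Qed.

(** The two draw indicators are 0 or 1 and never both 1, so the square has no cross term. *)
Lemma Ex_urn_step_sqr (G : T -> R) : measF j G ->
  L1 P (fun w => G w * p w ^+ 2) -> L1 P (fun w => G w * q w ^+ 2) ->
  L1 P (fun w => G w * urn_step w ^+ 2) /\
  Ex P (fun w => G w * urn_step w ^+ 2) =
    Ex P (fun w => G w * p w ^+ 2 * frac j type1 w) *
      Ex P (fun w => phi (U 1%N type1 w) ^+ 2) +
    Ex P (fun w => G w * q w ^+ 2 * frac j type2 w) *
      Ex P (fun w => psi (U 1%N type2 w) ^+ 2).
Proof.
move=> mG lGp lGq.
have mp2 : measF j (fun w => p w ^+ 2) by exact: measurable_funX.
have mq2 : measF j (fun w => q w ^+ 2) by exact: measurable_funX.
have mphi2 : measurable_fun setT (fun u => phi u ^+ 2) by exact: measurable_funX.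
have mpsi2 : measurable_fun setT (fun u => psi u ^+ 2) by exact: measurable_funX.
have [i1 E1] := @Ex_step _ _ _ _ _ _ _ urn j type1 _ _ (measurable_funM mG mp2) lGp mphi2 lphi.
have [i2 E2] := @Ex_step _ _ _ _ _ _ _ urn j type2 _ _ (measurable_funM mG mq2) lGq mpsi2 lpsi.
rewrite (_ : (fun w => G w * urn_step w ^+ 2) = (fun w =>
   G w * p w ^+ 2 * X j.+1 type1 w * phi (U j.+1 type1 w) ^+ 2 +
   G w * q w ^+ 2 * X j.+1 type2 w * psi (U j.+1 type2 w) ^+ 2)); last first.
  apply/funext => w; rewrite /urn_step (X2E urn).
  by case: (urn_X_01 urn j type1 w) => ->; ring.
by split; [exact: L1D|rewrite (ExD i1 i2) E1 E2].
Qed.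

Hypotheses (pB : forall w, `|p w| <= B) (qB : forall w, `|q w| <= B).

Let mpT : measurable_fun setT p. Proof. exact: measF_meas mp. Qed.
Let mqT : measurable_fun setT q. Proof. exact: measF_meas mq. Qed.

Let sqrB (x : R) : `|x| <= B -> `|x ^+ 2| <= B ^+ 2.
Proof. by move=> xB; rewrite normrX lerXn2r// nnegrE// (le_trans _ xB). Qed.

Lemma L1_urn_step_sqr : L1 P (fun w => urn_step w ^+ 2).
Proof.
have l (r : T -> R) : measurable_fun setT r -> (forall w, `|r w| <= B) ->
    L1 P (fun w => 1 * r w ^+ 2).
  move=> mr rB; apply: (@L1_bnd _ _ _ P _ (B ^+ 2)).
    by apply: measurable_funM => //; exact: measurable_funX.
  by move=> w; rewrite mul1r sqrB.
have [i _] := @Ex_urn_step_sqr (fun=> 1) (measurable_cst _) (l _ mpT pB) (l _ mqT qB).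
by move: i; congr L1; apply/funext => w; rewrite mul1r.
Qed.

Lemma Ex_urn_step_sqr_le (H : T -> R) : measurable_fun setT H ->
  (forall w, `|H w| <= B) ->
  (forall w, `|p w| <= `|H w|) -> (forall w, `|q w| <= `|H w|) ->
  Ex P (fun w => urn_step w ^+ 2) <= Ex P (fun w => H w ^+ 2) *
    (Ex P (fun w => phi (U 1%N type1 w) ^+ 2) +
     Ex P (fun w => psi (U 1%N type2 w) ^+ 2)).
Proof.
move=> mH HB pH qH.
have l (r : T -> R) : measurable_fun setT r -> (forall w, `|r w| <= B) ->
    L1 P (fun w => 1 * r w ^+ 2).
  move=> mr rB; apply: (@L1_bnd _ _ _ P _ (B ^+ 2)).
    by apply: measurable_funM => //; exact: measurable_funX.
  by move=> w; rewrite mul1r sqrB.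
have [_] := @Ex_urn_step_sqr (fun=> 1) (measurable_cst _) (l _ mpT pB) (l _ mqT qB).
rewrite (_ : (fun w => 1 * urn_step w ^+ 2) = (fun w => urn_step w ^+ 2)); last first.
  by apply/funext => w; rewrite mul1r.
move=> ->.
have lH : L1 P (fun w => H w ^+ 2).
  apply: (@L1_bnd _ _ _ P _ (B ^+ 2)); first exact: measurable_funX.
  by move=> w; exact: sqrB.
have le k (r : T -> R) : measurable_fun setT r -> (forall w, `|r w| <= `|H w|) ->
    Ex P (fun w => 1 * r w ^+ 2 * frac j k w) <= Ex P (fun w => H w ^+ 2).
  move=> mr rH; apply: Ex_ge0_le => //.
    apply: measurable_funM; first by apply: measurable_funM => //; exact: measurable_funX.
    exact: (measF_meas (measF_frac urn k)).
  move=> w; have /andP[f0 f1] := frac_itv urn j k w; rewrite mul1r.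
  rewrite mulr_ge0 ?sqr_ge0//=; apply: (@le_trans _ _ (r w ^+ 2)).
    by rewrite ler_piMr// sqr_ge0.
  rewrite -(real_normK (num_real (r w))) -(real_normK (num_real (H w))).
  by rewrite lerXn2r// nnegrE.
by rewrite mulrDr lerD// ler_wpM2r ?le//; apply: Ex_ge0 => w; exact: sqr_ge0.
Qed.

Hypothesis centered : forall w,
  p w * frac j type1 w * Ex P (fun w => phi (U 1%N type1 w)) +
  q w * frac j type2 w * Ex P (fun w => psi (U 1%N type2 w)) = 0.

Lemma Ex_urn_step0 (G : T -> R) : measF j G -> L1 P G ->
  Ex P (fun w => G w * urn_step w) = 0.
Proof.
move=> mG lG.
have l (r : T -> R) : measurable_fun setT r -> (forall w, `|r w| <= B) ->
    L1 P (fun w => G w * r w).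
  move=> mr rB; have := L1M_bnd mr rB lG.
  by congr L1; apply/funext => w; rewrite mulrC.
have lf k (r : T -> R) : measurable_fun setT r -> (forall w, `|r w| <= B) ->
    L1 P (fun w => G w * r w * frac j k w).
  move=> mr rB.
  have mf := measF_meas (@measF_frac _ _ _ _ _ _ _ urn j k).
  have fB w : `|frac j k w| <= 1.
    by have /andP[f0 f1] := frac_itv urn j k w; rewrite ger0_norm.
  have := L1M_bnd mf fB (l _ mr rB).
  by congr L1; apply/funext => w; rewrite mulrC.
have [_ ->] := Ex_urn_step mG (l _ mpT pB) (l _ mqT qB).
set a := Ex P (fun w => phi _); set b := Ex P (fun w => psi _).
rewrite mulrC -(ExZ a (lf type1 _ mpT pB)) [X in _ + X]mulrC.
rewrite -(ExZ b (lf type2 _ mqT qB)) -ExD; last 2 first.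
- exact: L1Z (lf _ _ mpT pB).
- exact: L1Z (lf _ _ mqT qB).
rewrite (_ : (fun w => _) = (fun=> 0)) ?Ex_cst//; apply/funext => w.
transitivity (G w * (p w * frac j type1 w * a + q w * frac j type2 w * b)); first by ring.
by rewrite centered mulr0.
Qed.

End one_step.

Lemma urn_mdiff (p q : nat -> T -> R) (phi psi : nat -> R -> R) (B : nat -> R) :
  (forall j, measF j (p j)) -> (forall j, measF j (q j)) ->
  (forall j, measurable_fun setT (phi j)) -> (forall j, measurable_fun setT (psi j)) ->
  (forall j, L1 P (fun w => phi j (U 1%N type1 w) ^+ 2)) ->
  (forall j, L1 P (fun w => psi j (U 1%N type2 w) ^+ 2)) ->
  (forall j w, `|p j w| <= B j) -> (forall j w, `|q j w| <= B j) ->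
  (forall j w, p j w * frac j type1 w * Ex P (fun w => phi j (U 1%N type1 w)) +
    q j w * frac j type2 w * Ex P (fun w => psi j (U 1%N type2 w)) = 0) ->
  mdiff (fun j => urn_step j (p j) (q j) (phi j) (psi j)).
Proof.
move=> mp mq mphi mpsi lphi lpsi pB qB cen j; split.
- exact: measF_step.
- by apply: (@L1_urn_step_sqr j (p j) (q j) (phi j) (psi j) (B j)).
- move=> G mG lG; apply: (@Ex_urn_step0 j (p j) (q j) (phi j) (psi j) (B j)) => //.
  exact: (L1_sqr (measF_meas mG) lG).
Qed.

End urn_martingales.

(** * Growth of the total weight *)

Section urn_total.
Context {R : realType} {d : measure_display} {T : measurableType d}.
Variables (P : probability T R) (y0 : 'I_2 -> R) (U X : nat -> 'I_2 -> {RV P >-> R}).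
Hypothesis urn : reinforced_urn y0 U X.
Variable m : R.
Hypotheses (m_gt0 : 0 < m) (mean : forall k, Ex P (fun w => U 1%N k w) = m)
  (U_L2 : forall k, L1 P (fun w => U 1%N k w ^+ 2)).

Local Notation frac := (urn_frac y0 U X).
Local Notation Z := (urn_Z y0 U X).
Local Notation S := (urn_S y0 U X).
Local Notation s0 := (urn_s0 y0).
Local Notation measF m := (meas_wrt (urn_gens y0 U X m)).

Definition urn_q : R := Ex P (fun w => U 1%N type1 w ^+ 2) + Ex P (fun w => U 1%N type2 w ^+ 2).
Local Notation q := urn_q.

Lemma U_L1 k : L1 P (fun w => U 1%N k w).
Proof. by apply: L1_sqr (U_L2 k); exact: measurable_funPT. Qed.

Lemma U2_le_q k : 0 <= Ex P (fun w => U 1%N k w ^+ 2) <= q.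
Proof.
have h i : 0 <= Ex P (fun w => U 1%N i w ^+ 2) by apply: Ex_ge0 => w; exact: sqr_ge0.
rewrite h /q /=; have := h type1; have := h type2.
by have [->|->] := ord2_cases k; lra.
Qed.

Lemma q_ge0 : 0 <= q. Proof. by have := U2_le_q type1; lra. Qed.

Lemma S_succ n w : S n.+1 w =
  S n w + (X n.+1 type1 w * U n.+1 type1 w + X n.+1 type2 w * U n.+1 type2 w).
Proof. by rewrite /urn_S /=; ring. Qed.

(** [2 * del = m^2 / (m + q)] is the maximum of [2 t m - t^2 (m + q)], attained at
    [t = m / (m + q)], see [laplace_U]. The factor 2 leaves half of the exponent for [small_S]. *)
Let del : R := m ^+ 2 / (m + q) / 2.

Let del_gt0 : 0 < del.
Proof. by rewrite !divr_gt0 ?exprn_gt0// ltr_wpDr// q_ge0. Qed.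

(** The absolute value keeps the function bounded on the whole line and has no effect on the
    reinforcements, which are nonnegative. *)
Let measurable_expN : measurable_fun setT (fun u : R => expR (- `|u|)).
Proof.
apply: measurableT_comp; first exact: measurable_expR.
by apply: measurable_funN; exact: normr_measurable.
Qed.

(* [exp(-u) <= 1/(1+u)], and [u/(1+u) >= 2 t u - t^2 u (1+u)] by AM-GM. *)
Let laplace_U k : Ex P (fun w => expR (- `|U 1%N k w|)) <= expR (- (2 * del)).
Proof.
apply: le_trans _ (expR_ge1Dx _); set t := m / (m + q).
have mq : 0 < m + q by rewrite ltr_wpDr// q_ge0.
have i1 := L1Z (- (2 * t) + t ^+ 2) (U_L1 k); have i2 := L1Z (t ^+ 2) (U_L2 k).
have i3 := L1D i1 i2; have i4 := L1D (L1_cst P 1) i3.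
apply: (@le_trans _ _ (Ex P (fun w => 1 + ((- (2 * t) + t ^+ 2) * U 1%N k w +
    t ^+ 2 * U 1%N k w ^+ 2)))).
  apply: Ex_ge0_le => //.
    exact: (measurableT_comp measurable_expN (measurable_funPT _)).
  move=> w; rewrite expR_ge0/=; have u0 := urn_U_ge0 urn 0 k w.
  rewrite ger0_norm// expRN; set u := U 1%N k w in u0 *.
  have u1 : 0 < 1 + u by rewrite ltr_wpDr.
  apply: (@le_trans _ _ (1 + u)^-1).
    by rewrite lef_pV2 ?posrE ?expR_gt0// expR_ge1Dx.
  rewrite -subr_ge0 [leRHS](_ : _ = u / (1 + u) * (1 - t * (1 + u)) ^+ 2).
    by rewrite mulr_ge0 ?sqr_ge0// divr_ge0// ltW.
  by field; rewrite gt_eqF.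
rewrite (ExD (L1_cst P 1) i3) (ExD i1 i2) (ExZ _ (U_L1 k)) (ExZ _ (U_L2 k)) Ex_cst mean.
have /andP[e0 eq] := U2_le_q k; have t2 := sqr_ge0 t.
have : t ^+ 2 * Ex P (fun w => U 1%N k w ^+ 2) <= t ^+ 2 * q by rewrite ler_wpM2l.
have -> : 2 * del = 2 * t * m - t ^+ 2 * (m + q).
  by rewrite /del /t; field; rewrite gt_eqF.
lra.
Qed.

Let measF_expS n : measF n (fun w => expR (- S n w)).
Proof.
apply: (@meas_wrt_comp _ _ _ _ (fun x => expR (- x))); last exact: measF_S.
apply: measurableT_comp; first exact: measurable_expR.
by apply: measurable_funN; exact: measurable_id.
Qed.

Let expS_le1 n w : `|expR (- S n w)| <= 1.
Proof. by rewrite ger0_norm ?expR_ge0// -expR0 ler_expR oppr_le0 ltW// (S_gt0 urn). Qed.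

Let expS_L1 n : L1 P (fun w => expR (- S n w)).
Proof. by apply: (@L1_bnd _ _ _ P _ 1) => //; exact: (measF_meas (@measF_expS n)). Qed.

(** Whatever type is drawn, the new reinforcement is independent of the past and of the draw, and
    contributes the factor of [laplace_U]. *)
Lemma laplace_S : exists2 del : R, 0 < del &
  forall n, Ex P (fun w => expR (- S n w)) <= expR (- (2 * del) * n%:R).
Proof.
exists del => //; elim=> [|n IH].
  rewrite mulr0 expR0; apply: Ex_bnd; first exact: (measF_meas (@measF_expS 0)).
  exact: expS_le1.
pose f (u : R) := expR (- `|u|).
have fL2 k : L1 P (fun w => f (U 1%N k w) ^+ 2).
  apply: (@L1_bnd _ _ _ P _ 1).
    apply: measurable_funX; exact: (measurableT_comp measurable_expN (measurable_funPT _)).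
  move=> w; rewrite normrX -[leRHS](expr1n _ 2) lerXn2r ?nnegrE// ger0_norm ?expR_ge0//.
  by rewrite -expR0 ler_expR oppr_le0.
have mE := @measF_expS n; have lE := @expS_L1 n.
have l1 : L1 P (fun w => 1 * expR (- S n w)).
  by move: lE; congr L1; apply/funext => w; rewrite mul1r.
have [_] := @Ex_urn_step _ _ _ _ _ _ _ urn n _ _ f f mE mE
  measurable_expN measurable_expN (fL2 _) (fL2 _) (fun=> 1) (measurable_cst _) l1 l1.
rewrite (_ : (fun w => 1 * urn_step _ _ _ _ _ _ _ w) = (fun w => expR (- S n.+1 w))); last first.
  apply/funext => w; rewrite mul1r /urn_step /f S_succ opprD expRD (X2E urn).
  have u1 := urn_U_ge0 urn n type1 w; have u2 := urn_U_ge0 urn n type2 w.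
  rewrite !ger0_norm//; case: (urn_X_01 urn n type1 w) => ->;
    by rewrite ?subr0 ?subrr !(mul0r, mulr0, mul1r, mulr1, addr0, add0r) /urn_S !opprD !expRD ?mulrA.
move=> ->.
have lf k : L1 P (fun w => 1 * expR (- S n w) * frac n k w).
  apply: (L1_dom _ lE).
    apply: measurable_funM; first exact: L1_meas l1.
    exact: (measF_meas (measF_frac urn k)).
  move=> w; have /andP[f0 f1] := frac_itv urn n k w.
  by rewrite mul1r normrM !ger0_norm ?expR_ge0// ler_piMr// expR_ge0.
have lf0 k : 0 <= Ex P (fun w => 1 * expR (- S n w) * frac n k w).
  apply: Ex_ge0 => w; have /andP[f0 _] := frac_itv urn n k w.
  by rewrite mul1r mulr_ge0// expR_ge0.
have lfE : Ex P (fun w => 1 * expR (- S n w) * frac n type1 w) +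
    Ex P (fun w => 1 * expR (- S n w) * frac n type2 w) = Ex P (fun w => expR (- S n w)).
  rewrite -(ExD (lf _) (lf _)); congr Ex; apply/funext => w.
  by rewrite (frac2E urn) -/(Z n w) /urn_Z; ring.
apply: le_trans (lerD (ler_wpM2l (lf0 _) (laplace_U _)) (ler_wpM2l (lf0 _) (laplace_U _))) _.
rewrite -mulrDl lfE -[n.+1%:R]natr1 mulrDr expRD mulr1 ler_wpM2r ?expR_ge0//.
Qed.

(* Off the event [S < del (n+1)], of exponentially small probability, the
   functions of [S] below are of the right order; on it they grow polynomially. *)
Let small_S : exists del C : R, [/\ 0 < del, 0 <= C &
  forall n, Ex P (fun w => expR (del * n.+1%:R - S n w)) <= C / n.+1%:R ^+ 3].
Proof.
have [a a0 ha] := laplace_S; exists a, (expR (2 * a) * (3 / a) ^+ 3); split=> //.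
  by rewrite mulr_ge0 ?expR_ge0// exprn_ge0// divr_ge0// ltW.
move=> n; rewrite (_ : (fun w => _) =
  (fun w => expR (a * n.+1%:R) * expR (- S n w))); last first.
  by apply/funext => w; rewrite expRD.
rewrite (ExZ _ (@expS_L1 n)).
apply: (@le_trans _ _ (expR (a * n.+1%:R) * expR (- (2 * a) * n%:R))).
  by rewrite ler_wpM2l ?expR_ge0.
have x0 : 0 < n.+1%:R :> R by rewrite ltr0n.
(* The decay used is [exp (- x) <= (3 / x)^3] for [x = a (n + 1)], the cube of
   [x / 3 <= exp (x / 3)]. *)
have -> : expR (a * n.+1%:R) * expR (- (2 * a) * n%:R) =
    expR (2 * a) * (expR (a * n.+1%:R / 3) ^+ 3)^-1.
  by rewrite -expRM_natl -expRN -!expRD; congr expR; rewrite -[n.+1%:R]natr1; field.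
rewrite -[leRHS]mulrA ler_wpM2l ?expR_ge0//.
have -> : (3 / a) ^+ 3 / n.+1%:R ^+ 3 = ((a * n.+1%:R / 3) ^+ 3)^-1 :> R.
  by field; rewrite !gt_eqF.
have y0' : 0 < a * n.+1%:R / 3 by rewrite divr_gt0// mulr_gt0.
rewrite lef_pV2 ?posrE ?exprn_gt0 ?expR_gt0//.
rewrite lerXn2r ?nnegrE ?expR_ge0 ?(ltW y0')//.
by apply: le_trans (expR_ge1Dx _); rewrite lerDr.
Qed.

Let measS n : measurable_fun setT (S n).
Proof. exact: (measF_meas (@measF_S _ _ _ _ y0 U X n)). Qed.

Let measVS n : measurable_fun setT (fun w => (S n w)^-1).
Proof. exact: (measF_meas (@measF_invS _ _ _ _ _ _ _ urn n)). Qed.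

(** If [S n >= a (n + 1)], the inverse square is at most [(a (n + 1))^-2]. Otherwise it is at most
    [s0^-2], and the exponential of [small_S], then at least 1, pays for it. *)
Lemma Ex_invS_sqr : exists2 C : R, 0 <= C &
  forall n, L1 P (fun w => (S n w)^-1 ^+ 2) /\
    Ex P (fun w => (S n w)^-1 ^+ 2) <= C / n.+1%:R ^+ 2.
Proof.
have [a [C [a0 C0 hC]]] := small_S.
have s00 : 0 < s0 by exact: s0_gt0 urn.
exists ((a ^+ 2)^-1 + (s0 ^+ 2)^-1 * C) => [|n].
  by rewrite addr_ge0 ?mulr_ge0// invr_ge0 sqr_ge0.
have x0 : 0 < n.+1%:R :> R by rewrite ltr0n.
have le : Ex P (fun w => expR (a * n.+1%:R - S n w)) <= C / n.+1%:R ^+ 2.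
  apply: le_trans (hC n) _; rewrite ler_wpM2l// lef_pV2 ?posrE ?exprn_gt0//.
  by rewrite ler_weXn2l// ler1n.
have lE : L1 P (fun w => expR (a * n.+1%:R - S n w)).
  rewrite (_ : (fun w => _) = (fun w => expR (a * n.+1%:R) * expR (- S n w))).
    exact: L1Z.
  by apply/funext => w; rewrite expRD.
have i1 := L1Z (s0 ^+ 2)^-1 lE.
have i2 := L1D (L1_cst P ((a * n.+1%:R) ^+ 2)^-1) i1.
have b w : 0 <= (S n w)^-1 ^+ 2 <=
    ((a * n.+1%:R) ^+ 2)^-1 + (s0 ^+ 2)^-1 * expR (a * n.+1%:R - S n w).
  rewrite sqr_ge0/= exprVn; have Sp := S_gt0 urn n w.
  have [aS|Sa] := leP (a * n.+1%:R) (S n w).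
    rewrite ler_wpDr ?mulr_ge0 ?expR_ge0 ?invr_ge0 ?sqr_ge0//.
    rewrite lef_pV2 ?posrE ?exprn_gt0 ?mulr_gt0//.
    by rewrite lerXn2r// ?nnegrE ?(ltW Sp)// mulr_ge0// ltW.
  rewrite ler_wpDl ?invr_ge0 ?sqr_ge0//.
  apply: (@le_trans _ _ (s0 ^+ 2)^-1).
    rewrite lef_pV2 ?posrE ?exprn_gt0//.
    by rewrite lerXn2r ?nnegrE ?(ltW Sp) ?(ltW s00)//; exact: S_ge urn _ _.
  rewrite ler_peMr ?invr_ge0 ?sqr_ge0// -[leLHS]expR0 ler_expR subr_ge0 ltW//.
have mS2 : measurable_fun setT (fun w => (S n w)^-1 ^+ 2) by exact: measurable_funX.
split; first by apply: (L1_dom mS2 i2) => w; have /andP[h1 h2] := b w; rewrite ger0_norm.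
apply: le_trans (Ex_ge0_le mS2 i2 b) _.
rewrite (ExD (L1_cst P _) i1) Ex_cst (ExZ _ lE) mulrDl exprMn invfM lerD//.
by rewrite -mulrA ler_wpM2l// invr_ge0 sqr_ge0.
Qed.

(** [S n - n m] is [s0] plus a martingale sum of centred reinforcements. The shift from [n] to
    [n + 1] changes only the constant and avoids division by 0 in rates. *)
Lemma Ex_S_sqr : exists2 C : R, 0 <= C &
  forall n, L1 P (fun w => (S n w - n.+1%:R * m) ^+ 2) /\
    Ex P (fun w => (S n w - n.+1%:R * m) ^+ 2) <= C * n.+1%:R.
Proof.
pose f (u : R) := u - m.
have mf : measurable_fun setT f by exact: measurable_funB.
have mU k : measurable_fun setT (fun w => U 1%N k w) by exact: measurable_funPT.
have fL2 k : L1 P (fun w => f (U 1%N k w) ^+ 2).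
  apply: L1_sqrD => //.
  by rewrite (_ : (fun w => (- m) ^+ 2) = cst (m ^+ 2)); [exact: L1_cst|apply/funext => w; rewrite sqrrN].
have f0 k : Ex P (fun w => f (U 1%N k w)) = 0.
  by rewrite (ExB (U_L1 k) (L1_cst P m)) Ex_cst mean subrr.
pose D n := urn_step U X n (fun=> 1) (fun=> 1) f f.
have m1 n : measF n (fun=> 1 : R) by exact: measurable_cst.
have n1 (w : T) : `|(fun=> 1 : R) w| <= 1 by rewrite normr1.
have mD : mdiff y0 U X D.
  apply: (@urn_mdiff _ _ _ _ _ _ _ urn (fun=> fun=> 1) (fun=> fun=> 1) (fun=> f)
    (fun=> f) (fun=> 1)) => //.
  by move=> j w; rewrite !f0 !mulr0 addr0.
pose K := Ex P (fun w => f (U 1%N type1 w) ^+ 2) + Ex P (fun w => f (U 1%N type2 w) ^+ 2).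
have K0 : 0 <= K by rewrite addr_ge0//; apply: Ex_ge0 => w; exact: sqr_ge0.
have DK j : Ex P (fun w => D j w ^+ 2) <= K.
  have := @Ex_urn_step_sqr_le _ _ _ _ _ _ _ urn j _ _ _ _ _ (m1 j) (m1 j) mf mf (fL2 _) (fL2 _)
    n1 n1 (fun=> 1) (measurable_cst _) n1 (fun w => lexx _) (fun w => lexx _).
  by rewrite expr1n Ex_cst mul1r.
have SE n w : S n w - n.+1%:R * m = (\sum_(0 <= j < n) D j w) + (s0 - m).
  elim: n => [|n IH]; first by rewrite big_geq// add0r mul1r.
  rewrite big_nat_recr//= S_succ /D /urn_step /f (X2E urn).
  rewrite -[n.+2%:R]natr1 mulrDl mul1r.
  have -> : S n w = \sum_(0 <= j < n) D j w + (s0 - m) + n.+1%:R * m by rewrite -IH subrK.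
  rewrite /D /urn_step /f; under eq_bigr do rewrite (X2E urn).
  ring.
exists (2 * (K + (s0 - m) ^+ 2)) => [|n].
  by rewrite mulr_ge0// addr_ge0// sqr_ge0.
have [ls Es] := mdiff_sum 0 n mD.
have i1 := L1D ls (L1_cst P ((s0 - m) ^+ 2)); have i2 := L1Z 2 i1.
have mS : measurable_fun setT (fun w => (S n w - n.+1%:R * m) ^+ 2).
  by apply: measurable_funX; exact: measurable_funB.
have b w : 0 <= (S n w - n.+1%:R * m) ^+ 2 <=
    2 * ((\sum_(0 <= j < n) D j w) ^+ 2 + (s0 - m) ^+ 2).
  rewrite sqr_ge0/= SE; set x := \sum_(_ <= _ < _) _.
  rewrite -subr_ge0 [leRHS](_ : _ = (x - (s0 - m)) ^+ 2) ?sqr_ge0//; ring.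
split; first by apply: (L1_dom mS i2) => w; have /andP[h1 h2] := b w; rewrite ger0_norm.
apply: le_trans (Ex_ge0_le mS i2 b) _.
rewrite (ExZ 2 i1) (ExD ls (L1_cst P _)) Ex_cst Es -mulrA ler_wpM2l// mulrDl lerD//.
  apply: (@le_trans _ _ (\sum_(0 <= j < n) K)); first by apply: ler_sum.
  rewrite sumr_const_nat subn0 -[K *+ n]mulr_natr ler_wpM2l// ler_nat//.
by rewrite ler_peMr ?sqr_ge0// ler1n.
Qed.

(** The difference is [(S n - (n + 1) m) / (m S n)], with [Ex_S_sqr] for the numerator. Where [S n]
    is small the square may be of order [n^2], which the rate [n^-3] of [small_S] outweighs. *)
Lemma Ex_ratio_sqr : exists2 C : R, 0 <= C &
  forall n, Ex P (fun w => (m^-1 - n.+1%:R / S n w) ^+ 2) <= C / n.+1%:R.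
Proof.
have [a [C [a0 C0 hC]]] := small_S.
have [C1 C10 hC1] := Ex_S_sqr.
have s00 : 0 < s0 by exact: s0_gt0 urn.
pose K := 2 * ((m ^+ 2)^-1 + (s0 ^+ 2)^-1).
have K0 : 0 <= K by rewrite mulr_ge0// addr_ge0// invr_ge0 sqr_ge0.
exists (C1 / (m * a) ^+ 2 + K * C) => [|n].
  by apply: addr_ge0; apply: mulr_ge0 => //; rewrite invr_ge0 sqr_ge0.
have x0 : 0 < n.+1%:R :> R by rewrite ltr0n.
have x1 : 1 <= n.+1%:R :> R by rewrite ler1n.
have lE : L1 P (fun w => expR (a * n.+1%:R - S n w)).
  rewrite (_ : (fun w => _) = (fun w => expR (a * n.+1%:R) * expR (- S n w))).
    exact: L1Z.
  by apply/funext => w; rewrite expRD.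
have [lS ES] := hC1 n.
have i1 := L1Z ((m * (a * n.+1%:R)) ^+ 2)^-1 lS.
have i2 := L1Z (K * n.+1%:R ^+ 2) lE.
have i3 := L1D i1 i2.
have b w : 0 <= (m^-1 - n.+1%:R / S n w) ^+ 2 <=
    ((m * (a * n.+1%:R)) ^+ 2)^-1 * (S n w - n.+1%:R * m) ^+ 2 +
    K * n.+1%:R ^+ 2 * expR (a * n.+1%:R - S n w).
  rewrite sqr_ge0/=; have Sp := S_gt0 urn n w.
  have [aS|Sa] := leP (a * n.+1%:R) (S n w).
    apply: ler_wpDr.
      by rewrite mulr_ge0 ?expR_ge0// mulr_ge0// sqr_ge0.
    have -> : m^-1 - n.+1%:R / S n w = (m * S n w)^-1 * (S n w - n.+1%:R * m).
      by field; rewrite !gt_eqF.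
    rewrite exprMn ler_wpM2r ?sqr_ge0// exprVn lef_pV2 ?posrE ?exprn_gt0 ?mulr_gt0//.
    by rewrite lerXn2r// ?nnegrE ?mulr_ge0 ?(ltW Sp) ?(ltW a0) ?(ltW m_gt0)// ler_wpM2l// ltW.
  apply: ler_wpDl; first by rewrite mulr_ge0 ?invr_ge0 ?sqr_ge0.
  apply: (@le_trans _ _ (K * n.+1%:R ^+ 2)); last first.
    apply: ler_peMr; first by rewrite mulr_ge0// sqr_ge0.
    by rewrite -[leLHS]expR0 ler_expR subr_ge0 ltW.
  have hy : (n.+1%:R / S n w) ^+ 2 <= (s0 ^+ 2)^-1 * n.+1%:R ^+ 2.
    rewrite exprMn exprVn mulrC ler_wpM2r ?sqr_ge0// lef_pV2 ?posrE ?exprn_gt0//.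
    by rewrite lerXn2r ?nnegrE ?(ltW Sp) ?(ltW s00)//; exact: S_ge urn _ _.
  have hx : m^-1 ^+ 2 <= (m ^+ 2)^-1 * n.+1%:R ^+ 2.
    by rewrite exprVn ler_peMr ?invr_ge0 ?sqr_ge0// -[leLHS](expr1n _ 2) lerXn2r ?nnegrE.
  have := sqr_ge0 (m^-1 + n.+1%:R / S n w); rewrite /K; nra.
have mr : measurable_fun setT (fun w => (m^-1 - n.+1%:R / S n w) ^+ 2).
  by apply: measurable_funX; apply: measurable_funB => //; exact: measurable_funM.
apply: le_trans (Ex_ge0_le mr i3 b) _.
rewrite (ExD i1 i2) (ExZ _ lS) (ExZ _ lE) mulrDl lerD//.
  apply: (@le_trans _ _ (((m * (a * n.+1%:R)) ^+ 2)^-1 * (C1 * n.+1%:R))).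
    by rewrite ler_wpM2l// invr_ge0 sqr_ge0.
  by rewrite le_eqVlt; apply/orP; left; apply/eqP; field; rewrite !gt_eqF.
apply: (@le_trans _ _ (K * n.+1%:R ^+ 2 * (C / n.+1%:R ^+ 3))).
  by rewrite ler_wpM2l// mulr_ge0// sqr_ge0.
by rewrite le_eqVlt; apply/orP; left; apply/eqP; field; rewrite gt_eqF.
Qed.

End urn_total.

(** * Tails of inverse squares, and blocks of indices *)

Section inverse_square_sums.
Context {R : realType}.

(** Each term is at most [2 / (j + 1) - 2 / (j + 2)], and these differences telescope. *)
Lemma sum_invsq_le (a b : nat) :
  \sum_(a <= j < b) (j.+1%:R ^+ 2)^-1 <= 2 / a.+1%:R :> R.
Proof.
have [ba|ab] := leqP b a.
  by rewrite big_geq// divr_ge0.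
suff : \sum_(a <= j < b) (j.+1%:R ^+ 2)^-1 <= 2 / a.+1%:R - 2 / b.+1%:R :> R.
  by move=> h; apply: le_trans h _; rewrite gerBl divr_ge0.
have step (n : nat) : (n.+1%:R ^+ 2)^-1 <= 2 / n.+1%:R - 2 / n.+2%:R :> R.
  rewrite -[n.+2%:R]natr1; have : 1 <= n.+1%:R :> R by rewrite ler1n.
  move: (n.+1%:R : R) => x x1; have x0 : 0 < x by rewrite (lt_le_trans _ x1).
  rewrite -subr_ge0 [leRHS](_ : _ = (x - 1) / (x ^+ 2 * (x + 1))).
    by rewrite divr_ge0 ?subr_ge0// mulr_ge0 ?sqr_ge0// addr_ge0// ltW.
  by field; rewrite !gt_eqF// addr_gt0.
elim: b ab => // b IH; rewrite ltnS leq_eqVlt => /predU1P[->|ab].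
  by rewrite big_nat1 step.
rewrite big_nat_recr ?(ltnW ab)//=; apply: le_trans (lerD (IH ab) (step b)) _.
by rewrite addrA subrK.
Qed.

Lemma block_index (N : nat -> nat) (r0 i : nat) :
  (forall r, (N r < N r.+1)%N) -> (N r0 <= i)%N ->
  exists2 r, (r0 <= r)%N & (N r <= i <= N r.+1)%N.
Proof.
move=> sN; elim: i => [|i IH].
  rewrite leqn0 => /eqP N0; exists r0 => //; by rewrite N0.
rewrite leq_eqVlt => /predU1P[<-|]; first by exists r0; rewrite // leqnn ltnW.
rewrite ltnS => /IH[r r0r /andP[Ni iN]].
have [iN'|Ni'] := ltnP i (N r.+1).
  by exists r => //; rewrite iN' (leq_trans Ni).
exists r.+1; first exact: leq_trans r0r _.
have -> : i = N r.+1 by apply/eqP; rewrite eqn_leq iN Ni'.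
by rewrite leqnSn sN.
Qed.

End inverse_square_sums.

(** * Increments of the proportion [Z] *)

Section urn_proportion.
Context {R : realType} {d : measure_display} {T : measurableType d}.
Variables (P : probability T R) (y0 : 'I_2 -> R) (U X : nat -> 'I_2 -> {RV P >-> R}).
Hypothesis urn : reinforced_urn y0 U X.
Variable m : R.
Hypotheses (m_gt0 : 0 < m) (mean : forall k, Ex P (fun w => U 1%N k w) = m)
  (U_L2 : forall k, L1 P (fun w => U 1%N k w ^+ 2)).

Local Notation Z := (urn_Z y0 U X).
Local Notation S := (urn_S y0 U X).
Local Notation s0 := (urn_s0 y0).
Local Notation measF m := (meas_wrt (urn_gens y0 U X m)).
Local Notation q := (urn_q U).

Definition urn_xi j := urn_step U X j (fun w => 1 - Z j w) (fun w => - Z j w) id id.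
Definition urn_V j := urn_step U X j (fun=> 1) (fun=> 1) id id.

Lemma urn_V_ge0 j w : 0 <= urn_V j w.
Proof.
by rewrite /urn_V /urn_step !mul1r addr_ge0// mulr_ge0 ?(X_ge0 urn)// (urn_U_ge0 urn).
Qed.

Lemma urn_xi_le j w : `|urn_xi j w| <= urn_V j w.
Proof.
rewrite /urn_xi /urn_V /urn_step !mul1r.
have u1 := urn_U_ge0 urn j type1 w; have u2 := urn_U_ge0 urn j type2 w.
have x1 := X_ge0 urn j type1 w; have x2 := X_ge0 urn j type2 w.
have /andP[z0 z1] := Z_itv urn j w.
have h1 : 0 <= X j.+1 type1 w * U j.+1 type1 w by exact: mulr_ge0.
have h2 : 0 <= X j.+1 type2 w * U j.+1 type2 w by exact: mulr_ge0.
apply: le_trans (ler_normD _ _) _; rewrite /= -!mulrA !normrM normrN.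
rewrite (ger0_norm x1) (ger0_norm x2) (ger0_norm u1) (ger0_norm u2) (ger0_norm z0).
by rewrite lerD// ler_piMl// ger0_norm ?subr_ge0// gerBl.
Qed.

Lemma S_step j w : S j.+1 w = S j w + urn_V j w.
Proof. by rewrite S_succ /urn_V /urn_step !mul1r. Qed.

Lemma Z_step j w : Z j.+1 w - Z j w = urn_xi j w / S j.+1 w.
Proof.
have h0 := S_neq0 urn j w; have h1 := S_neq0 urn j.+1 w.
apply: (mulIf h1); rewrite mulfVK// mulrBl.
have -> : Z j.+1 w * S j.+1 w = urn_Y y0 U X j.+1 type1 w by rewrite /urn_Z /urn_frac mulfVK.
have YE : urn_Y y0 U X j type1 w = Z j w * S j w by rewrite /urn_Z /urn_frac mulfVK.
by rewrite S_step /= YE /urn_V /urn_xi /urn_step /=; ring.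
Qed.

Lemma Z_step_le j w : `|Z j.+1 w - Z j w| <= urn_V j w / S j w.
Proof.
rewrite Z_step normrM normfV (ger0_norm (ltW (S_gt0 urn j.+1 w))).
apply: ler_pM; rewrite ?invr_ge0 ?(ltW (S_gt0 urn _ _))//; first exact: urn_xi_le.
by rewrite lef_pV2 ?posrE ?(S_gt0 urn)// S_step lerDl urn_V_ge0.
Qed.

(* The increment of [Z] with [S j.+1] replaced by [S j]: a martingale difference,
   up to an error of the order of [urn_dV j ^+ 2]. *)
Definition urn_dM j := urn_step U X j (fun w => (1 - Z j w) * (S j w)^-1)
  (fun w => - Z j w * (S j w)^-1) id id.

Definition urn_dV j := urn_step U X j (fun w => (S j w)^-1) (fun w => (S j w)^-1) id id.

Lemma urn_dME j w : urn_dM j w = urn_xi j w / S j w.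
Proof. by rewrite /urn_dM /urn_xi /urn_step; ring. Qed.

Lemma urn_dVE j w : urn_dV j w = urn_V j w / S j w.
Proof. by rewrite /urn_dV /urn_V /urn_step; ring. Qed.

(** The difference is [- xi V / (S j * S j.+1)], where [|xi| <= V] and [S j <= S j.+1]. *)
Lemma Z_step_dM j w : `|(Z j.+1 w - Z j w) - urn_dM j w| <= urn_dV j w ^+ 2.
Proof.
have h0 := S_gt0 urn j w; have h1 := S_gt0 urn j.+1 w; have V0 := urn_V_ge0 j w.
have -> : (Z j.+1 w - Z j w) - urn_dM j w =
    - (urn_xi j w * (urn_V j w / (S j w * S j.+1 w))).
  rewrite Z_step urn_dME; have -> : urn_V j w = S j.+1 w - S j w by rewrite S_step; ring.
  by field; rewrite !gt_eqF.
rewrite normrN normrM urn_dVE (ger0_norm (_ : 0 <= urn_V j w / _)); last first.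
  by rewrite divr_ge0// mulr_ge0// ltW.
rewrite (_ : (urn_V j w / S j w) ^+ 2 = urn_V j w * (urn_V j w / (S j w * S j w))); last first.
  by field; rewrite gt_eqF.
apply: ler_pM => //.
- by rewrite divr_ge0// mulr_ge0// ltW.
- exact: urn_xi_le.
- rewrite ler_wpM2l// lef_pV2 ?posrE ?mulr_gt0// ler_wpM2l ?(ltW h0)//.
  by rewrite S_step lerDl.
Qed.

Let mid : measurable_fun setT (id : R -> R). Proof. exact: measurable_id. Qed.

Let measF_V j : measF j (fun w => (S j w)^-1).
Proof. exact: measF_invS. Qed.

Let measF_p j : measF j (fun w => (1 - Z j w) * (S j w)^-1).
Proof.
apply: measurable_funM; last exact: measF_V.
by apply: measurable_funB; [exact: measurable_cst|exact: measF_Z].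
Qed.

Let measF_n j : measF j (fun w => - Z j w * (S j w)^-1).
Proof.
apply: measurable_funM; last exact: measF_V.
by apply: measurable_funN; exact: measF_Z.
Qed.

Let invS_le j w : `|(S j w)^-1| <= s0^-1.
Proof.
rewrite ger0_norm ?invr_ge0 ?(ltW (S_gt0 urn _ _))//.
by rewrite lef_pV2 ?posrE ?(S_gt0 urn)// ?(s0_gt0 urn)//; exact: S_ge urn _ _.
Qed.

Let p_le j w : `|(1 - Z j w) * (S j w)^-1| <= `|(S j w)^-1|.
Proof.
have /andP[z0 z1] := Z_itv urn j w.
by rewrite normrM ler_piMl// ger0_norm ?subr_ge0// gerBl.
Qed.

Let n_le j w : `|- Z j w * (S j w)^-1| <= `|(S j w)^-1|.
Proof.
have /andP[z0 z1] := Z_itv urn j w.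
by rewrite normrM ler_piMl// normrN ger0_norm.
Qed.

Lemma urn_dM_mdiff : mdiff y0 U X urn_dM.
Proof.
apply: (@urn_mdiff _ _ _ _ _ _ _ urn (fun j w => (1 - Z j w) * (S j w)^-1)
   (fun j w => - Z j w * (S j w)^-1) (fun=> id) (fun=> id) (fun=> s0^-1)) => //.
- by move=> j w; apply: le_trans (p_le j w) _.
- by move=> j w; apply: le_trans (n_le j w) _.
- move=> j w; rewrite (mean type1) (mean type2) (frac2E urn).
  by rewrite -/(Z j w) /urn_Z; ring.
Qed.

Lemma urn_dV_meas j : measF j.+1 (urn_dV j).
Proof. exact: measF_step. Qed.

Lemma urn_step_bounds : exists2 C : R, 0 <= C &
  forall j, [/\ L1 P (fun w => urn_dV j w ^+ 2),
    Ex P (fun w => urn_dV j w ^+ 2) <= C / j.+1%:R ^+ 2 &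
    Ex P (fun w => urn_dM j w ^+ 2) <= C / j.+1%:R ^+ 2].
Proof.
have [C C0 hC] := Ex_invS_sqr urn m_gt0 mean U_L2.
exists (C * q) => [|j]; first by rewrite mulr_ge0// q_ge0.
have [_ hj] := hC j.
have q0 : 0 <= q by exact: q_ge0.
have hq : Ex P (fun w => (S j w)^-1 ^+ 2) * q <= C * q / j.+1%:R ^+ 2.
  by rewrite mulrAC ler_wpM2r.
have mV := measF_meas (@measF_V j).
split.
- by apply: (@L1_urn_step_sqr _ _ _ _ _ _ _ urn j _ _ _ _ (s0^-1)).
- apply: le_trans hq.
  by apply: (@Ex_urn_step_sqr_le _ _ _ _ _ _ _ urn j _ _ _ _ (s0^-1)).
- apply: le_trans hq.
  apply: (@Ex_urn_step_sqr_le _ _ _ _ _ _ _ urn j _ _ _ _ (s0^-1)) => //.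
  + by move=> w; apply: le_trans (p_le j w) _.
  + by move=> w; apply: le_trans (n_le j w) _.
Qed.

Lemma measurable_Z n : measurable_fun setT (Z n).
Proof. exact: (measF_meas (@measF_Z _ _ _ _ _ _ _ urn n)). Qed.

Lemma Z_telescope a b w : (a <= b)%N ->
  Z b w - Z a w = \sum_(a <= j < b) (Z j.+1 w - Z j w).
Proof. by move=> ab; rewrite telescope_sumr. Qed.

Lemma Z_sub_L1 a b : L1 P (fun w => Z b w - Z a w).
Proof.
apply: (@L1_bnd _ _ _ P _ 1); first by apply: measurable_funB; exact: measurable_Z.
move=> w; have /andP[? ?] := Z_itv urn b w; have /andP[? ?] := Z_itv urn a w.
by rewrite ler_norml; apply/andP; split; lra.
Qed.

(** The martingale part is [O(a^(-1/2))] in mean square by orthogonality, and the second-order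
    errors add up to [O(1/a)]. *)
Lemma Ex_Z_sub : exists2 K : R, 0 <= K &
  forall a b, (a <= b)%N -> Ex P (fun w => `|Z b w - Z a w|) <= K / Num.sqrt a.+1%:R.
Proof.
have [C C0 hC] := urn_step_bounds.
exists (Num.sqrt (2 * C) + 2 * C) => [|a b ab]; first by rewrite addr_ge0// mulr_ge0.
have [lM EM] := mdiff_sum a b urn_dM_mdiff.
have a0 : 0 < a.+1%:R :> R by [].
have sa0 : 0 < Num.sqrt a.+1%:R :> R by rewrite sqrtr_gt0.
have sa1 : 1 <= Num.sqrt a.+1%:R :> R by rewrite -[leLHS]sqrtr1 ler_sqrt// ler1n.
have sumC : \sum_(a <= j < b) C / j.+1%:R ^+ 2 <= 2 * C / a.+1%:R.
  by rewrite -mulr_sumr [leRHS](_ : _ = C * (2 / a.+1%:R)) ?ler_wpM2l ?sum_invsq_le//; ring.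
have lV j : L1 P (fun w => urn_dV j w ^+ 2) by case: (hC j).
have mM : measurable_fun setT (fun w => \sum_(a <= j < b) urn_dM j w).
  apply: (@measF_meas _ _ _ _ y0 U X b); apply: measF_sum => j.
  by case: (urn_dM_mdiff j).
have lM1 := L1_abs (L1_sqr mM lM).
have lVs : L1 P (fun w => \sum_(a <= j < b) urn_dV j w ^+ 2).
  by apply: L1_sum => j _; exact: lV.
apply: (@le_trans _ _ (Ex P (fun w => `|\sum_(a <= j < b) urn_dM j w| +
    \sum_(a <= j < b) urn_dV j w ^+ 2))).
  apply: Ex_le; [exact: L1_abs (Z_sub_L1 a b)|exact: L1D|].
  move=> w; rewrite Z_telescope//.
  rewrite (_ : \sum_(a <= j < b) (Z j.+1 w - Z j w) = \sum_(a <= j < b) urn_dM j w +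
      \sum_(a <= j < b) ((Z j.+1 w - Z j w) - urn_dM j w)); last first.
    by rewrite -big_split/=; apply: eq_bigr => j _; rewrite addrC subrK.
  apply: le_trans (ler_normD _ _) _; rewrite lerD2l.
  apply: le_trans (ler_norm_sum _ _ _) _; apply: ler_sum => j _; exact: Z_step_dM.
rewrite (ExD lM1 lVs) mulrDl lerD//.
  apply: (Ex_sqr_le mM lM); first by rewrite mulr_ge0// invr_ge0 ltW.
  rewrite EM exprMn exprVn !sqr_sqrtr ?mulr_ge0//.
  by apply: le_trans sumC; apply: ler_sum => j _; case: (hC j).
rewrite (Ex_sum _ (fun j _ => lV j)).
apply: (@le_trans _ _ (2 * C / a.+1%:R)).
  by apply: le_trans sumC; apply: ler_sum => j _; case: (hC j).
rewrite ler_wpM2l ?mulr_ge0// lef_pV2 ?posrE//.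
by rewrite -[leRHS](@sqr_sqrtr _ a.+1%:R)// expr2 ler_peMl// ltW.
Qed.

End urn_proportion.

(** * Almost sure convergence of [Z], and the rate in mean *)

Section urn_limit.
Context {R : realType} {d : measure_display} {T : measurableType d}.
Variables (P : probability T R) (y0 : 'I_2 -> R) (U X : nat -> 'I_2 -> {RV P >-> R}).
Hypothesis urn : reinforced_urn y0 U X.
Variable m : R.
Hypotheses (m_gt0 : 0 < m) (mean : forall k, Ex P (fun w => U 1%N k w) = m)
  (U_L2 : forall k, L1 P (fun w => U 1%N k w ^+ 2)).

Local Notation Z := (urn_Z y0 U X).
Local Notation Zinf := (urn_Zinf y0 U X).
Local Notation dV := (urn_dV y0 U X).

(* Almost sure convergence is proved along these times, with the fluctuation [B r]
   inside the blocks: [E |Z (N r.+1) - Z (N r)|] and [E (B r) ^+ 2] are summable. *)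
Let N (r : nat) : nat := r.+1 ^ 4.

Let N_mono r : (N r < N r.+1)%N.
Proof. by rewrite /N ltn_exp2r. Qed.

Let N_block r : ((N r.+1 - N r)%:R : R) <= 15 * r.+1%:R ^+ 3.
Proof.
rewrite natrB ?(ltnW (N_mono r))// /N !natrX -[r.+2%:R]natr1; set x : R := r.+1%:R.
have x1 : 1 <= x by rewrite ler1n.
have x2 : x <= x ^+ 3 by rewrite -[leLHS]expr1 ler_weXn2l.
have x3 : x ^+ 2 <= x ^+ 3 by rewrite ler_weXn2l.
have -> : (x + 1) ^+ 4 - x ^+ 4 = 4 * x ^+ 3 + 6 * x ^+ 2 + 4 * x + 1 by ring.
have : 1 <= x ^+ 3 by rewrite exprn_ege1.
lra.
Qed.

Let B r w := \sum_(N r <= j < N r.+1) dV j w.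

Let G r w := `|Z (N r.+1) w - Z (N r) w|.

Let sum_sqr_le (a b : nat) (f : nat -> R) :
  (\sum_(a <= j < b) f j) ^+ 2 <= (b - a)%:R * \sum_(a <= j < b) f j ^+ 2.
Proof.
elim: b => [|b IH]; first by rewrite !big_geq// expr0n mulr0.
have [ab|ba] := leqP a b; last first.
  by rewrite !big_geq ?expr0n ?mulr0//.
rewrite !big_nat_recr//= subSn// -[(b - a).+1%:R]natr1.
set s := \sum_(_ <= _ < _) f _ in IH *; set t := \sum_(_ <= _ < _) _ in IH *.
set n : R := (b - a)%:R in IH *.
have [ab0|] := eqVneq (b - a)%N 0%N.
  have s0 : s = 0 by rewrite /s big_geq// -subn_eq0 ab0.
  have t0 : t = 0 by rewrite /t big_geq// -subn_eq0 ab0.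
  by rewrite s0 t0 !add0r /n ab0 add0r mul1r.
rewrite -lt0n => n0; have n1 : 1 <= n by rewrite /n ler1n.
have h : 2 * (s * f b) <= t + n * f b ^+ 2.
  have np : 0 < n by rewrite (lt_le_trans _ n1).
  rewrite -(ler_pM2l np).
  have := sqr_ge0 (s - n * f b); rewrite sqrrB; nra.
nra.
Qed.

(** This explains the fourth power in [N]. The mean of [G r] is [O((N r)^(-1/2))]; that of [(B r)^2]
    is, by Cauchy-Schwarz, at most the squared block length, [O(r^6)], times [O((N r)^-2)]. Both are
    [O(r^-2)]. *)
Let W_bound : exists2 K : R, 0 <= K & forall r,
  [/\ measurable_fun setT (fun w => G r w + B r w ^+ 2),
     L1 P (fun w => G r w + B r w ^+ 2) &
  Ex P (fun w => G r w + B r w ^+ 2) <= K / r.+1%:R ^+ 2].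
Proof.
have [K1 K10 hK1] := Ex_Z_sub urn m_gt0 mean U_L2.
have [C C0 hC] := urn_step_bounds urn m_gt0 mean U_L2.
exists (K1 + 15 * (15 * C)) => [|r]; first by rewrite addr_ge0// !mulr_ge0.
have lV j : L1 P (fun w => dV j w ^+ 2) by case: (hC j).
have mV j : measurable_fun setT (dV j) by exact: (measF_meas (urn_dV_meas urn (j := j))).
have mB : measurable_fun setT (B r) by exact: measurable_sum.
have lVs : L1 P (fun w => \sum_(N r <= j < N r.+1) dV j w ^+ 2).
  by apply: L1_sum => j _; exact: lV.
have lVs' := L1Z (N r.+1 - N r)%:R lVs.
have lG : L1 P (G r) by exact: L1_abs (Z_sub_L1 urn _ _).
have lB : L1 P (fun w => B r w ^+ 2).
  apply: (L1_dom _ lVs'); first exact: measurable_funX.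
  by move=> w; rewrite ger0_norm ?sqr_ge0//; exact: sum_sqr_le.
have lW := L1D lG lB.
split; [exact: L1_meas lW|exact: lW|].
have x0 : 0 < r.+1%:R :> R by [].
have x1 : 1 <= r.+1%:R :> R by rewrite ler1n.
rewrite (ExD lG lB) mulrDl lerD//.
  apply: le_trans (hK1 _ _ (ltnW (N_mono r))) _; rewrite ler_wpM2l//.
  rewrite lef_pV2 ?posrE ?exprn_gt0 ?sqrtr_gt0//.
  rewrite -[leLHS]ger0_norm ?exprn_ge0// -sqrtr_sqr ler_sqrt//.
  by rewrite /N -exprM -natrX ler_nat.
apply: (@le_trans _ _ ((N r.+1 - N r)%:R * (C * (N r.+1 - N r)%:R / (r.+1%:R ^+ 4) ^+ 2))).
  apply: le_trans (Ex_ge0_le _ lVs' _) _ => //.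
  - exact: measurable_funX.
  - by move=> w; rewrite sqr_ge0; exact: sum_sqr_le.
  rewrite (ExZ _ lVs) ler_wpM2l// (Ex_sum _ (fun j _ => lV j)).
  apply: (@le_trans _ _ (\sum_(N r <= j < N r.+1) C / (r.+1%:R ^+ 4) ^+ 2)).
    rewrite !big_nat; apply: ler_sum => j /andP[Nj _].
    case: (hC j) => _ hj _; apply: le_trans hj _; rewrite ler_wpM2l//.
    rewrite lef_pV2 ?posrE ?exprn_gt0//.
    rewrite lerXn2r ?nnegrE ?exprn_ge0//; apply: (@le_trans _ _ (N r)%:R).
      by rewrite /N natrX.
    by rewrite ler_nat (leq_trans Nj).
  by rewrite sumr_const_nat -[X in X <= _]mulr_natr mulrAC.
have hN := N_block r.
have N0 : 0 <= (N r.+1 - N r)%:R :> R by [].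
apply: (@le_trans _ _ ((15 * r.+1%:R ^+ 3) * (C * (15 * r.+1%:R ^+ 3) / (r.+1%:R ^+ 4) ^+ 2))).
  apply: ler_pM => //; first by rewrite !mulr_ge0// invr_ge0 !exprn_ge0.
  by rewrite ler_wpM2r ?invr_ge0 ?exprn_ge0// ler_wpM2l.
by rewrite le_eqVlt; apply/orP; left; apply/eqP; field; rewrite gt_eqF.
Qed.

Let ae_summable : {ae P, forall w, cvgn (series (fun r => G r w + B r w ^+ 2))}.
Proof.
have [K K0 hK] := W_bound.
pose W r w := G r w + B r w ^+ 2.
have W0 r w : 0 <= W r w.
  by apply: addr_ge0; [exact: normr_ge0|exact: sqr_ge0].
have mW r : measurable_fun setT (EFin \o W r).
  by have [h _ _] := hK r; exact/measurable_EFinP.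
pose F w := (\sum_(r <oo) (EFin \o W r) w)%E.
have F0 w : (0 <= F w)%E by apply: nneseries_ge0 => r _ _ /=; rewrite lee_fin.
have mF : measurable_fun setT F.
  by apply: ge0_emeasurable_sum => // r w _ _ /=; rewrite lee_fin.
have iF : P.-integrable setT F.
  apply/integrableP; split => //.
  under eq_integral do rewrite gee0_abs//.
  rewrite integral_nneseries//; last by move=> r w _ /=; rewrite lee_fin.
  apply: (@le_lt_trans _ _ (2 * K)%:E); last exact: ltry.
  apply: lime_le.
    apply: is_cvg_nneseries => r _ _; apply: integral_ge0 => w _ /=.
    by rewrite lee_fin.
  apply: nearW => n.
  rewrite (eq_bigr (fun r => (Ex P (W r))%:E)); last first.
    by move=> r _; have [_ l _] := hK r; exact: ExE l.
  rewrite sumEFin lee_fin.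
  apply: (@le_trans _ _ (\sum_(0 <= r < n) K / r.+1%:R ^+ 2)).
    by apply: ler_sum => r _; case: (hK r).
  rewrite -mulr_sumr mulrC; apply: ler_wpM2r => //.
  by apply: le_trans (sum_invsq_le 0 n) _; rewrite invr1 mulr1.
apply: filterS (integrable_ae measurableT iF) => w /(_ Logic.I) Fw.
apply: nondecreasing_is_cvgn.
  by apply: nondecreasing_series => r _ _; exact: W0.
exists (fine (F w)) => _ [n _ <-].
rewrite -lee_fin (fineK Fw) /series /= -sumEFin.
apply: (@nneseries_lim_ge R (fun r => (W r w)%:E) xpredT 0 n) => r _ _.
by rewrite lee_fin.
Qed.

Lemma Z_cvg_ae : {ae P, forall w, cvgn (fun n => Z n w)}.
Proof.
apply: filterS ae_summable => w cW.
have G0 r : 0 <= G r w by exact: normr_ge0.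
have B0 r : 0 <= B r w.
  rewrite /B; apply: sumr_ge0 => j _; rewrite urn_dVE divr_ge0 ?(urn_V_ge0 urn)//.
  exact: ltW (S_gt0 urn j w).
have cG : cvgn (series (fun r => G r w)).
  apply: (@series_le_cvg R _ (fun r => G r w + B r w ^+ 2)) => //.
  - by move=> r; rewrite addr_ge0 ?sqr_ge0.
  - by move=> r; rewrite lerDl sqr_ge0.
have cB : B r w ^+ 2 @[r --> \oo] --> 0.
  apply: (@cvg0_le _ _ (fun r => G r w + B r w ^+ 2) 0).
    by move=> r _; rewrite ger0_norm ?sqr_ge0// lerDr.
  exact: cvg_series_cvg_0 cW.
have cZN : cvgn (fun r => Z (N r) w).
  have cs : cvgn (series (fun r => Z (N r.+1) w - Z (N r) w : R^o)).
    by apply: normed_cvg; exact: cG.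
  have c0 : cvgn (fun _ : nat => Z (N 0) w) by exact: is_cvg_cst.
  rewrite (_ : (fun r => Z (N r) w) = (fun r => Z (N 0) w +
    series (fun r => Z (N r.+1) w - Z (N r) w : R^o) r)); first exact: is_cvgD c0 cs.
  apply/funext => r; rewrite /series /= (telescope_sumr (fun r => Z (N r) w))//.
  by rewrite addrC subrK.
have /cvg_ex[z cz] := cZN.
apply/cvg_ex; exists z; apply/cvgrPdist_lt => e e0.
have e2 : 0 < e / 2 by rewrite divr_gt0.
move/cvgrPdist_lt : cz => /(_ _ e2)[r1 _ h1].
move/cvgrPdist_lt : cB => /(_ _ (exprn_gt0 2 e2))[r2 _ h2].
exists (N (maxn r1 r2)) => // i /= Ni.
have [r rr /andP[Nri iNr]] := block_index N_mono Ni.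
have hB : B r w < e / 2.
  have := h2 r (leq_trans (leq_maxr _ _) rr); rewrite /= sub0r normrN.
  by rewrite ger0_norm ?sqr_ge0// ltr_pXn2r// nnegrE// ltW.
have hZ := h1 r (leq_trans (leq_maxl _ _) rr).
have hi : `|Z i w - Z (N r) w| <= B r w.
  rewrite Z_telescope//; apply: le_trans (ler_norm_sum _ _ _) _.
  rewrite /B (big_cat_nat Nri iNr)/= -[leLHS]addr0 lerD//.
    by apply: ler_sum => j _; rewrite urn_dVE; exact: (Z_step_le urn j w).
  apply: sumr_ge0 => j _; rewrite urn_dVE divr_ge0 ?(urn_V_ge0 urn)//.
  exact: ltW (S_gt0 urn j w).
have -> : z - Z i w = (z - Z (N r) w) - (Z i w - Z (N r) w) by ring.
apply: le_lt_trans (ler_normB _ _) _; move: hZ => /= hZ.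
by rewrite [e]splitr ltrD// (le_lt_trans hi).
Qed.

(** Valid at every point: where the sequence diverges, [limn] returns the default value 0. *)
Lemma Zinf_itv w : 0 <= Zinf w <= 1.
Proof.
have [cZ|dZ] := pselect (cvgn (fun n => Z n w)); last first.
  by rewrite /urn_Zinf (dvgP dZ) lexx ler01.
apply/andP; split.
- by apply: limr_ge => //; apply: nearW => n; have /andP[] := Z_itv urn n w.
- by apply: limr_le => //; apply: nearW => n; have /andP[] := Z_itv urn n w.
Qed.

(** As a total function [Zinf] is the upper limit on the event where upper and lower limits agree,
    and the default value 0 off it. *)
Lemma measurable_Zinf : measurable_fun setT Zinf.
Proof.
pose u w n := (Z n w)%:E.
pose Ls w := limn_esup (u w); pose Li w := limn_einf (u w).
have mZ n : measurable_fun setT (EFin \o Z n).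
  by apply/measurable_EFinP; exact: (measurable_Z urn).
have mLs : measurable_fun setT Ls by apply: measurable_fun_limn_esup => n; exact: mZ.
have mLi : measurable_fun setT Li.
  rewrite (_ : Li = (fun w => - limn_esup (-%E \o u w))%E).
    apply: measurableT_comp => //; apply: measurable_fun_limn_esup => n.
    by apply: measurableT_comp => //; exact: mZ.
  by apply/funext => w; rewrite limn_esupN oppeK.
pose C := [set w | Ls w = Li w].
have mC : measurable C.
  by have := measurable_eqe measurableT mLs mLi; rewrite setTI.
have u01 w n : (0 <= u w n <= 1)%E by rewrite !lee_fin; exact: Z_itv urn n w.
have CP w : C w <-> cvgn (fun n => Z n w).
  split => [Cw|/cvg_ex[l hl]]; last first.
    have hl' : u w @ \oo --> l%:E by apply/fine_cvgP; split => //; exact: nearW.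
    by have [h1 h2] := cvg_limn_einf_sup hl'; rewrite /C /= /Ls /Li h1 h2.
  have c1 : esups (u w) @ \oo --> Ls w.
    by rewrite /Ls limn_esup_lim; exact: is_cvg_esups.
  have c2 : einfs (u w) @ \oo --> Ls w.
    by rewrite Cw /Li limn_einf_lim; exact: is_cvg_einfs.
  have c3 : u w @ \oo --> Ls w.
    apply: (@squeeze_cvge _ _ _ _ (einfs (u w)) _ (esups (u w))) => //.
    apply: nearW => n; rewrite ereal_inf_lbound ?ereal_sup_ubound//; exists n => //=.
  have Lfin : Ls w \is a fin_num.
    have Ll : (Ls w <= 1)%E.
      by rewrite -(cvg_lim _ c3)//; apply: lime_le; [exact: cvgP c3|
        apply: nearW => n; case/andP: (u01 w n)].
    have Lg : (0 <= Ls w)%E.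
      by rewrite -(cvg_lim _ c3)//; apply: lime_ge; [exact: cvgP c3|
        apply: nearW => n; case/andP: (u01 w n)].
    by rewrite ge0_fin_numE// (le_lt_trans Ll)// ltry.
  move: c3; rewrite -(fineK Lfin) => /fine_cvgP[_ c3].
  by apply/cvg_ex; exists (fine (Ls w)).
rewrite (_ : Zinf = (fun w => fine (Ls w) * \1_C w)).
  apply: measurable_funM; last exact: measurable_indic.
  by apply: measurableT_comp mLs => //.
apply/funext => w; rewrite indicE.
have [Cw|nCw] := pselect (C w).
  rewrite mem_set// mulr1 /urn_Zinf.
  have /CP cZ := Cw; have hl : u w @ \oo --> (limn (fun n => Z n w))%:E.
    by apply/fine_cvgP; split => //; exact: nearW.
  by rewrite /Ls (cvg_limn_einf_sup hl).2.
rewrite memNset// mulr0 /urn_Zinf dvgP// => cZ; apply: nCw; exact/CP.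
Qed.

Lemma Z_cvg_Zinf : {ae P, forall w, Z n w @[n --> \oo] --> Zinf w}.
Proof. by apply: filterS Z_cvg_ae => w cZ; exact: cZ. Qed.

Lemma Ex_Zinf_sub : exists2 K : R, 0 <= K &
  forall a, L1 P (fun w => `|Zinf w - Z a w|) /\
    Ex P (fun w => `|Zinf w - Z a w|) <= K / Num.sqrt a.+1%:R.
Proof.
have [K K0 hK] := Ex_Z_sub urn m_gt0 mean U_L2.
exists K => // a.
have mZ b : measurable_fun setT (fun w => `|Z b w - Z a w|).
  by apply: measurableT_comp => //; apply: measurable_funB; exact: (measurable_Z urn).
have mZi : measurable_fun setT (fun w => `|Zinf w - Z a w|).
  apply: measurableT_comp => //; apply: measurable_funB; first exact: measurable_Zinf.
  exact: (measurable_Z urn).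
have b1 (x y : R) : 0 <= x <= 1 -> 0 <= y <= 1 -> `|(`|x - y|)| <= 1.
  by move=> /andP[? ?] /andP[? ?]; rewrite normr_id ler_norml; apply/andP; split; lra.
split.
  by apply: (@L1_bnd _ _ _ P _ 1) => // w; apply: b1; [exact: Zinf_itv|exact: Z_itv urn a w].
have c : Ex P (fun w => `|Z b w - Z a w|) @[b --> \oo] --> Ex P (fun w => `|Zinf w - Z a w|).
  apply: (Ex_cvg mZ mZi (L1_cst P 1)).
    by move=> b w; apply: b1; [exact: Z_itv urn b w|exact: Z_itv urn a w].
  apply: filterS Z_cvg_Zinf => w cw.
  by apply: cvg_norm; apply: cvgB => //; exact: cvg_cst.
rewrite -(cvg_lim (@Rhausdorff R) c); apply: limr_le; first exact: cvgP c.
by exists a => // b /= ab; exact: hK.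
Qed.

End urn_limit.

Lemma measurable_gsmooth {R : realType} {d : measure_display} {T : measurableType d}
  (f : R -> R) (C : R) (s x : T -> R) :
  continuous f -> (forall y, `|f y| <= C) -> measurable_fun setT s -> measurable_fun setT x ->
  measurable_fun setT (fun w => gsmooth f (s w) (x w)).
Proof.
move=> cf fC ms mx.
apply: (@measurable_Ex_normal _ T R (fun z => f (x z.1 + Num.sqrt (s z.1) * z.2)) C) => //.
have m1 (G : T -> R) : measurable_fun setT G ->
    measurable_fun setT (fun z : T * measurableTypeR R => G z.1).
  by move=> mG; exact: (measurableT_comp mG measurable_fst).
have mf : measurable_fun setT f by exact: continuous_measurable_fun.
apply: (measurableT_comp mf); apply: measurable_funD; first exact: (m1 _ mx).
apply: measurable_funM; last exact: measurable_snd.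
apply: (m1 (fun w => Num.sqrt (s w))).
exact: (measurableT_comp (continuous_measurable_fun (@sqrt_continuous R))).
Qed.

(** * Approximation of events and Lindeberg's replacement *)

Section lindeberg.
Context {R : realType} {d : measure_display} {T : measurableType d}.
Variables (P : probability T R) (gens : nat -> set (set T)).
Hypotheses (gens_sub : forall n, gens n `<=` measurable)
  (gens_mono : forall a b, (a <= b)%N -> <<s gens a >> `<=` <<s gens b >>).

Let gens_meas n (G : T -> R) : meas_wrt (gens n) G -> measurable_fun setT G.
Proof. exact: meas_wrt_measurable. Qed.

Let mono a b (G : T -> R) : (a <= b)%N -> meas_wrt (gens a) G -> meas_wrt (gens b) G.
Proof. by move=> ab mG; exact: (meas_wrt_sub (gens_mono ab) mG). Qed.

Lemma meas_wrt_gsmooth (g : set (set T)) (f : R -> R) (C : R) (s x : T -> R) :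
  continuous f -> (forall y, `|f y| <= C) -> meas_wrt g s -> meas_wrt g x ->
  meas_wrt g (fun w => gsmooth f (s w) (x w)).
Proof.
move=> cf fC ms mx.
exact: (@measurable_gsmooth _ _ (g_sigma_algebraType g) f C s x cf fC ms mx).
Qed.

(* An almost orthogonal projection, in place of Levy's upward theorem: [g] nearly
   minimizes [E (1_E - g) ^+ 2] among the bounded functions measurable at a finite
   time, so that the residual is nearly orthogonal to all of these. *)
Lemma approx_indicator (E : set T) (e : R) : measurable E -> 0 < e ->
  exists k (g : T -> R) (B : R), [/\ meas_wrt (gens k) g, forall w, `|g w| <= B &
    forall n (h : T -> R) (M : R), meas_wrt (gens n) h -> 0 < M ->
      (forall w, `|h w| <= M) -> `|Ex P (fun w => (\1_E w - g w) * h w)| <= e * M].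
Proof.
move=> mE e0.
pose A := [set x : R | exists k (g : T -> R) (B : R), [/\ meas_wrt (gens k) g,
  forall w, `|g w| <= B & x = Ex P (fun w => (\1_E w - g w) ^+ 2)]].
have m1 : measurable_fun setT (\1_E : T -> R) by exact: measurable_indic.
have i1 w : `|\1_E w : R| <= 1.
  by rewrite indicE; case: (_ \in _); rewrite ?normr1// normr0.
have A0 : A !=set0.
  exists (Ex P (fun w => (\1_E w - 0) ^+ 2)); exists 0%N, (fun=> 0), 0; split => //.
    exact: measurable_cst.
  by move=> w; rewrite normr0.
have Alb : lbound A 0.
  by move=> _ [k [g [B [_ _ ->]]]]; apply: Ex_ge0 => w; exact: sqr_ge0.
have Ainf : has_inf A by split => //; exists 0.
have e2 : 0 < e ^+ 2 by rewrite exprn_gt0.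
have [_ [k [g [B [mg gB ->]]]] hg] := inf_adherent e2 Ainf.
exists k, g, B; split => // n h M mh M0 hM.
have mgT := gens_meas mg; have mhT := gens_meas mh.
have mu : measurable_fun setT (fun w => \1_E w - g w) by exact: measurable_funB.
have uB w : `|\1_E w - g w| <= 1 + B.
  by apply: le_trans (ler_normB _ _) _; rewrite lerD.
have lu2 : L1 P (fun w => (\1_E w - g w) ^+ 2).
  apply: (@L1_bnd _ _ _ P _ ((1 + B) ^+ 2)); first exact: measurable_funX.
  by move=> w; rewrite normrX lerXn2r ?nnegrE// (le_trans _ (uB w)).
have lh2 : L1 P (fun w => h w ^+ 2).
  apply: (@L1_bnd _ _ _ P _ (M ^+ 2)); first exact: measurable_funX.
  by move=> w; rewrite normrX lerXn2r ?nnegrE// ltW.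
have luh := L1_mul mu mhT lu2 lh2.
have h2M : Ex P (fun w => h w ^+ 2) <= M ^+ 2.
  apply: Ex_bnd; first exact: measurable_funX.
  by move=> w; rewrite normrX lerXn2r ?nnegrE// ltW.
(* [g + t h] is again a competitor in the minimization, so it cannot lower the residual by more than
   [e ^+ 2]. *)
have key t : 2 * t * Ex P (fun w => (\1_E w - g w) * h w) <= e ^+ 2 + t ^+ 2 * M ^+ 2.
  have lA : inf A <= Ex P (fun w => (\1_E w - (g w + t * h w)) ^+ 2).
    apply: ge_inf; first by exists 0.
    exists (maxn k n), (fun w => g w + t * h w), (B + `|t| * M); split => //.
      apply: measurable_funD; first exact: (mono (leq_maxl k n) mg).
      apply: measurable_funM; first exact: measurable_cst.
      exact: (mono (leq_maxr k n) mh).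
    move=> w; apply: le_trans (ler_normD _ _) _; rewrite lerD// normrM.
    by rewrite ler_wpM2l.
  rewrite (_ : (fun w => (\1_E w - (g w + t * h w)) ^+ 2) = (fun w =>
     (\1_E w - g w) ^+ 2 + (- (2 * t) * ((\1_E w - g w) * h w) + t ^+ 2 * h w ^+ 2))) in lA;
    last by apply/funext => w; ring.
  have j1 := L1Z (- (2 * t)) luh; have j2 := L1Z (t ^+ 2) lh2; have j3 := L1D j1 j2.
  rewrite (ExD lu2 j3) (ExD j1 j2) (ExZ _ luh) (ExZ _ lh2) in lA.
  have : t ^+ 2 * Ex P (fun w => h w ^+ 2) <= t ^+ 2 * M ^+ 2 by rewrite ler_wpM2l ?sqr_ge0.
  lra.
set x := Ex P _ in key *.
(* [t = e / M] balances the two terms of the quadratic bound; both signs are needed for the absolute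
   value. *)
have k1 := key (e / M); have k2 := key (- (e / M)).
have eM : (e / M) ^+ 2 * M ^+ 2 = e ^+ 2 by field; rewrite gt_eqF.
have eM' : (- (e / M)) ^+ 2 * M ^+ 2 = e ^+ 2 by rewrite sqrrN.
rewrite eM in k1; rewrite eM' in k2.
have y0 : 0 < e / M by rewrite divr_gt0.
have ee : e ^+ 2 = (e / M) * (e * M) by field; rewrite gt_eqF.
rewrite ee in k1 k2; rewrite ler_norml; apply/andP; split.
  by rewrite -(ler_pM2l y0); lra.
by rewrite -(ler_pM2l y0); lra.
Qed.

Variables (f f1 f2 : R -> R) (C K : R).
Hypotheses (sm : smooth3 f f1 f2 C) (K0 : 0 <= K)
  (heat : forall s c x : R, 0 <= s -> 0 <= c ->
    `|gsmooth f (s + c) x - gsmooth f s x - c / 2 * gsmooth f2 s x| <=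
    K * C * (c * Num.sqrt c)).
(** [v j] is the conditional variance of [D j], [u j] its substitute known at time [k], [c j] a
    deterministic bound for both, and [g] the weight. *)
Variables (D v u : nat -> T -> R) (c : nat -> R) (g : T -> R) (B : R) (k : nat).
Hypotheses (mD : forall j, meas_wrt (gens j.+1) (D j))
  (lD : forall j, L1 P (fun w => D j w ^+ 2))
  (D0 : forall j (G : T -> R) b, meas_wrt (gens j) G -> (forall w, `|G w| <= b) ->
    Ex P (fun w => G w * D j w) = 0)
  (D2 : forall j (G : T -> R) b, meas_wrt (gens j) G -> (forall w, `|G w| <= b) ->
    Ex P (fun w => G w * D j w ^+ 2) = Ex P (fun w => G w * v j w))
  (mv : forall j, measurable_fun setT (v j)) (vc : forall j w, `|v j w| <= c j)
  (mu : forall j, meas_wrt (gens k) (u j)) (uc : forall j w, 0 <= u j w <= c j)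
  (mg : meas_wrt (gens k) g) (gB : forall w, `|g w| <= B).

Let S i w := \sum_(k <= j < i) D j w.
Let tau L i w := \sum_(i <= j < L) u j w.
(** The hybrid at stage [i]: differences before [i] are kept, while those from [i] on are replaced
    by one normal variable with the remaining variance [tau L i]. *)
Let Phi L i w := gsmooth f (tau L i w) (S i w).

Let mS i : (k <= i)%N -> meas_wrt (gens i) (S i).
Proof.
move=> /subnKC <-; elim: (i - k)%N => [|n IH].
  rewrite addn0 (_ : S k = (fun=> 0)); first exact: measurable_cst.
  by apply/funext => w; rewrite /S big_geq.
rewrite addnS (_ : S _ = (fun w => S (k + n) w + D (k + n) w)); last first.
  by apply/funext => w; rewrite /S big_nat_recr// leq_addr.
by apply: measurable_funD; [exact: mono IH|exact: mD].
Qed.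

Let mtau L i : meas_wrt (gens k) (tau L i).
Proof. by apply: measurable_sum => j; exact: mu. Qed.

Let tau_ge0 L i w : 0 <= tau L i w.
Proof. by apply: sumr_ge0 => j _; case/andP: (uc j w). Qed.

Let err i := B * (2 * C * Ex P (fun w => Num.min (D i w ^+ 2) (`|D i w| ^+ 3)) +
   C * Ex P (fun w => `|v i w - u i w|) + K * C * (c i * Num.sqrt (c i))).

(** Both hybrids are expanded around [gsmooth f (tau L i.+1) (S i)]: adding [D i] by Taylor, adding
    variance [u i] by the heat equation. The first-order term has mean zero and the second-order
    terms differ by [v i - u i]. As [tau] is known at time [k], all coefficients are known at time
    [i]. *)
Let lindeberg_step L i : (k <= i < L)%N ->
  `|Ex P (fun w => g w * Phi L i.+1 w) - Ex P (fun w => g w * Phi L i w)| <= err i.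
Proof.
move=> /andP[ki iL].
have [cf cf1 cf2] := smooth3_cont sm; have C0 := smooth3_C0 sm.
have B0 : 0 <= B by exact: le_trans (gB point).
pose s w := tau L i.+1 w; pose x w := S i w.
have ms : meas_wrt (gens i) s by exact: (mono ki (@mtau L i.+1)).
have mx : meas_wrt (gens i) x by exact: mS.
have mgi : meas_wrt (gens i) g by exact: (mono ki mg).
pose a1 w := gsmooth f1 (s w) (x w); pose a2 w := gsmooth f2 (s w) (x w).
have ma1 : meas_wrt (gens i) a1 by exact: (meas_wrt_gsmooth cf1 (smooth3_b1 sm)).
have ma2 : meas_wrt (gens i) a2 by exact: (meas_wrt_gsmooth cf2 (smooth3_b2 sm)).
have a1C w : `|a1 w| <= C by exact: gsmooth_bnd cf1 (smooth3_b1 sm).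
have a2C w : `|a2 w| <= C by exact: gsmooth_bnd cf2 (smooth3_b2 sm).
have mPhi n : (k <= n)%N -> measurable_fun setT (Phi L n).
  move=> kn; apply: (@gens_meas n); apply: (meas_wrt_gsmooth cf (smooth3_b0 sm)).
    exact: (mono kn (@mtau L n)).
  exact: mS.
have PhiC n w : `|Phi L n w| <= C by exact: gsmooth_bnd cf (smooth3_b0 sm).
have mgT := gens_meas mg.
have lP n : (k <= n)%N -> L1 P (fun w => g w * Phi L n w).
  move=> kn; apply: (L1M_bnd mgT gB); exact: (L1_bnd P (mPhi n kn) (PhiC n)).
have mDT j : measurable_fun setT (D j) by exact: (gens_meas (@mD j)).
have lD1 : L1 P (D i) by exact: L1_sqr (mDT i) (lD i).
pose G1 w := g w * a1 w; pose G2 w := g w * a2 w / 2.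
have mG1 : meas_wrt (gens i) G1 by exact: measurable_funM.
have mG2 : meas_wrt (gens i) G2.
  by apply: measurable_funM; [exact: measurable_funM|exact: measurable_cst].
have G1B w : `|G1 w| <= B * C by rewrite normrM ler_pM.
have G2B w : `|G2 w| <= B * C.
  rewrite normrM (_ : `|2^-1 : R| = 2^-1); last by rewrite gtr0_norm.
  have := normr_ge0 (g w * a2 w); have : `|g w * a2 w| <= B * C by rewrite normrM ler_pM.
  lra.
have mG1T := gens_meas mG1; have mG2T := gens_meas mG2.
have muT j : measurable_fun setT (u j) by exact: (gens_meas (@mu j)).
have ucn j w : `|u j w| <= c j by have /andP[h1 h2] := uc j w; rewrite ger0_norm.
have lv : L1 P (v i) by exact: (L1_bnd P (mv i) (vc i)).
have lu : L1 P (u i) by exact: (L1_bnd P (muT i) (ucn i)).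
have i1 := L1M_bnd mG1T G1B lD1.
have i2 := L1M_bnd mG2T G2B (lD i).
have i3 := L1M_bnd mG2T G2B lu.
have i3v := L1M_bnd mG2T G2B lv.
(* What remains without the first- and second-order terms: the Taylor remainder minus the heat
   remainder. *)
pose r w := Phi L i.+1 w - Phi L i w - D i w * a1 w - D i w ^+ 2 / 2 * a2 w + u i w / 2 * a2 w.
have mmin : measurable_fun setT (fun w => Num.min (D i w ^+ 2) (`|D i w| ^+ 3)).
  apply: measurable_minr; first exact: measurable_funX.
  by apply: measurable_funX; exact: measurableT_comp.
have lmin : L1 P (fun w => Num.min (D i w ^+ 2) (`|D i w| ^+ 3)).
  apply: (L1_dom mmin (lD i)) => w.
  rewrite ger0_norm; first by rewrite ge_min lexx.
  by rewrite le_min sqr_ge0 exprn_ge0.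
have cq0 : 0 <= c i * Num.sqrt (c i).
  by have /andP[h1 h2] := uc i point; rewrite mulr_ge0// (le_trans h1).
have rB w : `|r w| <= 2 * C * Num.min (D i w ^+ 2) (`|D i w| ^+ 3) +
    K * C * (c i * Num.sqrt (c i)).
  have h1 := gsmooth_taylor (s w) (x w) (D i w) sm.
  have /andP[u0 uci] := uc i w.
  have h2 := heat (x w) (tau_ge0 L i.+1 w) u0.
  have h3 : K * C * (u i w * Num.sqrt (u i w)) <= K * C * (c i * Num.sqrt (c i)).
    by rewrite ler_wpM2l ?mulr_ge0// ler_pM// ler_sqrt// (le_trans u0).
  have -> : r w = (gsmooth f (s w) (x w + D i w) - gsmooth f (s w) (x w) -
      D i w * gsmooth f1 (s w) (x w) - D i w ^+ 2 / 2 * gsmooth f2 (s w) (x w)) -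
      (gsmooth f (tau L i.+1 w + u i w) (x w) - gsmooth f (tau L i.+1 w) (x w) -
       u i w / 2 * gsmooth f2 (tau L i.+1 w) (x w)).
    rewrite /r /a1 /a2 /Phi (_ : S i.+1 w = x w + D i w); last by rewrite /S big_nat_recr.
    rewrite (_ : tau L i w = tau L i.+1 w + u i w); last by rewrite /tau big_ltn// addrC.
    rewrite /s /x; ring.
  apply: le_trans (ler_normB _ _) _; rewrite lerD//; exact: le_trans h2 h3.
have mr : measurable_fun setT r.
  have ma1T := gens_meas ma1; have ma2T := gens_meas ma2.
  apply: measurable_funD; last by apply: measurable_funM => //; exact: measurable_funM.
  apply: measurable_funB; last first.
    by apply: measurable_funM => //; apply: measurable_funM => //; exact: measurable_funX.
  apply: measurable_funB; last exact: measurable_funM.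
  by apply: measurable_funB; apply: mPhi => //; exact: leqW.
have lrB := L1D (L1Z (2 * C) lmin) (L1_cst P (K * C * (c i * Num.sqrt (c i)))).
have lr := L1_dom mr lrB rB.
have i4 := L1M_bnd mgT gB lr.
have i12 := L1D i1 i2; have i123 := L1B i12 i3.
rewrite -(ExB (lP i.+1 (leqW ki)) (lP i ki)).
rewrite (_ : (fun w => g w * Phi L i.+1 w - g w * Phi L i w) = (fun w =>
   ((G1 w * D i w + G2 w * D i w ^+ 2) - G2 w * u i w) + g w * r w)); last first.
  by apply/funext => w; rewrite /G1 /G2 /r; field.
rewrite (ExD i123 i4) (ExB i12 i3) (ExD i1 i2) (D0 mG1 G1B) (D2 mG2 G2B) add0r.
rewrite -(ExB i3v i3) /err.
apply: le_trans (ler_normD _ _) _.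
have lvu := L1_abs (L1B lv lu).
have b1 : `|Ex P (fun w => G2 w * v i w - G2 w * u i w)| <=
    B * (C * Ex P (fun w => `|v i w - u i w|)).
  rewrite mulrA -(ExZ _ lvu); apply: Ex_abs_le; [exact: L1_meas (L1B i3v i3)|exact: L1Z|].
  by move=> w; rewrite -mulrBr normrM ler_wpM2r.
have b2 : `|Ex P (fun w => g w * r w)| <= B *
    (2 * C * Ex P (fun w => Num.min (D i w ^+ 2) (`|D i w| ^+ 3)) +
     K * C * (c i * Num.sqrt (c i))).
  have <- : Ex P (fun w => 2 * C * Num.min (D i w ^+ 2) (`|D i w| ^+ 3) +
       K * C * (c i * Num.sqrt (c i))) =
     2 * C * Ex P (fun w => Num.min (D i w ^+ 2) (`|D i w| ^+ 3)) +
     K * C * (c i * Num.sqrt (c i)).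
    by rewrite (ExD (L1Z (2 * C) lmin) (L1_cst P _)) (ExZ _ lmin) Ex_cst.
  rewrite -(ExZ _ lrB); apply: Ex_abs_le; [exact: L1_meas i4|exact: L1Z|].
  by move=> w; rewrite normrM ler_pM.
by apply: le_trans (lerD b1 b2) _; rewrite -mulrDr ler_wpM2l//; lra.
Qed.

(* Lindeberg's replacement, with the conditional variances [v j] compared to
   [u j], which are known at time [k]. *)
Lemma lindeberg L : (k <= L)%N ->
  `|Ex P (fun w => g w * f (\sum_(k <= j < L) D j w)) -
    Ex P (fun w => g w * gsmooth f (\sum_(k <= j < L) u j w) 0)| <=
  \sum_(k <= i < L) B * (2 * C * Ex P (fun w => Num.min (D i w ^+ 2) (`|D i w| ^+ 3)) +
   C * Ex P (fun w => `|v i w - u i w|) + K * C * (c i * Num.sqrt (c i))).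
Proof.
move=> kL.
have E1 : (fun w => g w * f (\sum_(k <= j < L) D j w)) = (fun w => g w * Phi L L w).
  apply/funext => w; rewrite /Phi (_ : tau L L w = 0) ?gsmooth0//.
  by rewrite /tau big_geq.
have E2 : (fun w => g w * gsmooth f (\sum_(k <= j < L) u j w) 0) = (fun w => g w * Phi L k w).
  apply/funext => w; rewrite /Phi (_ : S k w = 0)//.
  by rewrite /S big_geq.
rewrite E1 E2 -(telescope_sumr (fun i => Ex P (fun w => g w * Phi L i w)) kL).
apply: le_trans (ler_norm_sum _ _ _) _; rewrite !big_nat; apply: ler_sum => i ki.
exact: lindeberg_step.
Qed.

End lindeberg.

(** * Smooth approximation by moving averages *)

Section box_average.
Context {R : realType}.
Notation mu := (@lebesgue_measure R).
Implicit Types f : R -> R.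

Definition box (h : R) f (x : R) : R := h^-1 * \int[mu]_(t in `]x, x + h]) f t.

Let integrable_itv f a b : continuous f -> mu.-integrable `[a, b] (EFin \o f).
Proof.
move=> cf; apply: continuous_compact_integrable; first exact: segment_compact.
exact: continuous_subspaceT.
Qed.

Let integrable_oc f a b : continuous f -> mu.-integrable `]a, b] (EFin \o f).
Proof.
move=> cf; apply: (@integrableS _ _ _ mu `[a, b]) => //; last exact: integrable_itv.
by apply: subset_itvr; rewrite bnd_simp.
Qed.

Lemma box_near (h : R) f (x a e : R) : 0 < h -> continuous f ->
  (forall t, x <= t <= x + h -> `|f t - a| <= e) -> `|box h f x - a| <= e.
Proof.
move=> h0 cf fa.
have mh : fine (mu `]x, x + h]) = h.
  rewrite lebesgue_measure_itv /= lte_fin ltrDl h0 -EFinB /=.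
  by rewrite addrAC subrr add0r.
have cfa : continuous (fun t => f t - a).
  by move=> t; apply: cvgB; [exact: cf|exact: cvg_cst].
have ia : mu.-integrable `]x, x + h] (EFin \o (fun=> a)).
  by apply: integrable_oc => t; exact: cvg_cst.
have ie : mu.-integrable `]x, x + h] (EFin \o (fun=> e)).
  by apply: integrable_oc => t; exact: cvg_cst.
have if_ := @integrable_oc _ x (x + h) cf.
have ifa := @integrable_oc _ x (x + h) cfa.
have E : box h f x - a = h^-1 * \int[mu]_(t in `]x, x + h]) (f t - a).
  rewrite /box RintegralB// Rintegral_cst// mh mulrBr; congr (_ - _).
  by rewrite mulrCA mulVf ?mulr1// gt_eqF.
rewrite E normrM ger0_norm ?invr_ge0 ?(ltW h0)// ler_pdivrMl//.
apply: le_trans (le_normr_Rintegral _ ifa) _ => //.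
rewrite [leRHS](_ : _ = \int[mu]_(t in `]x, x + h]) e); last first.
  by rewrite Rintegral_cst// mh mulrC.
apply: le_Rintegral => //.
  apply: integrable_oc => t; apply: cvg_norm; exact: cfa.
move=> t /=; rewrite in_itv/= => /andP[xt th]; apply: fa; by rewrite (ltW xt).
Qed.

Lemma box_bnd (h M : R) f x : 0 < h -> continuous f -> (forall t, `|f t| <= M) ->
  `|box h f x| <= M.
Proof.
move=> h0 cf fM; rewrite -[box h f x]subr0; apply: box_near => // t _.
by rewrite subr0.
Qed.

Lemma box_derive (h : R) f (x : R) : 0 < h -> continuous f ->
  is_derive x 1 (box h f) (h^-1 * (f (x + h) - f x)).
Proof.
(* Any base point to the left of [x] serves: for [y] near [x] the average is a difference quotient
   of the integral from [a]. *)
move=> h0 cf; pose a := x - 1.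
pose G y := \int[mu]_(t in `[a, y]) f t.
have dG y : a < y -> is_derive y 1 G (f y).
  move=> ay; have yu : y < y + 1 by rewrite ltrDl.
  have [] := @continuous_FTC1_closed R f a y (y + 1) yu (@integrable_itv f a (y + 1) cf) ay (cf y).
  by move=> dy Gy; split; [exact: dy|rewrite -derive1E; exact: Gy].
have ax : a < x by rewrite gtrBl.
have axh : a < x + h by rewrite ltr_wpDr// ltW.
have d1 : is_derive x 1 (fun y => G (h + 1 * y)) (f (x + h)).
  have E : h + 1 * x = x + h by rewrite mul1r addrC.
  have dGh : is_derive (h + 1 * x) 1 G (f (x + h)) by rewrite E; exact: dG.
  have := @is_derive1_comp R G (fun y => h + 1 * y) x _ _ dGh (is_derive1_affine h 1 x).
  by move/is_derive_eq; apply; rewrite mulr1.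
have d2 := is_derive1Z h^-1 (is_derive1D d1 (is_derive1Z (-1) (dG x ax))).
have := near_eq_is_derive _ d2; move/(_ (box h f)).
rewrite (_ : h^-1 * (f (x + h) + -1 * f x) = h^-1 * (f (x + h) - f x)); last by rewrite mulN1r.
apply; exists 1 => //= y; rewrite /ball_ /= => xy.
have ay : a < y.
  by rewrite /a ltrBlDr -ltrBlDl; apply: le_lt_trans xy; rewrite ler_norm.
have yh : y < y + h by rewrite ltrDl.
rewrite /box mul1r mulN1r (addrC h) /G; congr (_ * _).
rewrite (@Rintegral_itvB R f (BLeft a) (BRight (y + h)) y)//.
- exact: integrable_itv.
- by rewrite bnd_simp ltW.
- by rewrite bnd_simp ltW.
Qed.

Lemma box_cont (h : R) f : 0 < h -> continuous f -> continuous (box h f).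
Proof. by move=> h0 cf; apply: derive_continuous => y; exact: box_derive. Qed.

Let box3 h f := box h (box h (box h f)).

(** Each average gains one derivative, a difference quotient of step [h]. The first average is
    Lipschitz, and the second derivative of the third is a combination of its translates. *)
Lemma box3_smooth (h M : R) f : 0 < h -> continuous f -> (forall t, `|f t| <= M) ->
  exists (f1 f2 : R -> R) (C : R), smooth3 (box3 h f) f1 f2 C.
Proof.
move=> h0 cf fM; pose g := box h f; pose g2 := box h g.
have M0 : 0 <= M by exact: le_trans (fM 0).
have cg : continuous g by exact: box_cont.
have cg2 : continuous g2 by exact: box_cont.
have gM t : `|g t| <= M by exact: box_bnd.
have g2M t : `|g2 t| <= M by exact: box_bnd.
pose k := h^-1; have k0 : 0 <= k by rewrite invr_ge0 ltW.
have glip x y : `|g x - g y| <= (k * (2 * M)) * `|x - y|.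
  have dg (z : R) : is_derive z 1 g (k * (f (z + h) - f z)) by exact: box_derive.
  have [c _ ->] := MVT_real y x dg.
  rewrite normrM ler_wpM2r// normrM ger0_norm// ler_wpM2l//.
  by apply: le_trans (ler_normB _ _) _; have := fM (c + h); have := fM c; lra.
pose f1 x := k * (g2 (x + h) - g2 x).
pose f2 x := k * (k * (g (x + h + h) - g (x + h)) - k * (g (x + h) - g x)).
exists f1, f2, (M + k * (2 * M) + k ^+ 2 * (4 * M) + k ^+ 2 * (4 * (k * (2 * M)))).
have p1 : 0 <= k * (2 * M) by rewrite mulr_ge0// mulr_ge0.
have p2 : 0 <= k ^+ 2 * (4 * M) by rewrite mulr_ge0 ?sqr_ge0// mulr_ge0.
have p3 : 0 <= k ^+ 2 * (4 * (k * (2 * M))) by rewrite mulr_ge0 ?sqr_ge0// mulr_ge0.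
split.
- by move=> x; exact: box_derive.
- move=> x; have E : h + 1 * x = x + h by rewrite mul1r addrC.
  have d2 (z : R) : is_derive z 1 g2 (k * (g (z + h) - g z)) by exact: box_derive.
  have dh : is_derive (h + 1 * x) 1 g2 (k * (g (x + h + h) - g (x + h))).
    by rewrite E; exact: d2.
  have d1 := @is_derive1_comp R g2 (fun y => h + 1 * y) x _ _ dh (is_derive1_affine h 1 x).
  have := is_derive1Z k (is_derive1D d1 (is_derive1Z (-1) (d2 x))).
  rewrite (_ : (fun t => _) = f1); last first.
    by apply/funext => y; rewrite /f1 /= mul1r mulN1r (addrC h).
  by move/is_derive_eq; apply; rewrite /f2 mulr1 mulN1r.
- move=> x; have : `|box3 h f x| <= M by exact: box_bnd.
  lra.
- move=> x; rewrite normrM (ger0_norm k0).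
  have : `|g2 (x + h) - g2 x| <= 2 * M.
    by apply: le_trans (ler_normB _ _) _; have := g2M (x + h); have := g2M x; lra.
  by move=> /(ler_wpM2l k0); lra.
- move=> x; rewrite (_ : f2 x = k ^+ 2 * (g (x + h + h) - g (x + h) - (g (x + h) - g x))); last first.
    by rewrite /f2; ring.
  rewrite normrM (ger0_norm (sqr_ge0 k)).
  have : `|g (x + h + h) - g (x + h) - (g (x + h) - g x)| <= 4 * M.
    apply: le_trans (ler_normB _ _) _.
    have h1 := ler_normB (g (x + h + h)) (g (x + h)); have h2 := ler_normB (g (x + h)) (g x).
    have := gM (x + h + h); have := gM (x + h); have := gM x; lra.
  by move=> /(ler_wpM2l (sqr_ge0 k)); lra.
- move=> x y.
  rewrite (_ : f2 x - f2 y = k ^+ 2 * ((g (x + h + h) - g (y + h + h)) -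
      2 * (g (x + h) - g (y + h)) + (g x - g y))); last by rewrite /f2; ring.
  rewrite normrM (ger0_norm (sqr_ge0 k)).
  have b : `|(g (x + h + h) - g (y + h + h)) - 2 * (g (x + h) - g (y + h)) + (g x - g y)|
      <= 4 * (k * (2 * M)) * `|x - y|.
    apply: le_trans (ler_normD _ _) _.
    have a1 := ler_normB (g (x + h + h) - g (y + h + h)) (2 * (g (x + h) - g (y + h))).
    rewrite normrM (ger0_norm (_ : 0 <= 2 :> R))// in a1.
    have l1 := glip (x + h + h) (y + h + h).
    have l2 := glip (x + h) (y + h); have l3 := glip x y.
    have e1 : x + h + h - (y + h + h) = x - y by ring.
    have e2 : x + h - (y + h) = x - y by ring.
    rewrite e1 in l1; rewrite e2 in l2; lra.
  have xy : 0 <= `|x - y| by [].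
  apply: le_trans (ler_wpM2l (sqr_ge0 k) b) _.
  rewrite [leLHS](_ : _ = k ^+ 2 * (4 * (k * (2 * M))) * `|x - y|); last by ring.
  by rewrite ler_wpM2r//; lra.
Qed.

Lemma box3_near (h : R) f (x e : R) : 0 < h -> continuous f ->
  (forall t, x <= t <= x + h *+ 3 -> `|f t - f x| <= e) -> `|box3 h f x - f x| <= e.
Proof.
move=> h0 cf fe; have cg := box_cont h0 cf; have cg2 := box_cont h0 cg.
have h3 : h *+ 3 = h + h + h by rewrite !mulrS mulr0n addr0 addrA.
apply: box_near => // t /andP[xt th]; apply: box_near => // s /andP[ts sh].
apply: box_near => // r /andP[sr rh]; apply: fe; rewrite h3; apply/andP; split; lra.
Qed.

(** Compactness of [[-K, K]], although [t] may lie outside it; [3 / n.+1] is the reach of three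
    averages of step [1 / n.+1]. *)
Lemma unif_cont_segment f (K e : R) : continuous f -> 0 < e ->
  exists n : nat, forall x t, `|x| <= K -> `|t - x| <= 3 / n.+1%:R -> `|f t - f x| <= e.
Proof.
move=> cf e0; pose Q (n : nat) (x : R) := forall t, `|t - x| <= 3 / n.+1%:R -> `|f t - f x| <= e.
have := @segment_compact R (- K) K; move/compact_near_coveringP.
move/(_ nat \oo Q _) => [|N _ hN].
  move=> x _; have e2 : 0 < e / 2 by rewrite divr_gt0.
  have /cvgrPdist_lt /(_ _ e2)[/= r r0 hr] := cf x.
  have r2 : 0 < r / 2 by rewrite divr_gt0.
  have /cvgrPdist_lt /(_ _ r2)[n0 _ hn0] := cvg_invS0 (3 : R).
  exists ([set x' | `|x - x'| < r / 2], [set n | (n0 <= n)%N]) => /=.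
    split; last by exists n0.
    by exists (r / 2).
  move=> [x' n] [/= xx' n0n] t tx'.
  have := hn0 n n0n; rewrite /= sub0r normrN ger0_norm ?divr_ge0// => h3.
  have f1 : `|f x - f t| < e / 2.
    apply: hr; rewrite /ball_ /= (_ : x - t = (x - x') - (t - x')); last by ring.
    apply: le_lt_trans (ler_normB _ _) _.
    by rewrite [r]splitr ltrD// (le_lt_trans tx').
  have f2 : `|f x - f x'| < e / 2 by apply: hr; rewrite /ball_ /= (lt_le_trans xx')// ler_pdivrMr// ler_peMr ?ler1n// ltW.
  rewrite (_ : f t - f x' = (f x - f x') - (f x - f t)); last by ring.
  apply: le_trans (ler_normB _ _) _.
  by rewrite [e]splitr lerD// ltW.
exists N => x t xK tx; apply: (hN N (leqnn N) x) => //=.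
by rewrite in_itv/= -ler_norml.
Qed.

(* Three successive moving averages of a bounded continuous function are smooth
   enough, and close to it on compact sets. *)
Lemma smooth3_approx f (M e : R) : continuous f -> (forall t, `|f t| <= M) -> 0 < e ->
  exists (F f1 f2 : R -> R) (C : R), smooth3 F f1 f2 C /\
    forall x, `|f x - F x| <= e * (1 + `|x|).
Proof.
move=> cf fM e0; have M0 : 0 <= M by exact: le_trans (fM 0).
(* Beyond [2 * M / e] the trivial bound [2 M] on the difference is already below [e |x|]. *)
have [n hn] := @unif_cont_segment f (2 * M / e) e cf e0.
pose h : R := (n.+1%:R)^-1; have h0 : 0 < h by rewrite invr_gt0.
have [f1 [f2 [C sm]]] := box3_smooth h0 cf fM.
exists (box3 h f), f1, f2, C; split=> // x.
have [xK|Kx] := lerP `|x| (2 * M / e).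
  rewrite distrC; apply: (@le_trans _ _ e); last first.
    by rewrite ler_peMr ?(ltW e0)// lerDl.
  apply: box3_near => // t /andP[xt th]; apply: hn => //.
  rewrite ger0_norm ?subr_ge0//; rewrite -mulr_natl -/h; rewrite -mulr_natl in th.
  lra.
have bM : `|box3 h f x| <= M.
  have c1 := box_cont h0 cf; have c2 := box_cont h0 c1.
  by apply: box_bnd => // t; apply: box_bnd => // s; exact: box_bnd.
apply: le_trans (ler_normB _ _) _.
rewrite ltr_pdivrMr// in Kx; have := fM x; have := ltW e0; lra.
Qed.

End box_average.

(** * Coefficients of the martingale array *)

Section coefficients.
Context {R : realType}.
Implicit Types n j k : nat.

(* By summation by parts, [sqrt n (N_n / n - Z (n ^ 2))] is the sum over [j < n ^ 2] of
   [coefa n j (X j.+1 - Z j) - coefb n j (j + 1) (Z j.+1 - Z j)]; see [arr_decomp].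
   Stopping at time [n ^ 2] makes the remaining increments of [Z] negligible. *)
Definition coefr n : R := (Num.sqrt n%:R)^-1.

Definition coefa n j : R := if (j < n)%N then coefr n else 0.

Definition coefb n j : R := if (j < n)%N then coefr n else coefr n * (n%:R / j.+1%:R).

Lemma coefr_ge0 n : 0 <= coefr n. Proof. by rewrite invr_ge0 sqrtr_ge0. Qed.

Lemma coefr_sqr n : coefr n ^+ 2 = n%:R^-1.
Proof. by rewrite exprVn sqr_sqrtr. Qed.

Lemma coefr_cvg : coefr n @[n --> \oo] --> 0.
Proof.
apply/cvgrPdist_lt => e e0.
have e2 : 0 < e ^+ 2 by rewrite exprn_gt0.
have /cvgrPdist_lt /(_ _ e2)[N _ hN] := cvg_invS0 (1 : R).
exists N.+1 => // n /= Nn; case: n Nn => // n Nn.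
have := hN n Nn; rewrite /= !sub0r !normrN div1r.
rewrite !ger0_norm ?invr_ge0 ?coefr_ge0//.
by rewrite -coefr_sqr ltr_pXn2r// nnegrE ?coefr_ge0// ltW.
Qed.

Lemma coefb_ge0 n j : 0 <= coefb n j.
Proof. by rewrite /coefb; case: ifP => _; rewrite ?mulr_ge0 ?coefr_ge0// divr_ge0. Qed.

Lemma coefb_le n j : coefb n j <= coefr n.
Proof.
rewrite /coefb; case: ltnP => // nj; rewrite ler_piMr ?coefr_ge0// ler_pdivrMr//.
by rewrite mul1r ler_nat ltnW.
Qed.

Lemma coefa_ge0 n j : 0 <= coefa n j.
Proof. by rewrite /coefa; case: ifP => _; rewrite ?coefr_ge0. Qed.

Lemma coefa_le n j : coefa n j <= coefb n j.
Proof. by rewrite /coefa; case: ifP => [jn|_]; rewrite ?coefb_ge0// /coefb jn. Qed.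

(** The form in which the coefficients come out of the summation by parts. *)
Lemma coefbS n j : coefb n j * j.+1%:R = coefr n * (minn j.+1 n)%:R.
Proof.
rewrite /coefb; case: ltnP => jn.
  by rewrite (minn_idPl jn).
by rewrite (minn_idPr (leqW jn)) -mulrA divfK.
Qed.

Lemma leq_sqr n : (n <= n ^ 2)%N.
Proof. by case: n => // n; rewrite -mulnn leq_pmulr. Qed.

Let split_sum (F : nat -> R) n :
  \sum_(0 <= j < n ^ 2) F j = \sum_(0 <= j < n) F j + \sum_(n <= j < n ^ 2) F j.
Proof. by rewrite -big_cat_nat// leq_sqr. Qed.

Let tail_sqr_le n (c : R) : 0 <= c -> c * n%:R * \sum_(n <= j < n ^ 2) (j.+1%:R ^+ 2)^-1 <= 2 * c.
Proof.
move=> c0; rewrite -mulrA mulrC ler_wpM2r//.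
apply: (@le_trans _ _ (n%:R * (2 / n.+1%:R))); first by rewrite ler_wpM2l// sum_invsq_le.
by rewrite mulrCA ler_piMr// ler_pdivrMr// mul1r ler_nat.
Qed.

(** The first [n] terms add up to 1, and the others to at most 2. *)
Lemma sum_coefb_sqr n : \sum_(0 <= j < n ^ 2) coefb n j ^+ 2 <= 3.
Proof.
case: n => [|n']; first by rewrite big_geq.
set n := n'.+1; rewrite split_sum.
rewrite (eq_big_nat _ _ (F2 := fun=> n%:R^-1)); last first.
  by move=> j /andP[_ jn]; rewrite /coefb jn coefr_sqr.
rewrite sumr_const_nat subn0 -[_ *+ _]mulr_natr mulVf ?pnatr_eq0//.
rewrite (eq_big_nat _ _ (F2 := fun j => 1 * n%:R * (j.+1%:R ^+ 2)^-1)); last first.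
  move=> j /andP[nj _]; rewrite /coefb ltnNge nj /= exprMn coefr_sqr.
  have : n%:R != 0 :> R by rewrite pnatr_eq0.
  have : j.+1%:R != 0 :> R by rewrite pnatr_eq0.
  move: (j.+1%:R : R) (n%:R : R) => x y x0 y0; field.
  by rewrite x0 y0.
rewrite -mulr_sumr; have := @tail_sqr_le n 1 ler01; lra.
Qed.

(** Any bound [o(sqrt n)] will do in place of the logarithm. The fourth root makes the induction
    algebraic, through [1 = a^4 - b^4 <= 4 (a - b) a^3]. *)
Let harmonic_le n : \sum_(0 <= j < n) j.+1%:R^-1 <= 4 * Num.sqrt (Num.sqrt n%:R) :> R.
Proof.
elim: n => [|n IH]; first by rewrite big_geq// sqrtr0 sqrtr0 mulr0.
rewrite big_nat_recr//=; apply: le_trans (lerD IH (lexx _)) _.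
set a := Num.sqrt (Num.sqrt n.+1%:R); set b := Num.sqrt (Num.sqrt n%:R).
have a4 : a ^+ 4 = n.+1%:R :> R.
  by rewrite (exprM a 2 2) sqr_sqrtr ?sqrtr_ge0// sqr_sqrtr.
have b4 : b ^+ 4 = n%:R :> R.
  by rewrite (exprM b 2 2) sqr_sqrtr ?sqrtr_ge0// sqr_sqrtr.
have b0 : 0 <= b by exact: sqrtr_ge0.
have a1 : 1 <= a.
  by rewrite -[leLHS]sqrtr1 -{1}[1]sqrtr1 !ler_sqrt ?sqrtr_ge0// ?ler1n// sqrtr_gt0.
have a0 : 0 < a by rewrite (lt_le_trans _ a1).
have ba : b <= a by rewrite !ler_sqrt ?sqrtr_ge0// ?ler_nat// sqrtr_gt0.
have ab4 : a ^+ 4 - b ^+ 4 = 1 by rewrite a4 b4 -natr1 addrAC subrr add0r.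
rewrite -a4 -lerBrDl -mulrBr; clearbody a b.
have h : 1 <= (a - b) * (4 * a ^+ 3).
  rewrite -[leLHS]ab4 (_ : a ^+ 4 - b ^+ 4 = (a - b) * ((a + b) * (a ^+ 2 + b ^+ 2))); last by ring.
  rewrite ler_wpM2l ?subr_ge0//.
  have h1 : a + b <= 2 * a by lra.
  have h2 : b ^+ 2 <= a ^+ 2 by rewrite lerXn2r// nnegrE// ltW.
  apply: (@le_trans _ _ ((2 * a) * (2 * a ^+ 2))).
    by apply: ler_pM => //; rewrite ?addr_ge0 ?sqr_ge0 ?(ltW a0)//; lra.
  by rewrite le_eqVlt; apply/orP; left; apply/eqP; ring.
rewrite -[leLHS]div1r ler_pdivrMr ?exprn_gt0//.
have a3 : a ^+ 3 <= a ^+ 4 by rewrite ler_weXn2l.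
have h3 : (a - b) * a ^+ 3 <= (a - b) * a ^+ 4 by rewrite ler_wpM2l// subr_ge0.
lra.
Qed.

(** This sum controls the error in [arr_err]. Its head is [n^(-1/2)] times a harmonic sum, and its
    tail is at most [2 n^(-1/2)]. *)
Lemma sum_coefb_cvg :
  \sum_(0 <= j < n ^ 2) coefb n j / j.+1%:R @[n --> \oo] --> 0.
Proof.
have bd n : `|\sum_(0 <= j < n ^ 2) coefb n j / j.+1%:R| <=
    4 * Num.sqrt (coefr n) + 2 * coefr n.
  rewrite ger0_norm; last by apply: sumr_ge0 => j _; rewrite divr_ge0// coefb_ge0.
  rewrite split_sum lerD//.
    rewrite (eq_big_nat _ _ (F2 := fun j => coefr n * j.+1%:R^-1)); last first.
      by move=> j /andP[_ jn]; rewrite /coefb jn.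
    rewrite -mulr_sumr; apply: le_trans (ler_wpM2l (coefr_ge0 n) (harmonic_le n)) _.
    rewrite mulrCA ler_wpM2l//.
    case: n => [|n]; first by rewrite sqrtr0 sqrtr0 mulr0 sqrtr_ge0.
    rewrite /coefr; set x := Num.sqrt n.+1%:R.
    have x0 : 0 < x by rewrite sqrtr_gt0.
    rewrite -[X in X^-1 * _](sqr_sqrtr (ltW x0)) sqrtrV ?(ltW x0)//.
    rewrite expr2 invfM -mulrA mulVf ?mulr1// gt_eqF// sqrtr_gt0//.
  rewrite (eq_big_nat _ _ (F2 := fun j => coefr n * n%:R * (j.+1%:R ^+ 2)^-1)); last first.
    move=> j /andP[nj _]; rewrite /coefb ltnNge nj /=.
    by rewrite expr2 invfM !mulrA.
  by rewrite -mulr_sumr tail_sqr_le ?coefr_ge0.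
apply: (@cvg0_le R _ _ 0 (fun n _ => bd n)).
rewrite -[X in _ --> X](_ : 4 * Num.sqrt 0 + 2 * 0 = 0); last by rewrite sqrtr0 !mulr0 addr0.
apply: cvgD; apply: cvgMr; last exact: coefr_cvg.
exact: (continuous_cvg _ (@sqrt_continuous R 0) coefr_cvg).
Qed.

(** Comparison with telescoping sums on both sides; cutting the sum at [n ^ 2] costs only
    [O(1/n)]. *)
Lemma tail_sqr_cvg n : (0 < n)%N ->
  `|n%:R * \sum_(n <= j < n ^ 2) (j.+1%:R ^+ 2)^-1 - 1| <= 2 / n%:R :> R.
Proof.
move=> n0; have nR : 0 < n%:R :> R by rewrite ltr0n.
have tele (u : nat -> R) a b : (a <= b)%N ->
    \sum_(a <= j < b) (u j - u j.+1) = u a - u b.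
  move=> ab; rewrite -[LHS]opprK -sumrN.
  rewrite (eq_bigr (fun j => u j.+1 - u j)); last by move=> j _; rewrite opprB.
  by rewrite telescope_sumr// opprB.
have up : \sum_(n <= j < n ^ 2) (j.+1%:R ^+ 2)^-1 <= n%:R^-1 :> R.
  apply: (@le_trans _ _ (\sum_(n <= j < n ^ 2) (j%:R^-1 - j.+1%:R^-1))).
    rewrite !big_nat; apply: ler_sum => j /andP[nj _].
    have j0 : 0 < j%:R :> R by rewrite ltr0n (leq_trans n0).
    rewrite -[j.+1%:R]natr1 -subr_ge0 [leRHS](_ : _ = (j%:R * (j%:R + 1) ^+ 2)^-1).
      by rewrite invr_ge0 mulr_ge0 ?sqr_ge0// ltW.
    by field; rewrite !gt_eqF// addr_gt0.
  by rewrite (tele (fun j => j%:R^-1)) ?leq_sqr// gerBl invr_ge0.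
have lo : n.+1%:R^-1 - (n ^ 2).+1%:R^-1 <= \sum_(n <= j < n ^ 2) (j.+1%:R ^+ 2)^-1 :> R.
  rewrite -(tele (fun j => j.+1%:R^-1)) ?leq_sqr//.
  apply: ler_sum => j _; rewrite -[j.+2%:R]natr1; set x : R := j.+1%:R.
  have x0 : 0 < x by [].
  rewrite -subr_ge0 [leRHS](_ : _ = (x ^+ 2 * (x + 1))^-1).
    by rewrite invr_ge0 mulr_ge0 ?sqr_ge0// addr_ge0// ltW.
  by field; rewrite !gt_eqF// addr_gt0.
set s := \sum_(_ <= _ < _) _ in up lo *.
have u1 : n%:R * s <= 1 by rewrite mulrC -ler_pdivlMr// div1r.
rewrite distrC ger0_norm ?subr_ge0// lerBlDr -lerBlDl.
apply: le_trans (ler_wpM2l (ltW nR) lo).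
rewrite -natr1 -[(n ^ 2).+1%:R]natr1 natrX; set x : R := n%:R in nR *.
rewrite -subr_ge0 [leRHS](_ : _ = (x ^+ 2 + x + 2) / (x * (x + 1) * (x ^+ 2 + 1))).
  by rewrite divr_ge0 ?mulr_ge0 ?addr_ge0 ?sqr_ge0// ltW.
field; rewrite !gt_eqF ?addr_gt0// exprn_gt0//.
Qed.

End coefficients.

(** * The martingale array and its conditional variances *)

Section urn_array.
Context {R : realType} {d : measure_display} {T : measurableType d}.
Variables (P : probability T R) (y0 : 'I_2 -> R) (U X : nat -> 'I_2 -> {RV P >-> R}).
Hypothesis urn : reinforced_urn y0 U X.
Variable m : R.
Hypotheses (m_gt0 : 0 < m) (mean : forall k, Ex P (fun w => U 1%N k w) = m)
  (U_L2 : forall k, L1 P (fun w => U 1%N k w ^+ 2)).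

Local Notation frac := (urn_frac y0 U X).
Local Notation Z := (urn_Z y0 U X).
Local Notation measF m := (meas_wrt (urn_gens y0 U X m)).

Definition arr_sg k : R := Ex P (fun w => (U 1%N k w / m) ^+ 2).

(** Large enough to bound [arr_h2], and also [arr_v] and the second moment of [arr_D] in units of
    [coefb n j ^+ 2]. *)
Definition arr_K : R := 2 * (2 + arr_sg type1 + arr_sg type2).

(** If type 1 is drawn, [X - Z] is [1 - Z] and [xi] is [(1 - Z) U]; for type 2, [1 - Z] is replaced
    by [- Z]. In both cases the difference factors through [arr_A]. *)
Definition arr_A n j (u : R) : R := coefa n j - coefb n j * (u / m).

(* The array whose row sums approximate [sqrt n (N_n / n - Zinf)]. *)
Definition arr_D n j := urn_step U X j (fun w => 1 - Z j w) (fun w => - Z j w)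
  (arr_A n j) (arr_A n j).

Definition arr_W n w := \sum_(0 <= j < n ^ 2) arr_D n j w.

(** The second moment of [arr_A n j] at a reinforcement of type [k], as [U / m] has mean 1. *)
Definition arr_av n j k : R :=
  coefa n j ^+ 2 - 2 * (coefa n j * coefb n j) + coefb n j ^+ 2 * arr_sg k.

(** The conditional variance of [arr_D n j] when [Z j = z], factored from
    [z (1 - z)^2 av_1 + (1 - z) z^2 av_2]. *)
Definition arr_v n j (z : R) : R :=
  z * (1 - z) * ((1 - z) * arr_av n j type1 + z * arr_av n j type2).

Definition arr_h2 (z : R) : R :=
  z * (1 - z) * ((1 - z) * (2 * arr_sg type1 - 1) + z * (2 * arr_sg type2 - 1)).

(** The Lindeberg quantity: the mean of [min (Q^2) (coefr n * Q^3)] with [Q = 1 + |U| / m], summed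
    over both types. *)
Definition arr_lam n : R := \sum_(k : 'I_2) Ex P (fun w =>
  (1 + `|U 1%N k w| / m) ^+ 2 * Num.min 1 (coefr n * (1 + `|U 1%N k w| / m))).

Let sgL1 k : L1 P (fun w => (U 1%N k w / m) ^+ 2).
Proof.
have := L1Z (m^-1 ^+ 2) (U_L2 k); congr L1; apply/funext => w.
by rewrite exprMn mulrC.
Qed.

Let UL1 k : L1 P (fun w => U 1%N k w / m).
Proof.
have := L1Z m^-1 (U_L1 U_L2 k); congr L1; apply/funext => w; exact: mulrC.
Qed.

Let EUm k : Ex P (fun w => U 1%N k w / m) = 1.
Proof.
transitivity (Ex P (fun w => m^-1 * U 1%N k w)).
  by congr Ex; apply/funext => w; rewrite mulrC.
by rewrite (ExZ _ (U_L1 U_L2 k)) mean mulVf// gt_eqF.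
Qed.

(** The variance of [U / m] is nonnegative and its mean is 1; this makes the factors [2 sg - 1] of
    [arr_h2] positive. *)
Lemma arr_sg_ge1 k : 1 <= arr_sg k.
Proof.
have h : 0 <= Ex P (fun w => (U 1%N k w / m - 1) ^+ 2) by apply: Ex_ge0 => w; exact: sqr_ge0.
rewrite (_ : (fun w => (U 1%N k w / m - 1) ^+ 2) = (fun w =>
  (U 1%N k w / m) ^+ 2 + ((-2) * (U 1%N k w / m) + 1))) in h; last first.
  by apply/funext => w; ring.
have i1 := L1Z (-2) (UL1 k); have i2 := L1D i1 (L1_cst P 1).
by move: h; rewrite (ExD (sgL1 k) i2) (ExD i1 (L1_cst P 1)) (ExZ _ (UL1 k)) EUm Ex_cst -/(arr_sg k); lra.
Qed.

Lemma arr_K_ge0 : 0 <= arr_K.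
Proof. by rewrite /arr_K; have := arr_sg_ge1 type1; have := arr_sg_ge1 type2; lra. Qed.

Let mA n j : measurable_fun setT (arr_A n j).
Proof.
apply: measurable_funB; first exact: measurable_cst.
by apply: measurable_funM; [exact: measurable_cst|exact: measurable_funM].
Qed.

Let A_sqr n j u : arr_A n j u ^+ 2 =
  coefa n j ^+ 2 + (- (2 * (coefa n j * coefb n j)) * (u / m) + coefb n j ^+ 2 * (u / m) ^+ 2).
Proof. rewrite /arr_A; ring. Qed.

Let AL2 n j k : L1 P (fun w => arr_A n j (U 1%N k w) ^+ 2).
Proof.
under eq_fun do rewrite A_sqr.
by apply: L1D; [exact: L1_cst|apply: L1D; exact: L1Z].
Qed.

Let EA n j k : Ex P (fun w => arr_A n j (U 1%N k w)) = coefa n j - coefb n j.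
Proof.
rewrite (ExB (L1_cst P _) (L1Z (coefb n j) (UL1 k))) Ex_cst (ExZ _ (UL1 k)) EUm.
by rewrite mulr1.
Qed.

Let EA2 n j k : Ex P (fun w => arr_A n j (U 1%N k w) ^+ 2) = arr_av n j k.
Proof.
under eq_fun do rewrite A_sqr.
have i1 := L1Z (- (2 * (coefa n j * coefb n j))) (UL1 k).
have i2 := L1Z (coefb n j ^+ 2) (sgL1 k).
rewrite (ExD (L1_cst P _) (L1D i1 i2)) (ExD i1 i2) Ex_cst (ExZ _ (UL1 k)) (ExZ _ (sgL1 k)).
by rewrite EUm /arr_av /arr_sg; ring.
Qed.

Lemma arr_av_bnd n j k : 0 <= arr_av n j k <= 2 * (1 + arr_sg k) * coefb n j ^+ 2.
Proof.
apply/andP; split; first by rewrite -EA2; apply: Ex_ge0 => w; exact: sqr_ge0.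
have a0 := coefa_ge0 (R := R) n j; have ab := coefa_le (R := R) n j.
have b0 := coefb_ge0 (R := R) n j; have s1 := arr_sg_ge1 k.
rewrite /arr_av; have : coefa n j ^+ 2 <= coefb n j ^+ 2 :> R by rewrite lerXn2r.
have : 0 <= coefa n j * coefb n j :> R by exact: mulr_ge0.
have : 0 <= coefb n j ^+ 2 * arr_sg k by rewrite mulr_ge0 ?sqr_ge0//; lra.
have := sqr_ge0 (coefb n j : R); lra.
Qed.

Let pB j w : `|1 - Z j w| <= 1.
Proof.
by have /andP[z0 z1] := Z_itv urn j w; rewrite ger0_norm ?subr_ge0// gerBl.
Qed.

Let qB j w : `|- Z j w| <= 1.
Proof. by have /andP[z0 z1] := Z_itv urn j w; rewrite normrN ger0_norm. Qed.

Let mp j : measF j (fun w => 1 - Z j w).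
Proof. by apply: measurable_funB; [exact: measurable_cst|exact: measF_Z]. Qed.

Let mq j : measF j (fun w => - Z j w).
Proof. by apply: measurable_funN; exact: measF_Z. Qed.

(** Equal means give [arr_A] the mean [coefa - coefb] for both types, so the terms [+ Z (1 - Z)] and
    [- Z (1 - Z)] cancel. *)
Let cen n j w : (1 - Z j w) * frac j type1 w * Ex P (fun w => arr_A n j (U 1%N type1 w)) +
  - Z j w * frac j type2 w * Ex P (fun w => arr_A n j (U 1%N type2 w)) = 0.
Proof. rewrite !EA (frac2E urn) -/(Z j w) /urn_Z; ring. Qed.

Lemma arr_D_mdiff n : mdiff y0 U X (arr_D n).
Proof.
exact: (@urn_mdiff _ _ _ _ _ _ _ urn (fun j w => 1 - Z j w) (fun j w => - Z j w)
  (arr_A n) (arr_A n) (fun=> 1) mp mq (mA n) (mA n) (fun j => AL2 n j _) (fun j => AL2 n j _)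
  pB qB (cen n)).
Qed.

Lemma arr_D0 n j (G : T -> R) b : measF j G -> (forall w, `|G w| <= b) ->
  Ex P (fun w => G w * arr_D n j w) = 0.
Proof.
move=> mG Gb; have lG : L1 P G by exact: (L1_bnd P (measF_meas mG) Gb).
exact: (@Ex_urn_step0 _ _ _ _ _ _ _ urn j _ _ _ _ _ (@mp j) (@mq j) (@mA n j) (@mA n j)
  (AL2 n j _) (AL2 n j _) (pB j) (qB j) (cen n j) G mG lG).
Qed.

Lemma arr_D2 n j (G : T -> R) b : measF j G -> (forall w, `|G w| <= b) ->
  Ex P (fun w => G w * arr_D n j w ^+ 2) = Ex P (fun w => G w * arr_v n j (Z j w)).
Proof.
move=> mG Gb; have mGT := measF_meas mG; have lG : L1 P G by exact: (L1_bnd P mGT Gb).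
have mf k := measF_meas (@measF_frac _ _ _ _ _ _ _ urn j k).
have fB k w : `|frac j k w| <= 1.
  by have /andP[f0 f1] := frac_itv urn j k w; rewrite ger0_norm.
have l (p : T -> R) : measF j p -> (forall w, `|p w| <= 1) -> L1 P (fun w => G w * p w ^+ 2).
  move=> mp' pB'; have mp2 : measurable_fun setT (fun w => p w ^+ 2).
    by apply: measurable_funX; exact: (measF_meas mp').
  have p2B w : `|p w ^+ 2| <= 1.
    by rewrite normrX -[leRHS](expr1n _ 2) lerXn2r ?nnegrE.
  by have := L1M_bnd mp2 p2B lG; congr L1; apply/funext => w; rewrite mulrC.
have lf k (p : T -> R) : measF j p -> (forall w, `|p w| <= 1) ->
    L1 P (fun w => G w * p w ^+ 2 * frac j k w).
  move=> mp' pB'; have := L1M_bnd (@mf k) (fB k) (l p mp' pB').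
  by congr L1; apply/funext => w; rewrite mulrC.
have [_ ->] := @Ex_urn_step_sqr _ _ _ _ _ _ _ urn j _ _ _ _ (@mp j) (@mq j)
  (@mA n j) (@mA n j) (AL2 n j _) (AL2 n j _) G mG (l _ (@mp j) (pB j)) (l _ (@mq j) (qB j)).
have i1 := lf type1 _ (@mp j) (pB j); have i2 := lf type2 _ (@mq j) (qB j).
rewrite !EA2 [X in X + _]mulrC [X in _ + X]mulrC -(ExZ _ i1) -(ExZ _ i2).
rewrite -(ExD (L1Z _ i1) (L1Z _ i2)); congr Ex; apply/funext => w.
by rewrite (frac2E urn) -/(Z j w) /arr_v /urn_Z; ring.
Qed.

Lemma arr_D_sqr n j : Ex P (fun w => arr_D n j w ^+ 2) <= arr_K * coefb n j ^+ 2.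
Proof.
have := @Ex_urn_step_sqr_le _ _ _ _ _ _ _ urn j _ _ _ _ 1 (@mp j) (@mq j)
  (@mA n j) (@mA n j) (AL2 n j _) (AL2 n j _) (pB j) (qB j) (fun=> 1) (measurable_cst _).
have n1 (w : T) : `|1 : R| <= 1 by rewrite normr1.
have b1 w : `|1 - Z j w| <= `|1 : R| by rewrite normr1.
have b2 w : `|- Z j w| <= `|1 : R| by rewrite normr1.
move=> /(_ n1 b1 b2) h; apply: le_trans h _; clear n1 b1 b2.
rewrite expr1n Ex_cst mul1r !EA2 /arr_K.
by have /andP[_ h1] := arr_av_bnd n j type1; have /andP[_ h2] := arr_av_bnd n j type2; lra.
Qed.

Lemma arr_D_L2 n j : L1 P (fun w => arr_D n j w ^+ 2).
Proof. by case: (arr_D_mdiff n j). Qed.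

Lemma measF_arr_D n j : measF j.+1 (arr_D n j).
Proof. by case: (arr_D_mdiff n j). Qed.

Lemma arr_W_L2 n : L1 P (fun w => arr_W n w ^+ 2) /\
  Ex P (fun w => arr_W n w ^+ 2) <= 3 * arr_K.
Proof.
have [l E] := mdiff_sum 0 (n ^ 2) (arr_D_mdiff n); split; first exact: l.
rewrite /arr_W E; apply: (@le_trans _ _ (\sum_(0 <= j < n ^ 2) arr_K * coefb n j ^+ 2)).
  by apply: ler_sum => j _; exact: arr_D_sqr.
by rewrite -mulr_sumr mulrC ler_wpM2r ?arr_K_ge0// sum_coefb_sqr.
Qed.

(** For fixed [k] the first [k] differences are negligible, so Lindeberg's replacement may start at
    time [k]. *)
Lemma arr_head_sqr n k : (0 < n)%N ->
  Ex P (fun w => `|\sum_(0 <= j < k) arr_D n j w|) <= Num.sqrt (arr_K * k%:R) * coefr n.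
Proof.
move=> n0; have [l E] := mdiff_sum 0 k (arr_D_mdiff n).
have mM : measurable_fun setT (fun w => \sum_(0 <= j < k) arr_D n j w).
  by apply: (@measF_meas _ _ _ _ y0 U X k); apply: measF_sum => j; exact: measF_arr_D.
apply: (Ex_sqr_le mM l); first by rewrite mulr_ge0 ?sqrtr_ge0// coefr_ge0.
have Kk : 0 <= arr_K * k%:R by apply: mulr_ge0 => //; exact: arr_K_ge0.
rewrite E exprMn (sqr_sqrtr Kk).
apply: (@le_trans _ _ (\sum_(0 <= j < k) arr_K * coefr n ^+ 2)).
  apply: ler_sum => j _; apply: le_trans (arr_D_sqr n j) _.
  rewrite ler_wpM2l ?arr_K_ge0// lerXn2r ?nnegrE ?coefb_ge0 ?coefr_ge0//.
  exact: coefb_le.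
by rewrite sumr_const_nat subn0 -[X in X <= _]mulr_natr mulrAC.
Qed.

Lemma arr_v_bnd n j z : 0 <= z <= 1 -> 0 <= arr_v n j z <= arr_K * coefb n j ^+ 2.
Proof.
move=> /andP[z0 z1]; have /andP[a0 a1] := arr_av_bnd n j type1.
have /andP[b0 b1] := arr_av_bnd n j type2.
have z1' : 0 <= 1 - z by rewrite subr_ge0.
have t0 : 0 <= (1 - z) * arr_av n j type1 + z * arr_av n j type2.
  by rewrite addr_ge0// mulr_ge0.
rewrite /arr_v mulr_ge0 ?mulr_ge0//=.
apply: (@le_trans _ _ (1 * ((1 - z) * arr_av n j type1 + z * arr_av n j type2))).
  by rewrite ler_wpM2r//; nra.
rewrite mul1r; apply: (@le_trans _ _ (arr_av n j type1 + arr_av n j type2)).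
  by rewrite lerD// ler_piMl// gerBl.
by rewrite /arr_K; lra.
Qed.

Let cubic_lip (a b z z' : R) : 0 <= a -> 0 <= b -> 0 <= z <= 1 -> 0 <= z' <= 1 ->
  `|z * (1 - z) * ((1 - z) * a + z * b) - z' * (1 - z') * ((1 - z') * a + z' * b)| <=
  8 * (a + b) * `|z - z'|.
Proof.
move=> a0 b0 /andP[z0 z1] /andP[z'0 z'1].
have -> : z * (1 - z) * ((1 - z) * a + z * b) - z' * (1 - z') * ((1 - z') * a + z' * b) =
   (a * (1 - 2 * (z + z') + (z ^+ 2 + z * z' + z' ^+ 2)) +
    b * ((z + z') - (z ^+ 2 + z * z' + z' ^+ 2))) * (z - z') by ring.
rewrite normrM ler_wpM2r//.
have s0' : 0 <= z ^+ 2 + z * z' + z' ^+ 2 <= 3 by apply/andP; split; nra.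
move/andP: s0' => [s0' s3]; set s := z ^+ 2 + z * z' + z' ^+ 2 in s0' s3 *.
have A : `|1 - 2 * (z + z') + s| <= 8 by rewrite ler_norml; apply/andP; split; lra.
have B : `|(z + z') - s| <= 8 by rewrite ler_norml; apply/andP; split; lra.
apply: le_trans (ler_normD _ _) _; rewrite !normrM (ger0_norm a0) (ger0_norm b0).
by have := ler_wpM2l a0 A; have := ler_wpM2l b0 B; lra.
Qed.

Lemma arr_v_lip n j z z' : 0 <= z <= 1 -> 0 <= z' <= 1 ->
  `|arr_v n j z - arr_v n j z'| <= 8 * (arr_K * coefb n j ^+ 2) * `|z - z'|.
Proof.
move=> zi z'i; have /andP[a0 a1] := arr_av_bnd n j type1.
have /andP[b0 b1] := arr_av_bnd n j type2.
apply: le_trans (cubic_lip a0 b0 zi z'i) _; rewrite ler_wpM2r// ler_wpM2l//.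
by rewrite /arr_K; lra.
Qed.

Lemma measurable_arr_h2 : measurable_fun setT arr_h2.
Proof.
apply: continuous_measurable_fun => z; rewrite /arr_h2.
apply: cvgM; first by apply: cvgM; [exact: cvg_id|apply: cvgB; [exact: cvg_cst|exact: cvg_id]].
apply: cvgD; apply: cvgM; try exact: cvg_cst; last exact: cvg_id.
by apply: cvgB; [exact: cvg_cst|exact: cvg_id].
Qed.

Lemma arr_h2_bnd z : 0 <= z <= 1 -> 0 <= arr_h2 z <= arr_K.
Proof.
move=> /andP[z0 z1]; have a1 := arr_sg_ge1 type1; have b1 := arr_sg_ge1 type2.
rewrite /arr_h2 /arr_K; set a := arr_sg type1 in a1 *; set b := arr_sg type2 in b1 *.
have z1' : 0 <= 1 - z by rewrite subr_ge0.
have t0 : 0 <= (1 - z) * (2 * a - 1) + z * (2 * b - 1).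
  by rewrite addr_ge0// mulr_ge0//; lra.
rewrite mulr_ge0 ?mulr_ge0//=.
apply: (@le_trans _ _ (1 * ((1 - z) * (2 * a - 1) + z * (2 * b - 1)))).
  by rewrite ler_wpM2r//; nra.
rewrite mul1r; apply: (@le_trans _ _ ((2 * a - 1) + (2 * b - 1))); last by lra.
by rewrite lerD// ler_piMl//; lra.
Qed.

Lemma arr_h2_lip z z' : 0 <= z <= 1 -> 0 <= z' <= 1 ->
  `|arr_h2 z - arr_h2 z'| <= 8 * arr_K * `|z - z'|.
Proof.
move=> zi z'i; have a1 := arr_sg_ge1 type1; have b1 := arr_sg_ge1 type2.
have a0 : 0 <= 2 * arr_sg type1 - 1 by lra.
have b0 : 0 <= 2 * arr_sg type2 - 1 by lra.
apply: le_trans (cubic_lip a0 b0 zi z'i) _; rewrite ler_wpM2r// ler_wpM2l//.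
by rewrite /arr_K; lra.
Qed.

(** Up to the factor [z (1 - z)], each term before [n] is [(V - 1) / n] and the tail is [V] times a
    sum close to 1, which gives [2 V - 1]. The error consists of the [k] missing terms and the
    defect of [tail_sqr_cvg]. *)
Lemma arr_v_sum n k z : (0 < n)%N -> (k <= n)%N -> 0 <= z <= 1 ->
  `|\sum_(k <= j < n ^ 2) arr_v n j z - arr_h2 z| <= arr_K * ((k%:R + 2) / n%:R).
Proof.
move=> n0 kn /andP[z0 z1]; have nR : 0 < n%:R :> R by rewrite ltr0n.
have a1 := arr_sg_ge1 type1; have b1 := arr_sg_ge1 type2.
set V := (1 - z) * arr_sg type1 + z * arr_sg type2.
have V1 : 1 <= V.
  rewrite /V; have : (1 - z) * 1 <= (1 - z) * arr_sg type1 by rewrite ler_wpM2l// subr_ge0.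
  have : z * 1 <= z * arr_sg type2 by rewrite ler_wpM2l.
  lra.
have VK : V <= arr_sg type1 + arr_sg type2.
  by rewrite lerD// ler_piMl//; lra.
set t := \sum_(n <= j < n ^ 2) (j.+1%:R ^+ 2)^-1 : R.
have ht := @tail_sqr_cvg R n n0.
have E : \sum_(k <= j < n ^ 2) arr_v n j z - arr_h2 z = z * (1 - z) *
    (V * (n%:R * t - 1) - (k%:R / n%:R) * (V - 1)).
  rewrite (big_cat_nat kn (leq_sqr n))/=.
  rewrite (eq_big_nat _ _ (F2 := fun=> z * (1 - z) * (V - 1) / n%:R)); last first.
    move=> j /andP[_ jn]; rewrite /arr_v /arr_av /coefa /coefb jn /V -coefr_sqr; ring.
  rewrite sumr_const_nat -[X in X + _ - _]mulr_natr natrB//.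
  rewrite (eq_big_nat _ _ (F2 := fun j => z * (1 - z) * V * n%:R * (j.+1%:R ^+ 2)^-1)); last first.
    move=> j /andP[nj _]; rewrite /arr_v /arr_av /coefa /coefb ltnNge nj /= /V.
    rewrite exprMn coefr_sqr; have : n%:R != 0 :> R by rewrite gt_eqF.
    have : j.+1%:R != 0 :> R by rewrite pnatr_eq0.
    by move: (j.+1%:R : R) (n%:R : R) => x y x0 y0'; field; rewrite x0 y0'.
  rewrite -mulr_sumr -/t /arr_h2 /V; field; rewrite gt_eqF//.
rewrite E normrM.
have zz : `|z * (1 - z)| <= 1 by rewrite ler_norml; apply/andP; split; nra.
apply: le_trans (ler_wpM2r (normr_ge0 _) zz) _; rewrite mul1r.
apply: le_trans (ler_normB _ _) _; rewrite !normrM.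
rewrite (ger0_norm (_ : 0 <= V)); last by lra.
rewrite (ger0_norm (_ : 0 <= V - 1)); last by lra.
rewrite (ger0_norm (_ : 0 <= k%:R))// (ger0_norm (_ : 0 <= n%:R^-1)); last by rewrite invr_ge0.
have h1 : V * `|n%:R * t - 1| <= V * (2 / n%:R) by rewrite ler_wpM2l//; lra.
apply: le_trans (lerD h1 (lexx _)) _.
have kn0 : 0 <= k%:R / n%:R :> R by rewrite divr_ge0.
have n20 : 0 <= 2 / n%:R :> R by rewrite divr_ge0.
rewrite [leRHS](_ : _ = arr_K * (2 / n%:R) + k%:R / n%:R * arr_K); last by ring.
apply: lerD; first by apply: ler_wpM2r => //; rewrite /arr_K; lra.
by apply: ler_wpM2l => //; rewrite /arr_K; lra.
Qed.

End urn_array.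

(** * Lindeberg's condition and the error of the array *)

Section urn_array_error.
Context {R : realType} {d : measure_display} {T : measurableType d}.
Variables (P : probability T R) (y0 : 'I_2 -> R) (U X : nat -> 'I_2 -> {RV P >-> R}).
Hypothesis urn : reinforced_urn y0 U X.
Variable m : R.
Hypotheses (m_gt0 : 0 < m) (mean : forall k, Ex P (fun w => U 1%N k w) = m)
  (U_L2 : forall k, L1 P (fun w => U 1%N k w ^+ 2)).

Local Notation Z := (urn_Z y0 U X).
Local Notation Zinf := (urn_Zinf y0 U X).
Local Notation S := (urn_S y0 U X).
Local Notation s0 := (urn_s0 y0).
Local Notation measF m := (meas_wrt (urn_gens y0 U X m)).
Local Notation q := (urn_q U).
Local Notation D := (arr_D y0 U X m).
Local Notation W := (arr_W y0 U X m).
Local Notation lam := (arr_lam U m).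

Let phi n (u : R) : R := (1 + `|u| / m) ^+ 2 * Num.min 1 (coefr n * (1 + `|u| / m)).

Let Q_ge1 (u : R) : 1 <= 1 + `|u| / m.
Proof. by rewrite lerDl divr_ge0// ltW. Qed.

Let phi_ge0 n u : 0 <= phi n u.
Proof.
rewrite mulr_ge0 ?sqr_ge0// le_min ler01 mulr_ge0 ?coefr_ge0//.
exact: le_trans ler01 (Q_ge1 u).
Qed.

Let phi_le n u : phi n u <= 2 * (1 + (u / m) ^+ 2).
Proof.
apply: (@le_trans _ _ ((1 + `|u| / m) ^+ 2)).
  by rewrite ler_piMr ?sqr_ge0// ge_min lexx.
rewrite exprMn -(real_normK (num_real u)) -exprMn; set t := `|u| / m.
by rewrite -subr_ge0 [leRHS](_ : _ = (1 - t) ^+ 2) ?sqr_ge0//; ring.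
Qed.

Let measurable_Q : measurable_fun setT (fun u : R => 1 + `|u| / m).
Proof.
apply: measurable_funD; first exact: measurable_cst.
by apply: measurable_funM => //; exact: normr_measurable.
Qed.

Let measurable_phi n : measurable_fun setT (phi n).
Proof.
apply: measurable_funM; first exact: measurable_funX.
by apply: measurable_minr => //; exact: measurable_funM.
Qed.

Let phiU_meas n k : measurable_fun setT (fun w => phi n (U 1%N k w)).
Proof. exact: (measurableT_comp (@measurable_phi n) (measurable_funPT _)). Qed.

Let domL1 k : L1 P (fun w => 2 * (1 + (U 1%N k w / m) ^+ 2)).
Proof.
apply/L1Z/L1D; first exact: L1_cst.
have := L1Z (m^-1 ^+ 2) (U_L2 k); congr L1; apply/funext => w.
by rewrite exprMn mulrC.
Qed.

Let phiL1 n k : L1 P (fun w => phi n (U 1%N k w)).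
Proof.
apply: (L1_dom (@phiU_meas n k) (domL1 k)) => w.
by rewrite ger0_norm.
Qed.

(** Dominated convergence: pointwise the integrand is [O(n^(-1/2))], and it stays below
    [2 (1 + (U / m)^2)]. *)
Lemma arr_lam_cvg : lam n @[n --> \oo] --> 0.
Proof.
have c k : Ex P (fun w => phi n (U 1%N k w)) @[n --> \oo] --> 0.
  have -> : 0 = Ex P (fun=> 0 : R) by rewrite Ex_cst.
  apply: (@Ex_cvg _ _ _ P (fun n w => phi n (U 1%N k w)) _ _ (fun n => @phiU_meas n k) (measurable_cst _) (domL1 k)).
    by move=> n w; rewrite ger0_norm.
  apply: aeW => w; set Q := 1 + `|U 1%N k w| / m.
  apply: (@cvg0_le _ _ (fun n => Q ^+ 3 * coefr n) 0).
    move=> n _; rewrite ger0_norm// /phi -/Q.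
    have Q0 : 0 <= Q by exact: le_trans ler01 (Q_ge1 _).
    rewrite [leRHS](_ : _ = Q ^+ 2 * (coefr n * Q)); last by ring.
    by apply: ler_wpM2l; rewrite ?sqr_ge0// ge_min lexx orbT.
  have h : (Q ^+ 3 * coefr n) @[n --> \oo] --> Q ^+ 3 * 0.
    by apply: cvgMr; exact: coefr_cvg.
  by move: h; rewrite mulr0.
have -> : lam = (fun n => Ex P (fun w => phi n (U 1%N ord0 w)) +
    Ex P (fun w => phi n (U 1%N (lift ord0 ord0) w))).
  by apply/funext => n; rewrite /arr_lam !big_ord_recl big_ord0 addr0.
have h := cvgD (c ord0) (c (lift ord0 ord0)).
by rewrite addr0 in h; exact: h.
Qed.

(** For the type drawn, [|D n j| <= coefb n j * Q] with [Q = 1 + |U| / m]. In the cube one factor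
    [coefb n j] is bounded by [coefr n], the other two are kept for summation. *)
Lemma arr_min n j : Ex P (fun w => Num.min (D n j w ^+ 2) (`|D n j w| ^+ 3)) <=
  lam n * coefb n j ^+ 2.
Proof.
have lphi k := L1_U_ident urn j (@measurable_phi n) (phiL1 n k).
pose F w := \sum_(k : 'I_2) phi n (U j.+1 k w).
have lF : L1 P F by apply: L1_sum => k _; exact: lphi.
have <- : Ex P F = lam n.
  rewrite /F (Ex_sum _ (fun k _ => lphi k)) /arr_lam; apply: eq_bigr => k _.
  by rewrite (Ex_U_ident urn j k (@measurable_phi n) (phi_ge0 n)).
rewrite mulrC -(ExZ _ lF).
have mD : measurable_fun setT (D n j).
  by apply: (@measF_meas _ _ _ _ y0 U X j.+1); exact: (measF_arr_D urn m_gt0 mean U_L2).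
apply: Ex_ge0_le; [|exact: L1Z|].
  apply: measurable_minr; first exact: measurable_funX.
  by apply: measurable_funX; exact: measurableT_comp.
move=> w; rewrite le_min sqr_ge0 exprn_ge0//=.
have b0 := coefb_ge0 (R := R) n j.
have key k (z : R) : `|z| <= 1 -> D n j w = z * arr_A m n j (U j.+1 k w) ->
    Num.min (D n j w ^+ 2) (`|D n j w| ^+ 3) <= coefb n j ^+ 2 * phi n (U j.+1 k w).
  move=> z1 ->; set Q := 1 + `|U j.+1 k w| / m.
  have Q1 : 1 <= Q by exact: Q_ge1.
  have Q0 : 0 <= Q by exact: le_trans ler01 Q1.
  have xb : `|z * arr_A m n j (U j.+1 k w)| <= coefb n j * Q.
    rewrite normrM; apply: (@le_trans _ _ `|arr_A m n j (U j.+1 k w)|).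
      by rewrite ler_piMl.
    apply: le_trans (ler_normB _ _) _; rewrite mulrDr mulr1 lerD//.
      by rewrite ger0_norm ?coefa_ge0// coefa_le.
    by rewrite !normrM normfV (ger0_norm b0) (ger0_norm (ltW m_gt0)).
  move: (z * _) xb => x xb.
  have xb2 : x ^+ 2 <= (coefb n j * Q) ^+ 2.
    by rewrite -(real_normK (num_real x)) lerXn2r// nnegrE mulr_ge0.
  rewrite /phi -/Q mulrA -exprMn.
  have [h1|h1] := lerP 1 (coefr n * Q).
    by rewrite mulr1 ge_min xb2.
  rewrite ge_min; apply/orP; right.
  apply: (@le_trans _ _ ((coefb n j * Q) ^+ 3)); first by rewrite lerXn2r// nnegrE mulr_ge0.
  rewrite [leLHS]exprSr; apply: ler_wpM2l; first exact: sqr_ge0.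
  by apply: ler_wpM2r => //; exact: coefb_le.
rewrite /F !big_ord_recr big_ord0/= add0r mulrDr.
have p k : 0 <= coefb n j ^+ 2 * phi n (U j.+1 k w) by rewrite mulr_ge0 ?sqr_ge0.
have /andP[z0 z1] := Z_itv urn j w.
rewrite (_ : widen_ord _ _ = type1); last exact/val_inj.
rewrite (_ : ord_max = type2)//.
case: (urn_X_01 urn j type1 w) => Xw.
  apply: ler_wpDl => //; apply: (key _ (- Z j w)).
    by rewrite normrN ger0_norm.
  by rewrite /arr_D /urn_step (X2E urn) Xw mulr0 mul0r add0r subr0 mulr1.
apply: ler_wpDr => //; apply: (key _ (1 - Z j w)).
  by rewrite ger0_norm ?subr_ge0// gerBl.
by rewrite /arr_D /urn_step (X2E urn) Xw subrr mulr0 mul0r addr0 mulr1.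
Qed.

Let dZ j w := Z j.+1 w - Z j w.

(** Summation by parts: [n * Z n] is the sum of [Z j + (j + 1) (Z j.+1 - Z j)] over [j < n]. *)
Let N1_decomp n w : urn_N1 X n w - n%:R * Z n w =
  \sum_(0 <= j < n) ((X j.+1 type1 w - Z j w) - j.+1%:R * dZ j w).
Proof.
rewrite /urn_N1 big_add1 /=; elim: n => [|n IH]; first by rewrite !big_geq// mul0r subr0.
rewrite !big_nat_recr//= -IH /dZ -[n.+1%:R]natr1; ring.
Qed.

Lemma arr_decomp n w : coefr n * (urn_N1 X n w - n%:R * Z (n ^ 2) w) =
  \sum_(0 <= j < n ^ 2) (coefa n j * (X j.+1 type1 w - Z j w) -
    coefb n j * j.+1%:R * dZ j w).
Proof.
have -> : urn_N1 X n w - n%:R * Z (n ^ 2) w =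
  (urn_N1 X n w - n%:R * Z n w) - n%:R * (Z (n ^ 2) w - Z n w) by ring.
rewrite N1_decomp (Z_telescope y0 U X w (leq_sqr n)) (big_cat_nat (leq0n n) (leq_sqr n))/=.
rewrite mulrBr !mulr_sumr -sumrN; congr (_ + _).
  apply: eq_big_nat => j /andP[_ jn].
  by rewrite coefbS (minn_idPl jn) /coefa jn /dZ; ring.
apply: eq_big_nat => j /andP[nj _].
by rewrite coefbS (minn_idPr (leqW nj)) /coefa ltnNge nj /= /dZ; ring.
Qed.

Let arr_DE n j w : D n j w = coefa n j * (X j.+1 type1 w - Z j w) -
  coefb n j * (urn_xi y0 U X j w / m).
Proof. by rewrite /arr_D /urn_xi /urn_step /arr_A (X2E urn) /=; ring. Qed.

Let H j w := m^-1 - j.+1%:R / S j w.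

(** The error of replacing [(j + 1) / S j] by [1 / m]. It is again a martingale difference and is
    summed in mean square; summing the mean absolute values termwise would only give a bounded
    error. *)
Let E n j := urn_step U X j (fun w => coefb n j * ((1 - Z j w) * H j w))
  (fun w => coefb n j * (- Z j w * H j w)) id id.

Let err_decomp n j w :
  (coefa n j * (X j.+1 type1 w - Z j w) - coefb n j * j.+1%:R * dZ j w) - D n j w =
  E n j w - coefb n j * j.+1%:R * (dZ j w - urn_dM y0 U X j w).
Proof.
rewrite arr_DE urn_dME /E /H /urn_step /urn_xi /urn_step /=; ring.
Qed.

Let measF_H j : measF j (H j).
Proof.
apply: measurable_funB; first exact: measurable_cst.
by apply: measurable_funM; [exact: measurable_cst|exact: measF_invS].
Qed.

Let HB j w : `|H j w| <= m^-1 + j.+1%:R / s0.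
Proof.
have sp := S_gt0 urn j w; have s0p := s0_gt0 urn.
apply: le_trans (ler_normB _ _) _; rewrite !ger0_norm ?invr_ge0 ?(ltW m_gt0)//; last first.
  by rewrite divr_ge0// ltW.
by rewrite lerD2l ler_wpM2l// lef_pV2 ?posrE//; exact: S_ge urn _ _.
Qed.

Let p_le (b z h : R) : 0 <= b -> `|z| <= 1 -> `|b * (z * h)| <= `|b * h|.
Proof. by move=> b0 z1; rewrite !normrM ler_wpM2l// ler_piMl. Qed.

Let z1_le j w : `|1 - Z j w| <= 1.
Proof.
by have /andP[z0 z1] := Z_itv urn j w; rewrite ger0_norm ?subr_ge0// gerBl.
Qed.

Let z2_le j w : `|- Z j w| <= 1.
Proof. by have /andP[z0 z1] := Z_itv urn j w; rewrite normrN ger0_norm. Qed.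

Let bHB n j w : `|coefb n j * H j w| <= coefb n j * (m^-1 + j.+1%:R / s0).
Proof. by rewrite normrM ger0_norm ?coefb_ge0// ler_wpM2l ?coefb_ge0. Qed.

Let mEp n j : measF j (fun w => coefb n j * ((1 - Z j w) * H j w)).
Proof.
apply: measurable_funM; first exact: measurable_cst.
apply: measurable_funM; last exact: measF_H.
by apply: measurable_funB; [exact: measurable_cst|exact: measF_Z].
Qed.

Let mEq n j : measF j (fun w => coefb n j * (- Z j w * H j w)).
Proof.
apply: measurable_funM; first exact: measurable_cst.
apply: measurable_funM; last exact: measF_H.
by apply: measurable_funN; exact: measF_Z.
Qed.

Let mid : measurable_fun setT (id : R -> R). Proof. exact: measurable_id. Qed.

Let E_mdiff n : mdiff y0 U X (E n).
Proof.
apply: (@urn_mdiff _ _ _ _ _ _ _ urn _ _ (fun=> id) (fun=> id)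
  (fun j => coefb n j * (m^-1 + j.+1%:R / s0)) (mEp n) (mEq n)) => //.
- by move=> j w; apply: le_trans (p_le (H j w) (coefb_ge0 n j) (z1_le j w)) (bHB n j w).
- by move=> j w; apply: le_trans (p_le (H j w) (coefb_ge0 n j) (z2_le j w)) (bHB n j w).
- move=> j w; rewrite (mean type1) (mean type2) (frac2E urn).
  by rewrite -/(Z j w) /urn_Z; ring.
Qed.

Let tau n : R := \sum_(0 <= j < n ^ 2) coefb n j / j.+1%:R.

Let tau_ge0 n : 0 <= tau n.
Proof. by apply: sumr_ge0 => j _; rewrite divr_ge0// coefb_ge0. Qed.

Let coefr_le1 n : (0 < n)%N -> coefr n <= 1 :> R.
Proof.
move=> n0; rewrite invf_le1 ?sqrtr_gt0 ?ltr0n//.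
by rewrite -[leLHS]sqrtr1 ler_sqrt ?ler0n// ler1n.
Qed.

Lemma measurable_N1 n : measurable_fun setT (urn_N1 X n).
Proof. by apply: measurable_sum => j; exact: measurable_funPT. Qed.

Lemma measurable_W n : measurable_fun setT (W n).
Proof.
apply: (@measF_meas _ _ _ _ y0 U X (n ^ 2)); apply: measF_sum => j.
exact: (measF_arr_D urn m_gt0 mean U_L2).
Qed.

(** The sum of the [E n j] has second moment [O(tau n)], hence mean [O(sqrt (tau n))]; the
    second-order error in the increments of [Z] adds [O(tau n)]. *)
Let arr_err : exists2 K : R, 0 <= K & forall n, (0 < n)%N ->
  L1 P (fun w => `|coefr n * (urn_N1 X n w - n%:R * Z (n ^ 2) w) - W n w|) /\
  Ex P (fun w => `|coefr n * (urn_N1 X n w - n%:R * Z (n ^ 2) w) - W n w|) <=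
    K * (Num.sqrt (tau n) + tau n).
Proof.
have [C C0 hC] := urn_step_bounds urn m_gt0 mean U_L2.
have [C1 C10 hC1] := Ex_ratio_sqr urn m_gt0 mean U_L2.
have q0 : 0 <= q by exact: q_ge0.
pose K := Num.sqrt (C1 * q) + C.
have sK : 0 <= Num.sqrt (C1 * q) by exact: sqrtr_ge0.
exists K => [|n n0]; first by rewrite addr_ge0.
have EE j : Ex P (fun w => E n j w ^+ 2) <= (C1 * q) * (coefb n j / j.+1%:R).
  have mH := measF_meas (@measF_H j).
  have mbH : measurable_fun setT (fun w => coefb n j * H j w) by exact: measurable_funM.
  have := @Ex_urn_step_sqr_le _ _ _ _ _ _ _ urn j _ _ _ _ (coefb n j * (m^-1 + j.+1%:R / s0))
    (@mEp n j) (@mEq n j) mid mid (U_L2 _) (U_L2 _)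
    (fun w => le_trans (p_le (H j w) (coefb_ge0 n j) (z1_le j w)) (bHB n j w))
    (fun w => le_trans (p_le (H j w) (coefb_ge0 n j) (z2_le j w)) (bHB n j w))
    _ mbH (bHB n j) (fun w => p_le (H j w) (coefb_ge0 n j) (z1_le j w))
    (fun w => p_le (H j w) (coefb_ge0 n j) (z2_le j w)).
  move=> h; apply: le_trans h _; rewrite -/q [leRHS](_ : _ = (coefb n j * (C1 / j.+1%:R)) * q); last by ring.
  rewrite ler_wpM2r//.
  have lH : L1 P (fun w => H j w ^+ 2).
    apply: (@L1_bnd _ _ _ P _ ((m^-1 + j.+1%:R / s0) ^+ 2)); first exact: measurable_funX.
    by move=> w; rewrite normrX lerXn2r ?nnegrE// (le_trans _ (HB j w)).
  rewrite (_ : (fun w => (coefb n j * H j w) ^+ 2) = (fun w => coefb n j ^+ 2 * H j w ^+ 2)).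
    rewrite (ExZ _ lH); apply: ler_pM; rewrite ?sqr_ge0//.
    - by apply: Ex_ge0 => w; exact: sqr_ge0.
    (* Since [coefb <= 1], one factor is given away, so that the same [tau n] bounds both errors. *)
    - by rewrite expr2 ler_piMl ?coefb_ge0// (le_trans (coefb_le n j))// coefr_le1.
    - exact: hC1.
  by apply/funext => w; rewrite exprMn.
have [lE EsE] := mdiff_sum 0 (n ^ 2) (E_mdiff n).
have mE : measurable_fun setT (fun w => \sum_(0 <= j < n ^ 2) E n j w).
  apply: (@measF_meas _ _ _ _ y0 U X (n ^ 2)); apply: measF_sum => j.
  by case: (E_mdiff n j).
have lE1 := L1_abs (L1_sqr mE lE).
have lV j : L1 P (fun w => urn_dV y0 U X j w ^+ 2) by case: (hC j).
have lVs : L1 P (fun w => \sum_(0 <= j < n ^ 2) (coefb n j * j.+1%:R) * urn_dV y0 U X j w ^+ 2).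
  by apply: L1_sum => j _; apply: L1Z; exact: lV.
have lB := L1D lE1 lVs.
have b w : `|coefr n * (urn_N1 X n w - n%:R * Z (n ^ 2) w) - W n w| <=
    `|\sum_(0 <= j < n ^ 2) E n j w| +
    \sum_(0 <= j < n ^ 2) (coefb n j * j.+1%:R) * urn_dV y0 U X j w ^+ 2.
  rewrite arr_decomp /arr_W -sumrB; under eq_bigr do rewrite err_decomp.
  rewrite sumrB; apply: le_trans (ler_normB _ _) _; rewrite lerD2l.
  apply: le_trans (ler_norm_sum _ _ _) _; apply: ler_sum => j _.
  have cj : 0 <= coefb n j * j.+1%:R :> R by rewrite mulr_ge0// coefb_ge0.
  rewrite normrM (ger0_norm cj) ler_wpM2l//; exact: (Z_step_dM urn j w).
have mX : measurable_fun setT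
    (fun w => `|coefr n * (urn_N1 X n w - n%:R * Z (n ^ 2) w) - W n w|).
  apply: measurableT_comp => //; apply: measurable_funB; last exact: measurable_W.
  apply: measurable_funM => //; apply: measurable_funB; first exact: measurable_N1.
  by apply: measurable_funM => //; exact: (measurable_Z urn).
split; first by apply: (L1_dom mX lB) => w; rewrite normr_id.
apply: le_trans (Ex_ge0_le mX lB _) _; first by move=> w; rewrite normr_ge0 b.
rewrite (ExD lE1 lVs).
have h1 : Ex P (fun w => `|\sum_(0 <= j < n ^ 2) E n j w|) <= Num.sqrt (C1 * q) * Num.sqrt (tau n).
  apply: (Ex_sqr_le mE lE); first by rewrite mulr_ge0 ?sqrtr_ge0.
  rewrite EsE exprMn !sqr_sqrtr ?mulr_ge0// /tau mulr_sumr.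
  by apply: ler_sum => j _; exact: EE.
have h2 : Ex P (fun w => \sum_(0 <= j < n ^ 2) (coefb n j * j.+1%:R) * urn_dV y0 U X j w ^+ 2) <=
    C * tau n.
  rewrite (Ex_sum _ (fun j _ => L1Z (coefb n j * j.+1%:R) (lV j))) /tau mulr_sumr.
  apply: ler_sum => j _; rewrite (ExZ _ (lV j)); have [_ hj _] := hC j.
  have cj : 0 <= coefb n j * j.+1%:R :> R by rewrite mulr_ge0// coefb_ge0.
  apply: le_trans (ler_wpM2l cj hj) _.
  have : j.+1%:R != 0 :> R by rewrite pnatr_eq0.
  move: (j.+1%:R : R) => x x0.
  by rewrite le_eqVlt; apply/orP; left; apply/eqP; field.
have t0 := tau_ge0 n; have st0 := sqrtr_ge0 (tau n).
apply: le_trans (lerD h1 h2) _; rewrite [leRHS]mulrDr /K; apply: lerD.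
  by apply: ler_wpM2r => //; lra.
by apply: ler_wpM2r => //; lra.
Qed.

Lemma arr_error_cvg : exists2 e : nat -> R, e n @[n --> \oo] --> 0 &
  forall n, (0 < n)%N ->
  L1 P (fun w => `|Num.sqrt n%:R * (urn_N1 X n w / n%:R - Zinf w) - W n w|) /\
  Ex P (fun w => `|Num.sqrt n%:R * (urn_N1 X n w / n%:R - Zinf w) - W n w|) <= e n.
Proof.
have [K K0 hK] := arr_err; have [K1 K10 hK1] := Ex_Zinf_sub urn m_gt0 mean U_L2.
exists (fun n => K * (Num.sqrt (tau n) + tau n) + K1 * coefr n).
  have -> : 0 = K * (Num.sqrt 0 + 0) + K1 * 0 :> R.
    by rewrite sqrtr0 addr0 !mulr0 addr0.
  have ct : tau n @[n --> \oo] --> 0 by exact: sum_coefb_cvg.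
  apply: cvgD; apply: cvgMr; last exact: coefr_cvg.
  apply: cvgD => //; exact: (continuous_cvg _ (@sqrt_continuous R 0) ct).
move=> n n0; have [l1 h1] := hK n n0; have [l2 h2] := hK1 (n ^ 2)%N.
have nR : 0 < n%:R :> R by rewrite ltr0n.
have s0' : 0 < Num.sqrt n%:R :> R by rewrite sqrtr_gt0.
have ss : Num.sqrt n%:R ^+ 2 = n%:R :> R by rewrite sqr_sqrtr.
have l3 := L1Z (Num.sqrt n%:R) l2; have lB := L1D l1 l3.
have mX : measurable_fun setT
    (fun w => `|Num.sqrt n%:R * (urn_N1 X n w / n%:R - Zinf w) - W n w|).
  apply: measurableT_comp => //; apply: measurable_funB; last exact: measurable_W.
  apply: measurable_funM => //; apply: measurable_funB; last exact: (measurable_Zinf urn).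
  by apply: measurable_funM => //; exact: measurable_N1.
have b w : `|Num.sqrt n%:R * (urn_N1 X n w / n%:R - Zinf w) - W n w| <=
    `|coefr n * (urn_N1 X n w - n%:R * Z (n ^ 2) w) - W n w| +
    Num.sqrt n%:R * `|Zinf w - Z (n ^ 2) w|.
  have -> : Num.sqrt n%:R * (urn_N1 X n w / n%:R - Zinf w) - W n w =
     (coefr n * (urn_N1 X n w - n%:R * Z (n ^ 2) w) - W n w) -
     Num.sqrt n%:R * (Zinf w - Z (n ^ 2) w).
    have : Num.sqrt n%:R != 0 :> R by rewrite gt_eqF.
    by rewrite /coefr; move: (Num.sqrt _) ss => s <- sn0; field.
  by apply: le_trans (ler_normB _ _) _; rewrite [`|Num.sqrt _ * _|]normrM (ger0_norm (ltW s0')).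
split; first by apply: (L1_dom mX lB) => w; rewrite normr_id.
apply: le_trans (Ex_ge0_le mX lB _) _; first by move=> w; rewrite normr_ge0 b.
rewrite (ExD l1 l3) (ExZ _ l2) lerD//.
apply: le_trans (ler_wpM2l (ltW s0') h2) _; rewrite mulrCA ler_wpM2l//.
rewrite /coefr ler_pdivrMr ?sqrtr_gt0//.
(* The factor [sqrt n] meets the rate [1 / n] of [Ex_Zinf_sub] at time [n ^ 2]. *)
have hn : n%:R <= Num.sqrt (n ^ 2).+1%:R :> R.
  rewrite -[leLHS]ger0_norm// -sqrtr_sqr ler_sqrt//.
  by rewrite -natrX ler_nat.
rewrite mulrC ler_pdivlMr//; apply: le_trans hn; by rewrite -expr2 ss.
Qed.

End urn_array_error.

(** * Comparison of weighted expectations *)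

Section weighted_difference.
Context {R : realType} {d : measure_display} {T : measurableType d}.
Variables (P : probability T R) (g : T -> R) (B : R).
Hypotheses (mg : measurable_fun setT g) (gB : forall w, `|g w| <= B).

Lemma weight_ge0 : 0 <= B.
Proof. exact: le_trans (normr_ge0 _) (Ex_abs_bnd P mg gB). Qed.

Lemma Ex_weight_le (F H G : T -> R) (C : R) :
  measurable_fun setT F -> measurable_fun setT H ->
  (forall w, `|F w| <= C) -> (forall w, `|H w| <= C) -> L1 P G ->
  (forall w, `|F w - H w| <= G w) ->
  `|Ex P (fun w => g w * F w) - Ex P (fun w => g w * H w)| <= B * Ex P G.
Proof.
move=> mF mH FC HC lG FHG.
have lF := L1M_bnd mg gB (L1_bnd P mF FC); have lH := L1M_bnd mg gB (L1_bnd P mH HC).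
rewrite -(ExB lF lH) -(ExZ _ lG); apply: Ex_abs_le.
- by apply: measurable_funB; exact: measurable_funM.
- exact: L1Z.
- by move=> w; rewrite -mulrBr normrM ler_pM.
Qed.

End weighted_difference.

(** * Comparison of the array with a normal mixture *)

Section urn_array_limit.
Context {R : realType} {d : measure_display} {T : measurableType d}.
Variables (P : probability T R) (y0 : 'I_2 -> R) (U X : nat -> 'I_2 -> {RV P >-> R}).
Hypothesis urn : reinforced_urn y0 U X.
Variable m : R.
Hypotheses (m_gt0 : 0 < m) (mean : forall k, Ex P (fun w => U 1%N k w) = m)
  (U_L2 : forall k, L1 P (fun w => U 1%N k w ^+ 2)).

Local Notation Z := (urn_Z y0 U X).
Local Notation Zinf := (urn_Zinf y0 U X).
Local Notation measF m := (meas_wrt (urn_gens y0 U X m)).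
Local Notation D := (arr_D y0 U X m).
Local Notation W := (arr_W y0 U X m).
Local Notation lam := (arr_lam U m).
Local Notation A := (arr_K U m).
Local Notation h2 := (arr_h2 U m).
Local Notation v := (arr_v U m).

Variables (f f1 f2 : R -> R) (C : R).
Hypothesis sm : smooth3 f f1 f2 C.

Let C0 : 0 <= C := smooth3_C0 sm.

Let A0 : 0 <= A := arr_K_ge0 m_gt0 mean U_L2.

Let cf : continuous f. Proof. by case: (smooth3_cont sm). Qed.

Let mf : measurable_fun setT f. Proof. exact: continuous_measurable_fun. Qed.

Let mdD n j : measurable_fun setT (D n j).
Proof. exact: measF_meas (@measF_arr_D _ _ _ _ _ _ _ urn _ m_gt0 mean U_L2 n j). Qed.

Let mv n j : measurable_fun setT (v n j).
Proof.
apply: continuous_measurable_fun => z; rewrite /arr_v.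
apply: cvgM; first by apply: cvgM; [exact: cvg_id|apply: cvgB; [exact: cvg_cst|exact: cvg_id]].
apply: cvgD; apply: cvgM; try exact: cvg_cst; last exact: cvg_id.
by apply: cvgB; [exact: cvg_cst|exact: cvg_id].
Qed.

Let measF_vZ n j k : measF k (fun w => v n j (Z k w)).
Proof. exact: meas_wrt_comp (mv n j) (@measF_Z _ _ _ _ _ _ _ urn k). Qed.

Let gC s x : `|gsmooth f s x| <= C.
Proof. by apply: gsmooth_bnd => // y; exact: smooth3_b0 sm _. Qed.

Let coefr_le1 n : coefr n <= 1 :> R.
Proof.
case: n => [|n]; first by rewrite /coefr sqrtr0 invr0.
rewrite /coefr invf_le1 ?sqrtr_gt0 ?ltr0n//.
by rewrite -[leLHS]sqrtr1 ler_sqrt ?ler0n// ler1n.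
Qed.

(** Three comparisons: drop the first [k] differences ([t1]), replace the others with variances
    frozen at [Z k] ([t2]), pass from the summed frozen variance to [h2 Zinf] ([t3]). Freezing costs
    [M * coefr k.+1], where [M] depends neither on [k] nor on [g]; the rest vanishes for fixed
    [k]. *)
Lemma arr_W_limit : exists2 M : R, 0 <= M & forall k B (g : T -> R), measF k g ->
  (forall w, `|g w| <= B) -> exists2 e : nat -> R, e n @[n --> \oo] --> 0 &
  forall n, (0 < n)%N -> (k <= n)%N ->
  `|Ex P (fun w => g w * f (W n w)) -
    Ex P (fun w => g w * gsmooth f (h2 (Zinf w)) 0)| <= B * (M * coefr k.+1 + e n).
Proof.
have [K1 K10 heat] := @gsmooth_heat R; have [K2 K20 vlip] := @gsmooth_var_lip R.
have [Kz Kz0 hKz] := Ex_Z_sub urn m_gt0 mean U_L2.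
have [Ki Ki0 hKi] := Ex_Zinf_sub urn m_gt0 mean U_L2.
pose L := K2 * C * (1 + 3 * A).
have L0 : 0 <= L by rewrite /L; apply: mulr_ge0; [exact: mulr_ge0|rewrite addr_ge0// mulr_ge0].
exists (C * 8 * A * Kz * 3 + L * (8 * A) * Ki) => [|k B g mg gB].
  by apply: addr_ge0; do !(apply: mulr_ge0 => //).
have mgT := measF_meas mg; have B0 : 0 <= B := weight_ge0 P mgT gB.
pose e n : R := C * Num.sqrt (A * k%:R) * coefr n + 6 * C * lam n +
  3 * K1 * C * (A * Num.sqrt A) * coefr n + L * A * ((k%:R + 2) / n%:R).
exists e.
  have -> : 0 = C * Num.sqrt (A * k%:R) * 0 + 6 * C * 0 +
    3 * K1 * C * (A * Num.sqrt A) * 0 + L * A * 0 :> R by rewrite !mulr0 !addr0.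
  have cr := @coefr_cvg R; have cl := arr_lam_cvg m_gt0 U_L2.
  apply: cvgD; last first.
    apply: cvgMr; apply: (@cvg0_le _ _ (fun n => ((k%:R + 2) * coefr n)) 1%N).
      move=> n n0; have nR : 0 < n%:R :> R by rewrite ltr0n.
      rewrite ger0_norm ?divr_ge0 ?addr_ge0// ler_wpM2l ?addr_ge0//.
      rewrite -[leLHS]coefr_sqr expr2 ler_piMl ?coefr_ge0//.
    have h : ((k%:R + 2) * coefr n : R) @[n --> \oo] --> ((k%:R + 2) * 0 : R).
      by apply: cvgMr.
    by move: h; rewrite mulr0.
  by apply: cvgD; [apply: cvgD|]; apply: cvgMr.
move=> n n0 kn; have kn2 : (k <= n ^ 2)%N := leq_trans kn (leq_sqr n).
have zi j w : 0 <= Z j w <= 1 := Z_itv urn j w.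
have zii w : 0 <= Zinf w <= 1 := Zinf_itv urn w.
pose V w := \sum_(k <= j < n ^ 2) D n j w.
have mV : measurable_fun setT V by apply: measurable_sum => j; exact: mdD.
have mH : measurable_fun setT (fun w => \sum_(0 <= j < k) D n j w).
  by apply: measurable_sum => j; exact: mdD.
pose c j : R := A * coefb n j ^+ 2.
have c0 j : 0 <= c j by rewrite mulr_ge0 ?sqr_ge0.
have sumc : \sum_(k <= j < n ^ 2) coefb n j ^+ 2 <= 3 :> R.
  apply: le_trans (@sum_coefb_sqr R n); rewrite (big_cat_nat (leq0n k) kn2)/=.
  by rewrite lerDr; apply: sumr_ge0 => j _; exact: sqr_ge0.
pose u w := \sum_(k <= j < n ^ 2) v n j (Z k w).
have u3 w : 0 <= u w <= 3 * A.
  apply/andP; split; first by apply: sumr_ge0 => j _; case/andP: (arr_v_bnd m_gt0 mean U_L2 n j (zi k w)).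
  apply: (@le_trans _ _ (\sum_(k <= j < n ^ 2) c j)).
    by apply: ler_sum => j _; case/andP: (arr_v_bnd m_gt0 mean U_L2 n j (zi k w)).
  by rewrite -mulr_sumr mulrC ler_wpM2r.
have mu : measurable_fun setT u.
  by apply: measurable_sum => j; exact: measF_meas (@measF_vZ n j k).
have h3 z : 0 <= z <= 1 -> 0 <= h2 z <= 3 * A.
  move=> /(arr_h2_bnd m_gt0 mean U_L2)/andP[h0 h1]; rewrite h0/=; apply: le_trans h1 _.
  by rewrite ler_peMl//; lra.
have mfW : measurable_fun setT (fun w => f (W n w)).
  by apply: measurableT_comp => //; exact: (measurable_W urn m_gt0 mean U_L2).
have mfV : measurable_fun setT (fun w => f (V w)) by exact: measurableT_comp.
have mZ j := measurable_Z urn j; have mZi := measurable_Zinf urn.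
have mgu : measurable_fun setT (fun w => gsmooth f (u w) 0).
  have mFu : measF k u by apply: measurable_sum => j; exact: measF_vZ.
  have mF0 : measF k (fun=> 0 : R) by exact: measurable_cst.
  exact: (measF_meas (meas_wrt_gsmooth cf (smooth3_b0 sm) mFu mF0)).
have mgi : measurable_fun setT (fun w => gsmooth f (h2 (Zinf w)) 0).
  apply: (measurable_gsmooth cf (smooth3_b0 sm)); last exact: measurable_cst.
  exact: (measurableT_comp (measurable_arr_h2 U m)).
have t1 : `|Ex P (fun w => g w * f (W n w)) - Ex P (fun w => g w * f (V w))| <=
    B * (C * Num.sqrt (A * k%:R) * coefr n).
  have lH : L1 P (fun w => `|\sum_(0 <= j < k) D n j w|).
    have [l _] := mdiff_sum 0 k (arr_D_mdiff urn m_gt0 mean U_L2 n).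
    by apply: L1_abs; exact: L1_sqr.
  apply: le_trans (Ex_weight_le mgT gB mfW mfV (fun w => smooth3_b0 sm _)
    (fun w => smooth3_b0 sm _) (L1Z C lH) _) _.
    move=> w; apply: le_trans (smooth3_lip0 sm _ _) _; rewrite ler_wpM2l//.
    by rewrite /arr_W /V (big_cat_nat (leq0n k) kn2)/= addrK.
  rewrite ler_wpM2l// (ExZ _ lH) -mulrA ler_wpM2l//.
  exact: (arr_head_sqr urn m_gt0 mean U_L2).
have t2 : `|Ex P (fun w => g w * f (V w)) - Ex P (fun w => g w * gsmooth f (u w) 0)| <=
    B * (C * 8 * A * Kz * 3 * coefr k.+1 + 6 * C * lam n +
      3 * K1 * C * (A * Num.sqrt A) * coefr n).
  have vc j w : `|v n j (Z j w)| <= c j.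
    by have /andP[a b] := arr_v_bnd m_gt0 mean U_L2 n j (zi j w); rewrite ger0_norm.
  have := lindeberg (gens := urn_gens y0 U X) (fun n => @urn_gens_sub _ _ _ _ y0 U X n)
    (fun a b => @urn_gens_mono _ _ _ _ y0 U X a b) sm K10 (heat _ _ _ _ sm)
    (fun j => @measF_arr_D _ _ _ _ _ _ _ urn _ m_gt0 mean U_L2 n j)
    (arr_D_L2 urn m_gt0 mean U_L2 n) (arr_D0 urn m_gt0 mean U_L2 n)
    (arr_D2 urn m_gt0 mean U_L2 n) (fun j => measurableT_comp (mv n j) (mZ j)) vc
    (fun j => @measF_vZ n j k) (fun j w => arr_v_bnd m_gt0 mean U_L2 n j (zi k w))
    mg gB kn2.
  move=> h; apply: le_trans h _.
  apply: (@le_trans _ _ (\sum_(k <= j < n ^ 2) B * (2 * C * lam n +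
      C * 8 * A * Kz * coefr k.+1 + K1 * C * (A * Num.sqrt A) * coefr n) * coefb n j ^+ 2)).
    rewrite big_nat_cond [leRHS]big_nat_cond; apply: ler_sum => j /andP[/andP[kj _] _].
    rewrite -[leRHS]mulrA ler_wpM2l// [leRHS]mulrDl [X in _ <= X + _]mulrDl.
    apply: lerD; [apply: lerD|].
    - rewrite -[leRHS]mulrA ler_wpM2l ?mulr_ge0//.
      exact: (arr_min urn m_gt0 mean U_L2).
    (* The cost of freezing: [arr_v] is Lipschitz in [z], and [Z j] stays within [O(k^(-1/2))] of
       [Z k] in mean. The factors [coefb n j ^+ 2] are summable with total at most 3. *)
    - rewrite [leRHS](_ : _ = C * (8 * c j * (Kz * coefr k.+1))); last by rewrite /c; ring.
      rewrite ler_wpM2l//.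
      have lz : L1 P (fun w => `|Z j w - Z k w|).
        apply: (@L1_bnd _ _ _ P _ 1); first by apply: measurableT_comp => //; exact: measurable_funB.
        move=> w; rewrite normr_id ler_norml.
        by have /andP[a b] := zi j w; have /andP[a' b'] := zi k w; apply/andP; split; lra.
      apply: (@le_trans _ _ (Ex P (fun w => 8 * c j * `|Z j w - Z k w|))).
        apply: Ex_ge0_le; [|exact: L1Z|].
          apply: measurableT_comp => //; apply: measurable_funB.
            exact: measurableT_comp (mv n j) (mZ j).
          exact: measurableT_comp (mv n j) (mZ k).
        by move=> w; rewrite normr_ge0/=; exact: (arr_v_lip m_gt0 mean U_L2).
      rewrite (ExZ _ lz); apply: ler_wpM2l; first by rewrite mulr_ge0.
      exact: hKz.
    - rewrite [leRHS](_ : _ = K1 * C * (c j * (Num.sqrt A * coefr n))); last by rewrite /c; ring.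
      apply: ler_wpM2l; first exact: mulr_ge0.
      apply: ler_wpM2l => //; rewrite /c sqrtrM// ler_wpM2l ?sqrtr_ge0//.
      by rewrite sqrtr_sqr ger0_norm ?coefb_ge0// coefb_le.
  rewrite -mulr_sumr -[leLHS]mulrA ler_wpM2l//.
  apply: (@le_trans _ _ ((2 * C * lam n +
      C * 8 * A * Kz * coefr k.+1 + K1 * C * (A * Num.sqrt A) * coefr n) * 3)); last first.
    by rewrite le_eqVlt; apply/orP; left; apply/eqP; ring.
  apply: ler_wpM2l => //.
  have l0 : 0 <= lam n.
    apply: sumr_ge0 => i _; apply: Ex_ge0 => w; rewrite mulr_ge0 ?sqr_ge0//.
    by rewrite le_min ler01 mulr_ge0 ?coefr_ge0 ?addr_ge0 ?divr_ge0// ltW.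
  have k0 : 0 <= coefr k.+1 :> R by exact: coefr_ge0.
  have n0' : 0 <= coefr n :> R by exact: coefr_ge0.
  have sA : 0 <= Num.sqrt A by exact: sqrtr_ge0.
  by apply: addr_ge0; [apply: addr_ge0|]; do !(apply: mulr_ge0 => //).
have t3 : `|Ex P (fun w => g w * gsmooth f (u w) 0) -
     Ex P (fun w => g w * gsmooth f (h2 (Zinf w)) 0)| <=
    B * (L * A * ((k%:R + 2) / n%:R) + L * (8 * A) * Ki * coefr k.+1).
  have [lz hz] := hKi k.
  apply: le_trans (Ex_weight_le mgT gB mgu mgi (fun w => gC _ _)
    (fun w => gC _ _) (L1D (L1_cst P (L * A * ((k%:R + 2) / n%:R))) (L1Z (L * (8 * A)) lz)) _) _.
    move=> w; apply: le_trans (vlip _ _ _ _ _ sm _ _ _ (u3 w) (h3 _ (zii w))) _.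
    rewrite -/L [leRHS](_ : _ = L * (A * ((k%:R + 2) / n%:R) +
      8 * A * `|Zinf w - Z k w|)); last by ring.
    rewrite ler_wpM2l//.
    have -> : u w - h2 (Zinf w) = (u w - h2 (Z k w)) - (h2 (Zinf w) - h2 (Z k w)) by ring.
    apply: le_trans (ler_normB _ _) _; apply: lerD.
      exact: (arr_v_sum m_gt0 mean U_L2 n0 kn (zi k w)).
    exact: (arr_h2_lip m_gt0 mean U_L2).
  rewrite (ExD (L1_cst P _) (L1Z _ lz)) Ex_cst (ExZ _ lz) ler_wpM2l// lerD2l.
  rewrite -[leRHS]mulrA ler_wpM2l//.
  by do !(apply: mulr_ge0 => //).
apply: le_trans (ler_distD (Ex P (fun w => g w * f (V w))) _ _) _.
apply: le_trans (lerD t1 (le_trans (ler_distD _ _ _) (lerD t2 t3))) _.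
clear t1 t2 t3; rewrite /e; move: (coefr k.+1) (coefr n) (lam n) (Num.sqrt _) => r1 r2 r3 r4.
by rewrite le_eqVlt; apply/orP; left; apply/eqP; ring.
Qed.

End urn_array_limit.

Lemma cvg0_ex (R : realType) (u : nat -> R) (e : R) : u n @[n --> \oo] --> 0 -> 0 < e ->
  exists N, forall n, (N <= n)%N -> `|u n| <= e.
Proof.
move=> /cvgrPdist_le cu e0; have [N _ hN] := cu e e0.
by exists N => n Nn; have := hN n Nn; rewrite /= sub0r normrN.
Qed.

Lemma cvg_ex (R : realType) (u : nat -> R) (l : R) :
  (forall e, 0 < e -> exists N, forall n, (N <= n)%N -> `|u n - l| <= e) ->
  u n @[n --> \oo] --> l.
Proof.
move=> h; apply/cvgrPdist_le => e e0; have [N hN] := h e e0.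
by exists N => // n /= /hN; rewrite distrC.
Qed.

(** * Stable limit for smooth test functions *)

Section urn_smooth_limit.
Context {R : realType} {d : measure_display} {T : measurableType d}.
Variables (P : probability T R) (y0 : 'I_2 -> R) (U X : nat -> 'I_2 -> {RV P >-> R}).
Hypothesis urn : reinforced_urn y0 U X.
Variable m : R.
Hypotheses (m_gt0 : 0 < m) (mean : forall k, Ex P (fun w => U 1%N k w) = m)
  (U_L2 : forall k, L1 P (fun w => U 1%N k w ^+ 2)).

Local Notation Z := (urn_Z y0 U X).
Local Notation Zinf := (urn_Zinf y0 U X).
Local Notation measF m := (meas_wrt (urn_gens y0 U X m)).
Local Notation W := (arr_W y0 U X m).
Local Notation A := (arr_K U m).
Local Notation h2 := (arr_h2 U m).
Local Notation xi n w := (Num.sqrt n%:R * (urn_N1 X n w / n%:R - Zinf w)).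

Let A0 : 0 <= A := arr_K_ge0 m_gt0 mean U_L2.

Lemma measurable_xi n : measurable_fun setT (fun w => xi n w).
Proof.
apply: measurable_funM; first exact: measurable_cst.
apply: measurable_funB; last exact: (measurable_Zinf urn).
by apply: measurable_funM; [exact: measurable_N1|exact: measurable_cst].
Qed.

(** The indicator of [E] is replaced by a weight [g] on both sides. The residual is nearly
    orthogonal to [f (W n)], known at time [n ^ 2], and to the limit with [Zinf] replaced by [Z k];
    for [g] itself [arr_W_limit] applies. *)
Lemma smooth_limit (f f1 f2 : R -> R) (C : R) (E : set T) :
  smooth3 f f1 f2 C -> measurable E ->
  Ex P (fun w => \1_E w * f (xi n w)) @[n --> \oo] -->
  Ex P (fun w => \1_E w * gsmooth f (h2 (Zinf w)) 0).
Proof.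
move=> sm mE; have C0 : 0 <= C := smooth3_C0 sm.
have [cf _ _] := smooth3_cont sm.
have mf : measurable_fun setT f by exact: continuous_measurable_fun.
have [M M0 hM] := arr_W_limit urn m_gt0 mean U_L2 sm.
have [K2 K20 vlip] := @gsmooth_var_lip R.
have [Ki Ki0 hKi] := Ex_Zinf_sub urn m_gt0 mean U_L2.
have [err cerr herr] := arr_error_cvg urn m_gt0 mean U_L2.
pose L := K2 * C * (1 + A) * (8 * A).
have L0 : 0 <= L by rewrite /L; do !(apply: mulr_ge0 => //); rewrite addr_ge0.
have gC s x : `|gsmooth f s x| <= C by apply: gsmooth_bnd => // y; exact: smooth3_b0 sm _.
have mZi := measurable_Zinf urn; have mh2 := measurable_arr_h2 U m.
pose Phi w := gsmooth f (h2 (Zinf w)) 0.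
have mPhi : measurable_fun setT Phi := 
  measurable_gsmooth cf (smooth3_b0 sm) (measurableT_comp mh2 mZi) (measurable_cst _).
have m1 : measurable_fun setT (\1_E : T -> R) by exact: measurable_indic.
have b1 w : `|\1_E w : R| <= 1 by rewrite indicE; case: (w \in E); rewrite ?normr0 ?normr1.
have mfx n : measurable_fun setT (fun w => f (xi n w)).
  by apply: measurableT_comp => //; exact: measurable_xi.
have mfW n : measurable_fun setT (fun w => f (W n w)).
  by apply: measurableT_comp => //; exact: (measurable_W urn m_gt0 mean U_L2).
apply: cvg_ex => e e0.
have C'0 : 0 < C + 1 by rewrite ltr_wpDl.
have e10 : 0 < e / 8 / (C + 1) by rewrite !divr_gt0.
have [k0 [g [B [mg gB hg]]]] := approx_indicator P
  (fun n => @urn_gens_sub _ _ _ _ y0 U X n) (fun a b => @urn_gens_mono _ _ _ _ y0 U X a b) mE e10.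
have e1C : e / 8 / (C + 1) * (C + 1) = e / 8 by rewrite divfK// gt_eqF.
have mgT := measF_meas mg; have B0 : 0 <= B := weight_ge0 P mgT gB.
have [k1 hk1] : exists k1, forall k, (k1 <= k)%N ->
    `|(B * M + (1 + B) * L * Ki) * coefr k| <= e / 4.
  apply: cvg0_ex; last by rewrite divr_gt0.
  have -> : 0 = (B * M + (1 + B) * L * Ki) * 0 :> R by rewrite mulr0.
  by apply: cvgMr; exact: coefr_cvg.
(* Late enough for [g] to be known and for the errors that do not vanish with [n] to be small; [n]
   is chosen after [k]. *)
pose k := maxn k0 k1; have k0k : (k0 <= k)%N by rewrite leq_maxl.
have mgk : measF k g by exact: measF_mono mg.
have [ek cek hek] := hM k B g mgk gB.
have [n1 hn1] : exists N, forall n, (N <= n)%N -> `|C * err n| <= e / 8.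
  apply: cvg0_ex; last by rewrite divr_gt0.
  have -> : 0 = C * 0 :> R by rewrite mulr0.
  by apply: cvgMr.
have [n2 hn2] : exists N, forall n, (N <= n)%N -> `|B * ek n| <= e / 8.
  apply: cvg0_ex; last by rewrite divr_gt0.
  have -> : 0 = B * 0 :> R by rewrite mulr0.
  by apply: cvgMr.
have mdf : measurable_fun setT (fun w => \1_E w - g w) by exact: measurable_funB.
have bdf w : `|\1_E w - g w| <= 1 + B by exact: le_trans (ler_normB _ _) (lerD (b1 w) (gB w)).
exists (maxn (maxn n1 n2) k.+1) => n; rewrite !geq_max => /andP[/andP[n1n n2n] kn].
have n0 : (0 < n)%N by exact: leq_ltn_trans kn.
have t1 : `|Ex P (fun w => \1_E w * f (xi n w)) - Ex P (fun w => \1_E w * f (W n w))| <= e / 8.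
  have [lX hX] := herr n n0.
  apply: le_trans (Ex_weight_le m1 b1 (mfx n) (mfW n) (fun w => smooth3_b0 sm _)
    (fun w => smooth3_b0 sm _) (L1Z C lX) (fun w => smooth3_lip0 sm _ _)) _.
  rewrite mul1r (ExZ _ lX); apply: le_trans (le_trans (ler_norm _) (hn1 n n1n)).
  by rewrite ler_wpM2l.
have split_g (F : T -> R) : measurable_fun setT F -> (forall w, `|F w| <= C) ->
    Ex P (fun w => \1_E w * F w) = Ex P (fun w => (\1_E w - g w) * F w) + Ex P (fun w => g w * F w).
  move=> mF FC; have lF := L1_bnd P mF FC.
  rewrite -(ExD (L1M_bnd mdf bdf lF) (L1M_bnd mgT gB lF)); congr Ex; apply/funext => w.
  by rewrite -mulrDl subrK.
have t2 : `|Ex P (fun w => (\1_E w - g w) * f (W n w))| <= e / 8.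
  rewrite -e1C; apply: (hg (n ^ 2)%N) => //.
    apply: meas_wrt_comp => //; apply: measF_sum => j.
    exact: (measF_arr_D urn m_gt0 mean U_L2).
  by move=> w; rewrite (le_trans (smooth3_b0 sm _))// lerDl.
have t3 := hek n n0 (ltnW kn).
have t4 : `|Ex P (fun w => (\1_E w - g w) * Phi w)| <= e / 8 + (1 + B) * (L * Ki * coefr k.+1).
  (* [Phi] depends on [Zinf], which is not observed at a finite time, so [Z k] takes its place
     before orthogonality is used. *)
  pose h w := gsmooth f (h2 (Z k w)) 0.
  have mh : measurable_fun setT h := 
    measurable_gsmooth cf (smooth3_b0 sm) (measurableT_comp mh2 (measurable_Z urn k)) (measurable_cst _).
  have [lZ hZ] := hKi k.
  have q1 : `|Ex P (fun w => (\1_E w - g w) * h w)| <= e / 8.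
    rewrite -e1C; apply: (hg k) => //; last by move=> w; rewrite (le_trans (gC _ _))// lerDl.
    have mFh : measF k (fun w => h2 (Z k w)).
      exact: meas_wrt_comp mh2 (@measF_Z _ _ _ _ _ _ _ urn k).
    have mF0 : measF k (fun=> 0 : R) by exact: measurable_cst.
    exact: (meas_wrt_gsmooth cf (smooth3_b0 sm) mFh mF0).
  have q2 : `|Ex P (fun w => (\1_E w - g w) * Phi w) - Ex P (fun w => (\1_E w - g w) * h w)| <=
      (1 + B) * (L * Ki * coefr k.+1).
    apply: le_trans (Ex_weight_le mdf bdf mPhi mh (fun w => gC _ _) (fun w => gC _ _)
      (L1Z L lZ) _) _.
      move=> w; apply: le_trans (vlip _ _ _ _ _ sm _ _ _ (arr_h2_bnd m_gt0 mean U_L2 (Zinf_itv urn w))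
        (arr_h2_bnd m_gt0 mean U_L2 (Z_itv urn k w))) _.
      rewrite /L -[leRHS]mulrA ler_wpM2l//; first by do !(apply: mulr_ge0 => //); rewrite addr_ge0.
      exact: (arr_h2_lip m_gt0 mean U_L2 (Zinf_itv urn w) (Z_itv urn k w)).
    by rewrite ler_wpM2l ?addr_ge0// (ExZ _ lZ) -mulrA ler_wpM2l.
  by rewrite -[Ex _ _](subrK (Ex P (fun w => (\1_E w - g w) * h w))) addrC
    (le_trans (ler_normD _ _))// lerD.
have t5 := le_trans (ler_norm _) (hk1 k.+1 (leq_trans (leq_maxr _ _) (leqnSn _))).
have t6 := le_trans (ler_norm _) (hn2 n n2n).
apply: le_trans (ler_distD (Ex P (fun w => \1_E w * f (W n w))) _ _) _.
rewrite (split_g _ (mfW n) (fun w => smooth3_b0 sm _)) (split_g _ mPhi (fun w => gC _ _)).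
move: t1; rewrite (split_g _ (mfW n) (fun w => smooth3_b0 sm _)) => t1.
move: (Ex P (fun w => g w * f (W n w))) (Ex P (fun w => g w * Phi w))
  (Ex P (fun w => (\1_E w - g w) * f (W n w))) (Ex P (fun w => (\1_E w - g w) * Phi w))
  (Ex P (fun w => \1_E w * f (xi n w))) t1 t2 t3 t4 => x1 x2 x3 x4 x5 t1 t2 t3 t4.
apply: le_trans (lerD t1 (lexx _)) _.
rewrite (_ : x3 + x1 - (x4 + x2) = x3 + ((x1 - x2) - x4)); last by ring.
apply: le_trans (lerD (lexx _) (le_trans (ler_normD _ _) (lerD t2 (le_trans (ler_normB _ _) (lerD t3 t4))))) _.
rewrite [leLHS](_ : _ = e / 8 * 3 + (B * M + (1 + B) * L * Ki) * coefr k.+1 + B * ek n); last by ring.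
apply: le_trans (lerD (lerD (lexx _) t5) t6) _.
by rewrite -subr_ge0 [leRHS](_ : _ = e / 4) ?divr_ge0 ?ltW//; field.
Qed.

End urn_smooth_limit.

(** * Stable limit for bounded continuous test functions *)

Section urn_continuous_limit.
Context {R : realType} {d : measure_display} {T : measurableType d}.
Variables (P : probability T R) (y0 : 'I_2 -> R) (U X : nat -> 'I_2 -> {RV P >-> R}).
Hypothesis urn : reinforced_urn y0 U X.
Variable m : R.
Hypotheses (m_gt0 : 0 < m) (mean : forall k, Ex P (fun w => U 1%N k w) = m)
  (U_L2 : forall k, L1 P (fun w => U 1%N k w ^+ 2)).

Local Notation Zinf := (urn_Zinf y0 U X).
Local Notation W := (arr_W y0 U X m).
Local Notation A := (arr_K U m).
Local Notation h2 := (arr_h2 U m).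
Local Notation xi n w := (Num.sqrt n%:R * (urn_N1 X n w / n%:R - Zinf w)).
Local Notation gam := (normal_prob 0 1 : probability (measurableTypeR R) R).

(** A first moment bounded in [n], against which the error [e (1 + |x|)] of [smooth3_approx] is
    integrated; it plays the part of tightness. *)
Let Ex_xi_abs : exists N, forall n, (N <= n)%N ->
  L1 P (fun w => `|xi n w|) /\ Ex P (fun w => `|xi n w|) <= Num.sqrt (3 * A) + 1.
Proof.
have A0 : 0 <= A := arr_K_ge0 m_gt0 mean U_L2.
have [err cerr herr] := arr_error_cvg urn m_gt0 mean U_L2.
have [N hN] := cvg0_ex cerr ltr01.
exists N.+1 => n Nn; have n0 : (0 < n)%N by exact: leq_ltn_trans Nn.
have [l h] := herr n n0; have [lW hW] := arr_W_L2 urn m_gt0 mean U_L2 n.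
have mW := measurable_W urn m_gt0 mean U_L2 n.
have lW1 := L1_abs (L1_sqr mW lW).
have mx : measurable_fun setT (fun w => `|xi n w|).
  by apply: measurableT_comp => //; exact: measurable_xi.
have b w : `|xi n w| <= `|W n w| + `|xi n w - W n w|.
  by rewrite -[X in `|X| <= _](subrKC (W n w)) ler_normD.
split; first by apply: (L1_dom mx (L1D lW1 l)) => w; rewrite normr_id.
apply: le_trans (Ex_ge0_le mx (L1D lW1 l) _) _; first by move=> w; rewrite normr_ge0 b.
rewrite (ExD lW1 l); apply: lerD; last first.
  by apply: le_trans h (le_trans (ler_norm _) (hN n (ltnW Nn))).
by apply: (Ex_sqr_le mW lW); rewrite ?sqrtr_ge0// sqr_sqrtr// mulr_ge0.
Qed.

Lemma continuous_limit (f : R -> R) (M : R) (E : set T) :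
  continuous f -> (forall x, `|f x| <= M) -> measurable E ->
  Ex P (fun w => \1_E w * f (xi n w)) @[n --> \oo] -->
  Ex P (fun w => \1_E w * gsmooth f (h2 (Zinf w)) 0).
Proof.
move=> cf fM mE; have A0 : 0 <= A := arr_K_ge0 m_gt0 mean U_L2.
have [l1 _ _ _] := @normal_moments R.
have [N1 hN1] := Ex_xi_abs.
pose a := Ex gam (fun y => `|y|).
have a0 : 0 <= a by apply: Ex_ge0.
(* Bounds the mean of [1 + |x|] under the law of [xi n] plus that under the limit, a normal mixture
   of variance at most [A]. *)
pose K := (1 + (Num.sqrt (3 * A) + 1)) + (1 + Num.sqrt A * a).
have sA : 0 <= Num.sqrt A by exact: sqrtr_ge0.
have K0 : 0 < K.
  by rewrite /K; have := sqrtr_ge0 (3 * A); have := mulr_ge0 sA a0; lra.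
have m1 : measurable_fun setT (\1_E : T -> R) by exact: measurable_indic.
have b1 w : `|\1_E w : R| <= 1 by rewrite indicE; case: (w \in E); rewrite ?normr0 ?normr1.
have mZi := measurable_Zinf urn; have mh2 := measurable_arr_h2 U m.
have mhZ : measurable_fun setT (fun w => h2 (Zinf w)) by exact: (measurableT_comp mh2).
have m0 : measurable_fun setT ((fun=> 0) : T -> R) by exact: measurable_cst.
apply: cvg_ex => e e0.
have e10 : 0 < e / 2 / K by rewrite !divr_gt0.
have [F [f1 [f2 [C [sm fF]]]]] := smooth3_approx cf fM e10.
have C0 := smooth3_C0 sm; have [cF _ _] := smooth3_cont sm.
have M0 : 0 <= M by exact: le_trans (normr_ge0 _) (fM 0).
have fMC x : `|f x| <= M + C by rewrite (le_trans (fM x))// lerDl.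
have FMC x : `|F x| <= M + C by rewrite (le_trans (smooth3_b0 sm x))// lerDr.
have mf : measurable_fun setT f by exact: continuous_measurable_fun.
have mF : measurable_fun setT F by exact: continuous_measurable_fun.
have [N2 hN2] : exists N, forall n, (N <= n)%N ->
    `|Ex P (fun w => \1_E w * F (xi n w)) - Ex P (fun w => \1_E w * gsmooth F (h2 (Zinf w)) 0)| <= e / 2.
  have /cvgrPdist_le/(_ (e / 2)) := smooth_limit urn m_gt0 mean U_L2 sm mE.
  move=> /(_ (divr_gt0 e0 (ltr0n _ 2)))[N _ hN]; exists N => n Nn.
  by rewrite distrC; exact: hN.
exists (maxn N1 N2) => n; rewrite geq_max => /andP[/hN1[lx hx] /hN2 t2].
have mx := measurable_xi urn n.
have t1 : `|Ex P (fun w => \1_E w * f (xi n w)) - Ex P (fun w => \1_E w * F (xi n w))| <=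
    e / 2 / K * (1 + (Num.sqrt (3 * A) + 1)).
  have lb := L1D (L1_cst P 1) lx.
  apply: le_trans (Ex_weight_le m1 b1 (measurableT_comp mf mx) (measurableT_comp mF mx)
    (fun w => fMC _) (fun w => FMC _) (L1Z _ lb) (fun w => fF _)) _.
  rewrite mul1r (ExZ _ lb) (ExD (L1_cst P 1) lx) Ex_cst ler_wpM2l ?(ltW e10)//.
  by rewrite lerD2l.
have t3 : `|Ex P (fun w => \1_E w * gsmooth F (h2 (Zinf w)) 0) -
    Ex P (fun w => \1_E w * gsmooth f (h2 (Zinf w)) 0)| <= e / 2 / K * (1 + Num.sqrt A * a).
  apply: le_trans (Ex_weight_le m1 b1 (measurable_gsmooth cF FMC mhZ m0)
    (measurable_gsmooth cf fMC mhZ m0) (fun w => gsmooth_bnd _ _ cF FMC)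
    (fun w => gsmooth_bnd _ _ cf fMC) (L1_cst P (e / 2 / K * (1 + Num.sqrt A * a))) _) _; last first.
    by rewrite Ex_cst mul1r.
  move=> w; have /andP[h0 hA] := arr_h2_bnd m_gt0 mean U_L2 (Zinf_itv urn w).
  set s := h2 (Zinf w) in h0 hA *.
  have ma : measurable_fun setT (fun y : measurableTypeR R => 0 + Num.sqrt s * y).
    apply: measurable_funD; first exact: measurable_cst.
    by apply: measurable_funM; [exact: measurable_cst|exact: measurable_id].
  have lF := @L1_bnd _ (measurableTypeR R) R gam _ _ (measurableT_comp mF ma) (fun y => FMC _).
  have lf := @L1_bnd _ (measurableTypeR R) R gam _ _ (measurableT_comp mf ma) (fun y => fMC _).
  have ls := L1Z (Num.sqrt s) l1.
  have lb := L1D (@L1_cst _ (measurableTypeR R) R gam 1) ls.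
  rewrite /gsmooth -(ExB lF lf).
  apply: le_trans (Ex_abs_le _ (L1Z (e / 2 / K) lb) _) _.
  - by apply: measurable_funB; exact: measurableT_comp.
  - move=> y; rewrite distrC; apply: le_trans (fF _) _.
    by rewrite add0r normrM ger0_norm ?sqrtr_ge0.
  - rewrite (ExZ _ lb) (ExD (@L1_cst _ (measurableTypeR R) R gam 1) ls) (Ex_cst gam 1) (ExZ _ l1).
    rewrite ler_wpM2l ?(ltW e10)// lerD2l ler_wpM2r//.
    by rewrite ler_sqrt// (le_trans h0).
apply: le_trans (ler_distD (Ex P (fun w => \1_E w * F (xi n w))) _ _) _.
apply: le_trans (lerD t1 (le_trans (ler_distD _ _ _) (lerD t2 t3))) _.
rewrite [leLHS](_ : _ = e / 2 / K * K + e / 2); last by rewrite /K; ring.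
by rewrite divfK ?gt_eqF// -splitr.
Qed.

End urn_continuous_limit.

(** * Passage to the original hypotheses and conclusion *)

Lemma L1_sqr_moment {d : measure_display} {T : measurableType d} {R : realType}
  (P : probability T R) (Y : {RV P >-> R}) (p : R) : 2 <= p -> (forall w, 0 <= Y w) ->
  ('E_P[(fun w => Y w `^ p)%R] < +oo)%E -> L1 P (fun w => Y w ^+ 2).
Proof.
move=> p2 Y0 Yp.
have mYp : measurable_fun setT (fun w => Y w `^ p).
  exact: (measurableT_comp (measurable_powR p) (measurable_funPT Y)).
have lp : L1 P (fun w => Y w `^ p).
  rewrite /L1; apply/integrableP; split; first exact/measurable_EFinP.
  under eq_integral do rewrite /= ger0_norm ?powR_ge0//.
  by move: Yp; rewrite unlock.
have mY2 : measurable_fun setT (fun w => Y w ^+ 2).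
  by apply: measurable_funX; exact: measurable_funPT.
apply: (L1_dom mY2 (L1D (L1_cst P 1) lp)) => w.
rewrite ger0_norm ?sqr_ge0//.
have [Y1|Y1] := leP (Y w) 1.
  apply: (@le_trans _ _ 1); last by rewrite lerDl powR_ge0.
  by rewrite -[leRHS](expr1n _ 2) lerXn2r// nnegrE.
apply: (@le_trans _ _ (Y w `^ p)); last by rewrite lerDr.
by rewrite -powR_mulrn//; apply: ler_powR => //; exact: ltW.
Qed.

Theorem corollary2p5 (R : realType) (d : measure_display)
  (T : measurableType d) (P : probability T R)
  (y0 : 'I_2 -> R) (U X : nat -> 'I_2 -> {RV P >-> R})
  (urn : reinforced_urn y0 U X)
  (mean_eq : ('E_P[U 1%N type1] = 'E_P[U 1%N type2])%E)
  (mean_gt0 : (0 < 'E_P[U 1%N type1])%E)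
  (p : R) (p_gt2 : 2 < p)
  (U_moment : forall k : 'I_2, ('E_P[(fun w => U 1%N k w `^ p)%R] < +oo)%E)
  (d' : measure_display) (T' : measurableType d') (Q : probability T' R)
  (pr : {mfun T' >-> T}) (Q_ext : prob_extension P Q pr)
  (N : {RV Q >-> R}) (N_normal : standard_normal N)
  (N_indep : indep_of_base pr N) :
  stable_cvg P Q pr
    (fun n w => Num.sqrt n%:R * (urn_N1 X n w / n%:R - urn_Zinf y0 U X w))
    (fun w' => urn_h y0 U X (pr w') * N w').
Proof.
have U_L2 k : L1 P (fun w => U 1%N k w ^+ 2).
  by apply: (L1_sqr_moment (ltW p_gt2)) => // w; exact: urn_U_ge0 urn 0%N k w.
have UL1 := U_L1 U_L2.
pose m := Ex P (fun w => U 1%N type1 w).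
have mean k : Ex P (fun w => U 1%N k w) = m.
  have [->//|->] := ord2_cases k.
  by move: mean_eq; rewrite !expectE// => -[].
have m_gt0 : 0 < m by move: mean_gt0; rewrite expectE// lte_fin.
have meanE k : urn_mean U k = m by rewrite /urn_mean expectE//= mean.
have mU k : measurable_fun setT (U 1%N k) by exact: measurable_funPT.
have sg2E k : urn_sigma2 U k = arr_sg U m k.
  rewrite /urn_sigma2 /arr_sg meanE expectE//.
  have := L1Z (m^-1 ^+ 2) (U_L2 k); congr L1; apply/funext => w.
  by rewrite exprMn mulrC.
have hE w : urn_h y0 U X w = Num.sqrt (arr_h2 U m (urn_Zinf y0 U X w)).
  have /andP[z0 z1] := Zinf_itv urn w.
  rewrite /urn_h !sg2E /arr_h2 [RHS]sqrtrM// mulr_ge0//.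
  by rewrite subr_ge0.
move=> f cf [M0 [_ hM]] E mE.
(* [bounded_fun] provides bounds strictly above [M0] only. *)
have fM x : `|f x| <= M0 + 1 by apply: hM => //; rewrite ltrDl.
have mf : measurable_fun setT f by exact: continuous_measurable_fun.
have m1 : measurable_fun setT (\1_E : T -> R) by exact: measurable_indic.
have b1 w : `|\1_E w : R| <= 1 by rewrite indicE; case: (w \in E); rewrite ?normr0 ?normr1.
have mulB (x y : R) : `|x| <= M0 + 1 -> `|y| <= 1 -> `|x * y| <= M0 + 1.
  by move=> xM y1; rewrite -[leRHS]mulr1 normrM ler_pM.
have mZi := measurable_Zinf urn.
have ms : measurable_fun setT (fun w => Num.sqrt (arr_h2 U m (urn_Zinf y0 U X w))).
  apply: (measurableT_comp (continuous_measurable_fun (@sqrt_continuous R))).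
  exact: (measurableT_comp (measurable_arr_h2 U m)).
(* The limit integrand with base point and normal value as separate variables, so that the latter
   can be integrated out. *)
pose phi (z : T * measurableTypeR R) : R :=
  f (Num.sqrt (arr_h2 U m (urn_Zinf y0 U X z.1)) * z.2) * \1_E z.1.
have mphi : measurable_fun setT phi.
  apply: measurable_funM; last exact: (measurableT_comp m1 measurable_fst).
  apply: (measurableT_comp mf); apply: measurable_funM; last exact: measurable_snd.
  exact: (measurableT_comp ms measurable_fst).
have phiB z : `|phi z| <= M0 + 1 by apply: mulB; [exact: fM|exact: b1].
have [_ phiE] := Ex_extension_normal Q_ext N_normal N_indep mphi phiB.
(* The target becomes an expectation over the original space, in the form of [continuous_limit]. *)
rewrite [X in _ --> X](_ : _ = (Ex P (fun w =>
    \1_E w * gsmooth f (arr_h2 U m (urn_Zinf y0 U X w)) 0))%:E); last first.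
  rewrite (_ : (fun w' => f (urn_h y0 U X (pr w') * N w') * \1_(pr @^-1` E) w') =
    (fun w => phi (pr w, N w))); last first.
    by apply/funext => w; rewrite hE /phi/= !indicE.
  rewrite expectE; last first.
    apply: (@L1_bnd _ _ _ Q _ (M0 + 1)); last by move=> w; exact: phiB.
    have mN : measurable_fun setT (N : T' -> measurableTypeR R) := measurable_funPT N.
    exact: (measurableT_comp mphi (measurable_fun_pair (measurable_funPT pr) mN)).
  congr EFin; rewrite phiE; congr Ex; apply/funext => w.
  rewrite /phi /gsmooth /=; set s := Num.sqrt _.
  have ls : L1 (normal_prob 0 1 : probability (measurableTypeR R) R) (fun y => f (0 + s * y)).
    apply: (@L1_bnd _ (measurableTypeR R) R (normal_prob 0 1) _ (M0 + 1)) => //.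
    apply: (measurableT_comp mf); apply: measurable_funD; first exact: measurable_cst.
    by apply: measurable_funM; [exact: measurable_cst|exact: measurable_id].
  rewrite -(ExZ _ ls); congr Ex; apply/funext => y.
  by rewrite add0r mulrC.
rewrite (_ : (fun n => _) = (fun n => (Ex P (fun w => \1_E w *
   f (Num.sqrt n%:R * (urn_N1 X n w / n%:R - urn_Zinf y0 U X w))))%:E)); last first.
  apply/funext => n; rewrite expectE; last first.
    apply: (@L1_bnd _ _ _ P _ (M0 + 1)); last by move=> w; apply: mulB.
    by apply: measurable_funM => //; apply: (measurableT_comp mf); exact: measurable_xi.
  by congr EFin; congr Ex; apply/funext => w; rewrite mulrC.
apply: cvg_EFin; first exact: nearW.
exact: (continuous_limit urn m_gt0 mean U_L2 cf fM mE).
Qed.
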